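(* Let $\epsilon\in\{1,-1\}$ and let $f\colon M^N=\prod_{i=0}^rM_i\to\mathbb{Q}_\epsilon^N$ be a local isometry of an $N$-dimensional product manifold with a polar metric. Then there exist an extrinsic product $\tilde f\colon\tilde M=\prod_{a=1}^rM_a\to\mathbb{Q}_\epsilon^N\subset\mathbb{E}^{N+1}$ with flat normal bundle, a parallel vector bundle isometry $\phi\colon\tilde M\times\mathbb{E}^s\to N_{\tilde f}\tilde M$ and a local isometry $f_0\colon M_0\to(e_1+\Omega(\tilde f;\phi))\cap\mathbb{Q}_\epsilon^{s-1}\subset\mathbb{E}^s$, where $e_1\in\mathbb{E}^s$ satisfies $\phi_{\tilde p}(e_1)=\tilde f(\tilde p)$ for every $\tilde p\in\tilde M$, such that $f(p_0,\tilde p)=\phi_{\tilde p}(f_0(p_0))$ for all $(p_0,\tilde p)\in M_0\times\tilde M$.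
   Context: Product manifolds are connected. $\mathbb{E}^{N+1}$ denotes $\mathbb{R}^{N+1}$ if $\epsilon=1$ and Lorentzian space $\mathbb{L}^{N+1}$ (signature $(-,+,\dots,+)$) if $\epsilon=-1$; $\mathbb{Q}_\epsilon^N\subset\mathbb{E}^{N+1}$ is the unit sphere if $\epsilon=1$ and hyperbolic space $\{X:\langle X,X\rangle=-1,\ x_1>0\}$ if $\epsilon=-1$; similarly for $\mathbb{E}^s,\mathbb{Q}_\epsilon^{s-1}$. With $\pi_i\colon M\to M_i$ the projections, a Riemannian metric $g$ on $M=\prod_{i=0}^rM_i$ is polar if $g=\pi_0^*g_0+\sum_{a=1}^r\pi_a^*(g_a\circ\pi_0)$ for a Riemannian metric $g_0$ on $M_0$ and smooth families $g_a=(g_a(p_0))_{p_0\in M_0}$ of Riemannian metrics on $M_a$ parametrized by $M_0$, i.e. $g(p)(X,Y)=g_0(\pi_{0*}X,\pi_{0*}Y)+\sum_ag_a(\pi_0(p))(\pi_{a*}X,\pi_{a*}Y)$. Extrinsic products. For $\epsilon=1$: given an orthogonal decomposition $\mathbb{R}^{N+1}=\prod_{a=1}^r\mathbb{R}^{m_a}$ and immersions $f_a\colon M_a\to\mathbb{S}^{m_a-1}(R_a)\subset\mathbb{R}^{m_a}$ into spheres of radius $R_a$ centered at the origin with $\sum_aR_a^2=1$, the extrinsic product is $\tilde f(p_1,\dots,p_r)=(f_1(p_1),\dots,f_r(p_r))$. For $\epsilon=-1$ an extrinsic product is one of the following: (i) given an orthogonal decomposition of $\mathbb{L}^{N+1}$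 into one Lorentzian factor $\mathbb{L}^{m_b}$ (for some index $b$) and Euclidean factors $\mathbb{R}^{m_a}$, $a\ne b$, an immersion $f_b\colon M_b\to\{X\in\mathbb{L}^{m_b}:\langle X,X\rangle=-R_b^2,\ x_1>0\}$ and immersions $f_a\colon M_a\to\mathbb{S}^{m_a-1}(R_a)\subset\mathbb{R}^{m_a}$, $a\neq b$, with $-R_b^2+\sum_{a\ne b}R_a^2=-1$, the map $\tilde f(p_1,\dots,p_r)=(f_1(p_1),\dots,f_r(p_r))$; or (ii) a composition $j\circ(h_1\times\cdots\times h_r)$, where $h_a\colon M_a\to\mathbb{R}^{m_a}$ are immersions, $\prod_a\mathbb{R}^{m_a}=\mathbb{R}^{N-1}$ is an orthogonal decomposition, $(h_1\times\cdots\times h_r)(p_1,\dots,p_r)=(h_1(p_1),\dots,h_r(p_r))$, and $j\colon\mathbb{R}^{N-1}\to\mathbb{H}^N$ is the umbilical isometric inclusion as a horosphere. $N_{\tilde f}\tilde M$ is the normal bundle of $\tilde f$ as an immersion into $\mathbb{E}^{N+1}$ with its normal connection, and $A^{\tilde f}_\xi$ its shape operators, $\langle A^{\tilde f}_\xi X,Y\rangle=\langle\alpha_{\tilde f}(X,Y),\xi\rangle$. A parallel vector bundle isometry $\phi\colon\tilde M\times\mathbb{E}^s\to N_{\tilde f}\tilde M$ is a smooth bundle map such that each $\phi_{\tilde p}=\phi(\tilde p,\cdot)$ is a linear isometry onto the fibre and $\tilde p\mapsto\phi_{\tilde p}(y)$ is parallel in the normal connection for each fixed $y$. $\Omega(\tilde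 f;\phi)=\{Y\in\mathbb{E}^s:\ I-A^{\tilde f}_{\phi_{\tilde p}(Y)}\text{ is nonsingular on }T_{\tilde p}\tilde M\text{ for every }\tilde p\in\tilde M\}$. *)

(* Defs.v *)
From HB Require Import structures.
From mathcomp Require Import all_boot all_order all_algebra.
From mathcomp Require Import all_classical all_reals all_analysis.

Set Implicit Arguments.
Unset Strict Implicit.
Unset Printing Implicit Defensive.

Import Order.TTheory GRing.Theory Num.Theory.
Import numFieldNormedType.Exports.

Local Open Scope classical_set_scope.
Local Open Scope ring_scope.

Section Smooth.
Variables (R : realType) (V W : normedModType R).

(* Meaningful for open [U]: only the values of [F] near points of [U] matter. *)
Fixpoint Cdiff (k : nat) (U : set V) (F : V -> W) : Prop :=
  match k with
  | 0 => forall x, U x -> {for x, continuous F}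
  | k'.+1 => (forall x, U x -> differentiable F x) /\
             (forall v, Cdiff k' U ('D_v F))
  end.

Definition Csmooth (U : set V) (F : V -> W) : Prop := forall k, Cdiff k U F.

End Smooth.

(* An atlas is an indexed family of charts.  Charts are total functions that
   are only relevant on their domain; [cinv i] is the inverse chart, relevant on
   [cmap i @` cdom i].  The record carries data only, so that products need no
   proof; the manifold axioms are the predicate [is_manifold]. *)
Record atlas (R : realType) := Atlas {
  car :> topologicalType;
  mdim : nat;
  idx : Type;
  cdom : idx -> set car;
  cmap : idx -> car -> 'rV[R]_mdim;
  cinv : idx -> 'rV[R]_mdim -> car }.

Arguments cdom {R} a i : rename.
Arguments cmap {R} a i : rename.
Arguments cinv {R} a i : rename.

Definition is_manifold (R : realType) (M : atlas R) : Prop :=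
  [/\ hausdorff_space M,
      @second_countable M,
      (forall p : M, exists i, cdom M i p),
      (forall i,
        [/\ open (cdom M i),
            open (cmap M i @` cdom M i),
            (forall p, cdom M i p -> cinv M i (cmap M i p) = p),
            (forall p, cdom M i p -> {for p, continuous (cmap M i)}) &
            (forall x, (cmap M i @` cdom M i) x ->
               {for x, continuous (cinv M i)})]) &
      (forall i j, Csmooth (cmap M i @` (cdom M i `&` cdom M j))
                           (cmap M j \o cinv M i))].

Section Products.
Variable R : realType.

Definition euclid (k : nat) : atlas R :=
  @Atlas R 'rV[R]_k k unit (fun=> setT) (fun=> id) (fun=> id).

Definition prod2 (M N : atlas R) : atlas R :=
  @Atlas R (M * N)%type (mdim M + mdim N) (idx M * idx N)%type
    (fun c => cdom M c.1 `*` cdom N c.2)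
    (fun c p => row_mx (cmap M c.1 p.1) (cmap N c.2 p.2))
    (fun c x => (cinv M c.1 (lsubmx x), cinv N c.2 (rsubmx x))).

Definition prodn (r : nat) (M : 'I_r -> atlas R) : atlas R :=
  @Atlas R (prod_topology (fun a => car (M a))) (\sum_a mdim (M a))
    (forall a, idx (M a))
    (fun c => [set p | forall a, cdom (M a) (c a) (p a)])
    (fun c p => \mxrow_a cmap (M a) (c a) (p a))
    (fun c x a => cinv (M a) (c a) (submxrow x a)).

End Products.

(* Tangent vectors at [p] are represented by their coordinates in a chart [i]
   around [p]; every notion below is required in all charts. *)
Section Maps.
Variables (R : realType) (M : atlas R) (k : nat).
Implicit Types (F : M -> 'rV[R]_k) (i : idx M) (p : M).

Definition smooth_on (W : set M) F : Prop :=
  forall i, Csmooth (cmap M i @` (cdom M i `&` W)) (F \o cinv M i).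

Definition smooth_map F : Prop := smooth_on setT F.

Definition push F i p (u : 'rV[R]_(mdim M)) : 'rV[R]_k :=
  'D_u (F \o cinv M i) (cmap M i p).

Definition hess F i p (u v : 'rV[R]_(mdim M)) : 'rV[R]_k :=
  'D_u ('D_v (F \o cinv M i)) (cmap M i p).

Definition immersion F : Prop :=
  smooth_map F /\ forall i p, cdom M i p -> injective (push F i p).

End Maps.

Section Metrics.
Variable R : realType.

(* Gram matrices of a field of bilinear forms in the coordinate frames. *)
Definition metric (M : atlas R) := idx M -> M -> 'M[R]_(mdim M).

Definition gval (M : atlas R) (g : metric M) (i : idx M) (p : M)
    (u v : 'rV[R]_(mdim M)) : R :=
  (u *m g i p *m v^T) 0 0.

Definition riemannian (M : atlas R) (g : metric M) : Prop :=
  [/\ (forall i p, cdom M i p -> (g i p)^T = g i p),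
      (forall i p u, cdom M i p -> u != 0 -> 0 < gval g i p u u),
      (forall i, Csmooth (cmap M i @` cdom M i) (g i \o cinv M i)) &
      (forall i j p u v, cdom M i p -> cdom M j p ->
         gval g j p (push (cmap M j) i p u) (push (cmap M j) i p v)
         = gval g i p u v)].

Definition smooth_family (P M : atlas R) (g : P -> metric M) : Prop :=
  (forall q, riemannian (g q)) /\
  (forall c : idx (prod2 P M),
     Csmooth (cmap (prod2 P M) c @` cdom (prod2 P M) c)
       (fun x => let q := cinv (prod2 P M) c x in g q.1 c.2 q.2)).

Definition polar (r : nat) (M0 : atlas R) (M : 'I_r -> atlas R)
    (g0 : metric M0) (ga : forall a, M0 -> metric (M a))
    (g : metric (prod2 M0 (prodn M))) : Prop :=
  [/\ riemannian g,
      riemannian g0,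
      (forall a, smooth_family (ga a)) &
      (forall (c : idx (prod2 M0 (prodn M))) (p : prod2 M0 (prodn M)) X Y,
         cdom (prod2 M0 (prodn M)) c p ->
         gval g c p X Y =
         gval g0 c.1 p.1 (lsubmx X) (lsubmx Y) +
         \sum_a gval (ga a p.1) (c.2 a) (p.2 a)
                  (submxrow (rsubmx X) a) (submxrow (rsubmx Y) a))].

End Metrics.

(* The metric of R^k ([eps] = 1) or L^k ([eps] = -1, first coordinate timelike). *)
Definition ip (R : realType) (eps : R) (k : nat) (x y : 'rV[R]_k) : R :=
  \sum_(i < k) (if val i == 0%N then eps else 1) * x 0 i * y 0 i.

(* [quadric 1 k (a ^+ 2)] is the sphere of radius [a]; [quadric (-1) k (- a ^+ 2)]
   is the upper sheet of the hyperboloid. *)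
Definition quadric (R : realType) (eps : R) (k : nat) (c : R) : set 'rV[R]_k :=
  [set x | ip eps x x = c /\
           (eps = -1 -> forall i : 'I_k, val i = 0%N -> 0 < x 0 i)].

Arguments quadric {R} eps k c.

(* Q_eps^(k-1) in E^k; its tangent space at [x] is the orthogonal of [x]. *)
Definition spaceform (R : realType) (eps : R) (k : nat) : set 'rV[R]_k :=
  quadric eps k eps.

Arguments spaceform {R} eps k.

Definition local_isometry (R : realType) (eps : R) (M : atlas R) (g : metric M)
    (k : nat) (f : M -> 'rV[R]_k) : Prop :=
  [/\ smooth_map f,
      (forall p, spaceform eps k (f p)),
      (forall i p u v, cdom M i p ->
         ip eps (push f i p u) (push f i p v) = gval g i p u v) &
      (forall i p w, cdom M i p -> ip eps (f p) w = 0 ->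
         exists u, push f i p u = w)].

Section Submanifolds.
Variables (R : realType) (eps : R) (M : atlas R) (k : nat).
Variable F : M -> 'rV[R]_k.
Implicit Types (i : idx M) (p : M) (u v : 'rV[R]_(mdim M)) (xi : M -> 'rV[R]_k).

Definition normal_space i p : set 'rV[R]_k :=
  [set w | forall u, ip eps w (push F i p u) = 0].

(* The normal component of [x]: unique as soon as the induced metric is
   nondegenerate, which always holds for immersions into a space form. *)
Definition normal_part i p (x : 'rV[R]_k) : 'rV[R]_k :=
  xget 0 [set w | normal_space i p w /\ range (push F i p) (x - w)].

(* By the Gauss formula, as [u] and [v] extend to coordinate vector fields. *)
Definition second_form i p u v : 'rV[R]_k :=
  normal_part i p (hess F i p u v).

Definition nabla_perp i u xi : M -> 'rV[R]_k :=
  fun p => normal_part i p (push xi i p u).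

(* Curvature of the normal connection on the commuting coordinate fields [u], [v]. *)
Definition curv_perp i u v xi : M -> 'rV[R]_k :=
  fun p => nabla_perp i u (nabla_perp i v xi) p
           - nabla_perp i v (nabla_perp i u xi) p.

Definition normal_field (W : set M) xi : Prop :=
  smooth_on W xi /\
  forall i p, W p -> cdom M i p -> normal_space i p (xi p).

Definition flat_normal_bundle : Prop :=
  forall (W : set M) xi, open W -> normal_field W xi ->
  forall i p u v, W p -> cdom M i p -> curv_perp i u v xi p = 0.

(* [A], acting on row vectors, is the shape operator of [xi] in the chart [i]. *)
Definition is_shape i p (xi : 'rV[R]_k) (A : 'M[R]_(mdim M)) : Prop :=
  forall u v, ip eps (push F i p (u *m A)) (push F i p v)
              = ip eps (second_form i p u v) xi.

Definition parallel_isometry (s : nat) (phi : M -> 'rV[R]_s -> 'rV[R]_k) : Prop :=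
  [/\ smooth_map (fun q : prod2 M (euclid R s) => phi q.1 q.2 : 'rV[R]_k),
      (forall p a y z, phi p (a *: y + z) = a *: phi p y + phi p z),
      (forall p y z, ip eps (phi p y) (phi p z) = ip eps y z),
      (forall i p, cdom M i p -> range (phi p) = normal_space i p) &
      (forall i p u y, cdom M i p -> nabla_perp i u (phi^~ y) p = 0)].

Definition Omega (s : nat) (phi : M -> 'rV[R]_s -> 'rV[R]_k) : set 'rV[R]_s :=
  [set Y | forall i p, cdom M i p ->
     exists2 A, is_shape i p (phi p Y) A & 1%:M - A \in unitmx].

End Submanifolds.

Section ExtrinsicProducts.
Variable R : realType.

(* [iota a] is the inclusion of the [a]-th summand, whose metric has sign [sg a]. *)
Definition orth_decomp (eps : R) (n r : nat) (sg : 'I_r -> R) (m : 'I_r -> nat)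
    (iota : forall a, 'M[R]_(m a, n)) : Prop :=
  [/\ (forall a x y, ip eps (x *m iota a) (y *m iota a) = ip (sg a) x y),
      (forall a b x y, a != b -> ip eps (x *m iota a) (y *m iota b) = 0) &
      (forall z, exists x : forall a, 'rV[R]_(m a), z = \sum_a x a *m iota a)].

Definition quadric_product (eps : R) (n r : nat) (sg : 'I_r -> R)
    (M : 'I_r -> atlas R) (F : prodn M -> 'rV[R]_n) : Prop :=
  exists (m : 'I_r -> nat) (iota : forall a, 'M[R]_(m a, n)) (rad : 'I_r -> R)
         (h : forall a, M a -> 'rV[R]_(m a)),
  [/\ orth_decomp eps sg iota,
      (forall a, 0 < rad a) /\ \sum_a sg a * rad a ^+ 2 = eps,
      (forall a, immersion (h a)),
      (forall a p, quadric (sg a) (m a) (sg a * rad a ^+ 2) (h a p)) &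
      (forall p, F p = \sum_a h a (p a) *m iota a)].

(* Every horosphere of H^n is a slice [<x, w> = -1] for a suitable null vector
   [w].  Umbilicity is expressed in H^n: the second fundamental form of [j] in
   L^(n+1) is that of [j] in H^n plus the metric times the position vector. *)
Definition horosphere_inclusion (l n : nat) (j : 'rV[R]_l -> 'rV[R]_n) : Prop :=
  [/\ immersion (j : euclid R l -> _) /\ injective j,
      (forall x u v, ip (-1) (push (j : euclid R l -> _) tt x u)
                             (push (j : euclid R l -> _) tt x v) = ip 1 u v),
      (exists w, [/\ w != 0, ip (-1) w w = 0 &
         range j = [set x | spaceform (-1) n x /\ ip (-1) x w = -1]]) &
      (forall x, exists eta,
         [/\ normal_space (-1) (j : euclid R l -> _) tt x eta,
             ip (-1) eta (j x) = 0 &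
             forall u v, second_form (-1) (j : euclid R l -> _) tt x u v
                         = ip 1 u v *: (eta + j x)])].

Definition horosphere_product (n r : nat) (M : 'I_r -> atlas R)
    (F : prodn M -> 'rV[R]_n) : Prop :=
  exists (m : 'I_r -> nat) (iota : forall a, 'M[R]_(m a, n.-2))
         (h : forall a, M a -> 'rV[R]_(m a)) (j : 'rV[R]_(n.-2) -> 'rV[R]_n),
  [/\ orth_decomp 1 (fun=> 1) iota,
      (forall a, immersion (h a)),
      horosphere_inclusion j &
      (forall p, F p = j (\sum_a h a (p a) *m iota a))].

(* The ambient space E^n contains the space form of dimension [n - 1]. *)
Definition extrinsic_product (eps : R) (n r : nat) (M : 'I_r -> atlas R)
    (F : prodn M -> 'rV[R]_n) : Prop :=
  (forall p, spaceform eps n (F p)) /\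
  (eps = 1 /\ quadric_product eps (fun=> 1) F \/
   eps = -1 /\
   ((exists b, quadric_product eps (fun a => if a == b then -1 else 1) F) \/
    horosphere_product F)).

End ExtrinsicProducts.

(* Main.v *)
(* For fixed [q] consider along M_0 the frame of E^(N+1) vectors
   [(f, df(e_1), .., df(e_n))] with [e_i] the coordinate fields of M_0.  Since
   g_0 does not depend on [q], Koszul's formula makes the Gram matrix of this
   frame and the coefficients of its derivative along M_0 independent of [q].
   Hence the linear map that carries the frame at [q1] to the frame at [q2] and
   kills the vectors tangent to the other factors is constant along M_0, so that
   [f (p0, q) = f0 p0 *m Phi q], where [Phi q] is the frame at a base point of
   M_0, orthonormalized.  The rows of [Phi] are a parallel frame of the normal
   bundle of [ft = f (q0, _)], which is therefore flat, and [f0] inherits from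
   [f] the property of being a local isometry.

   Koszul's formula also gives that the mixed second derivatives of [ft] along
   two distinct factors vanish.  So the tangent vectors along the a-th factor
   span a subspace U_a that depends only on [a], and the U_a are mutually
   orthogonal.  If their sum is nondegenerate, it extends to an orthogonal
   decomposition of E^(N+1) whose projections split [ft] into immersions of the
   factors, of constant norm because [ft] has constant norm.  Otherwise a null
   vector [w] is orthogonal to every U_a, so [<ft, w>] is constant, [ft] lies in a
   horosphere, and the decomposition takes place in the Euclidean space
   that parametrizes it. *)

(* The engine is that [f] has codimension zero in the space form: [f p] and the tangent vectors at
   [p] span all of E^(N+1), so an ambient vector vanishes as soon as its inner products with them
   do. This turns Koszul's formula, which is intrinsic, into equalities between second derivatives
   in the ambient space. The frame along M_0 has 1 + dim M_0 rows, which is the value of s. As it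
   does not span E^(N+1), a matrix moving frames is determined only once its effect on the
   complement is prescribed; letting it kill the complement makes the local transport matrices
   unique, so they agree on overlaps and connectedness of M_0 glues them. Membership in Omega is a
   regularity statement: by Weingarten, [I - A] for [f0 p0 - e1] followed by the differential of
   [ft] is the differential of [f (p0, _)], which is injective because the metrics g_a(p0) are
   positive definite. For eps = -1 each membership in an upper sheet rests on one fact: two future
   timelike vectors have negative product. Positive dimension of the M_a makes the radii of the
   Euclidean spheres nonzero. *)
Require Import Defs.
From HB Require Import structures.
From mathcomp Require Import all_boot all_order all_algebra.
From mathcomp Require Import perm ring lra.
From mathcomp Require Import all_classical all_reals all_analysis.

Set Implicit Arguments.
Unset Strict Implicit.
Unset Printing Implicit Defensive.

Import Order.TTheory GRing.Theory Num.Theory.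
Import numFieldNormedType.Exports.

Local Open Scope classical_set_scope.
Local Open Scope ring_scope.

(** * Calculus of matrix-valued maps *)

Section Calculus.
Variables (R : realType) (V : normedModType R).
Implicit Types (x v : V) (U : set V).

Lemma differentiable_bigsum (W : normedModType R) (I : Type) (s : seq I)
    (P : pred I) (f : I -> V -> W) x :
  (forall i, P i -> differentiable (f i) x) ->
  differentiable (fun y => \sum_(i <- s | P i) f i y) x.
Proof.
move=> df; elim: s => [|i s IH].
  by rewrite (_ : (fun _ => _) = cst 0) //; apply/funext => y; rewrite big_nil.
rewrite (_ : (fun _ => _) = if P i then fun y => f i y + \sum_(j <- s | P j) f j y
    else fun y => \sum_(j <- s | P j) f j y).
  2: by apply/funext => y; rewrite big_cons; case: (P i).
case: ifP => // Pi; apply: (@differentiableD _ _ _ (f i)) => //; exact: df.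
Qed.

Lemma differentiable_bigprod (I : Type) (s : seq I)
    (P : pred I) (f : I -> V -> R) x :
  (forall i, P i -> differentiable (f i) x) ->
  differentiable (fun y => \prod_(i <- s | P i) f i y) x.
Proof.
move=> df; elim: s => [|i s IH].
  by rewrite (_ : (fun _ => _) = cst 1) //; apply/funext => y; rewrite big_nil.
rewrite (_ : (fun _ => _) = if P i then fun y => f i y * \prod_(j <- s | P j) f j y
    else fun y => \prod_(j <- s | P j) f j y).
  2: by apply/funext => y; rewrite big_cons; case: (P i).
case: ifP => // Pi; apply: (@differentiableM _ _ (f i)) => //; exact: df.
Qed.

Lemma derive_bigsum (W : normedModType R) (I : finType) (f : I -> V -> W) x v :
  (forall i, differentiable (f i) x) ->
  'D_v (fun y => \sum_i f i y) x = \sum_i 'D_v (f i) x.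
Proof.
move=> df; rewrite /index_enum; elim: Finite.enum => [|i s IH].
  rewrite big_nil (_ : (fun _ => _) = cst 0) ?derive_cst//.
  by apply/funext => y; rewrite big_nil.
rewrite big_cons -IH (_ : (fun _ => _) = fun y => f i y + \sum_(j <- s) f j y).
  2: by apply/funext => y; rewrite big_cons.
apply: (@deriveD _ _ _ (f i)); apply: diff_derivable => //.
exact: differentiable_bigsum.
Qed.

Lemma differentiable_mxP m n (F : V -> 'M[R]_(m, n)) x :
  differentiable F x <-> forall i j, differentiable (fun y => F y i j : R^o) x.
Proof.
split=> [dF i j|dF].
  exact: (differentiable_comp dF (differentiable_coord (F x) i j)).
have -> : F = fun y => \sum_i \sum_j F y i j *: delta_mx i j.
  by apply/funext => y; rewrite [LHS]matrix_sum_delta.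
apply: differentiable_bigsum => i _; apply: differentiable_bigsum => j _.
exact: differentiableZl.
Qed.

Lemma derive_mxE m n (F : V -> 'M[R]_(m, n)) x v i j : differentiable F x ->
  'D_v F x i j = 'D_v (fun y => F y i j : R^o) x.
Proof. by move=> dF; rewrite derive_mx ?mxE//; exact: diff_derivable. Qed.

Lemma differentiable_mulmx m n p (F : V -> 'M[R]_(m, n)) (G : V -> 'M[R]_(n, p)) x :
  differentiable F x -> differentiable G x ->
  differentiable (fun y => F y *m G y) x.
Proof.
move=> /differentiable_mxP dF /differentiable_mxP dG.
apply/differentiable_mxP => i j; under eq_fun do rewrite mxE.
apply: differentiable_bigsum => k _.
exact: (@differentiableM _ _ (fun y => F y i k) (fun y => G y k j)).
Qed.

Lemma derive_mulmx m n p (F : V -> 'M[R]_(m, n)) (G : V -> 'M[R]_(n, p)) x v :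
  differentiable F x -> differentiable G x ->
  'D_v (fun y => F y *m G y) x = 'D_v F x *m G x + F x *m 'D_v G x.
Proof.
move=> dF dG; apply/matrixP => i j.
rewrite derive_mxE; last exact: differentiable_mulmx.
under eq_fun do rewrite mxE.
move/differentiable_mxP: (dF) => dF'; move/differentiable_mxP: (dG) => dG'.
rewrite derive_bigsum; last first.
  by move=> k; exact: (@differentiableM _ _ (fun y => F y i k) (fun y => G y k j)).
rewrite !mxE -big_split /=; apply: eq_bigr => k _.
rewrite (@deriveM _ _ (fun y => F y i k) (fun y => G y k j)); try exact: diff_derivable.
by rewrite !derive_mxE// addrC; congr (_ + _); rewrite /GRing.scale /= mulrC.
Qed.

Lemma differentiable_trmx m n (F : V -> 'M[R]_(m, n)) x :
  differentiable F x -> differentiable (fun y => (F y)^T) x.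
Proof.
move=> /differentiable_mxP dF; apply/differentiable_mxP => i j.
by under eq_fun do rewrite mxE.
Qed.

Lemma derive_trmx m n (F : V -> 'M[R]_(m, n)) x v :
  differentiable F x -> 'D_v (fun y => (F y)^T) x = ('D_v F x)^T.
Proof.
move=> dF; apply/matrixP => i j; rewrite derive_mxE ?mxE; last exact: differentiable_trmx.
by rewrite derive_mxE//; under eq_fun do rewrite mxE.
Qed.

Lemma derive_mulmxr m n p (F : V -> 'M[R]_(m, n)) (B : 'M[R]_(n, p)) x v :
  differentiable F x -> 'D_v (fun y => F y *m B) x = 'D_v F x *m B.
Proof.
move=> dF; rewrite (derive_mulmx (G := fun=> B) _ dF (differentiable_cst B x)).
by rewrite (derive_cst B) mulmx0 addr0.
Qed.

Lemma derive_mulmxl m n p (B : 'M[R]_(m, n)) (F : V -> 'M[R]_(n, p)) x v :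
  differentiable F x -> 'D_v (fun y => B *m F y) x = B *m 'D_v F x.
Proof.
move=> dF; rewrite (derive_mulmx (F := fun=> B) _ (differentiable_cst B x) dF).
by rewrite (derive_cst B) mul0mx add0r.
Qed.

Lemma differentiable_mulmxr m n p (F : V -> 'M[R]_(m, n)) (B : 'M[R]_(n, p)) x :
  differentiable F x -> differentiable (fun y => F y *m B) x.
Proof. by move=> dF; apply: differentiable_mulmx => //; exact: (differentiable_cst B). Qed.

(** Both the candidate differential and the little-o remainder depend on the germ only. Charts and
    [invmx] are given by the expected formulas only locally, so this is how differentiability passes
    to the total functions. *)
Lemma near_eq_differentiable (W : normedModType R) (F G : V -> W) x :
  {near x, F =1 G} -> differentiable F x -> differentiable G x.
Proof.
move=> FG dF; have GFx : F x = G x by exact: (nbhs_singleton FG).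
have [cdF eF] := (diff_locallyP _ _).1 dF.
have eG : G \o shift x = cst (G x) + 'd F x +o_ 0 id.
  apply/eqaddoP => e e0; move/eqaddoP/(_ e e0) : eF => eF.
  have FG0 : \forall h \near 0, F (h + x) = G (h + x).
    by move: FG; rewrite (near_shift 0 x) /=; apply: filterS => h /=; rewrite subr0.
  near=> h.
  have -> : (G \o shift x - (cst (G x) + 'd F x)) h =
            (F \o shift x - (cst (F x) + 'd F x)) h.
    by rewrite GFx !fctE /= (near FG0 h).
  by near: h.
have dG : 'd G x = 'd F x :> (V -> W) by exact: diff_unique.
by apply/diff_locallyP; rewrite dG.
Unshelve. all: by end_near. Qed.

Lemma differentiable_det n (F : V -> 'M[R]_n) x :
  differentiable F x -> differentiable (fun y => \det (F y) : R^o) x.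
Proof.
move=> /differentiable_mxP dF; rewrite /determinant.
apply: differentiable_bigsum => s _.
have dp : differentiable (fun y => \prod_i F y i ((s : 'S_n) i)) x.
  by apply: differentiable_bigprod => i _; exact: dF.
exact: (differentiableM (differentiable_cst ((-1) ^+ (s : 'S_n) : R) x) dp).
Qed.

(** Cramer's formula. Since [invmx] returns its argument on singular matrices, it agrees with that
    formula only where [F] is invertible, whence the hypothesis on a neighbourhood. *)
Lemma differentiable_invmx n (F : V -> 'M[R]_n) x :
  differentiable F x -> (\near x, F x \in unitmx) ->
  differentiable (fun y => invmx (F y)) x.
Proof.
move=> dF uF.
apply: (@near_eq_differentiable _ (fun y => (\det (F y))^-1 *: \adj (F y))).
  by apply: filterS uF => y uFy; rewrite /invmx uFy.
apply/differentiable_mxP => i j.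
rewrite (_ : (fun _ => _) = (fun y => (\det (F y))^-1 * cofactor (F y) j i)).
  2: by apply/funext => y; rewrite !mxE.
apply: (@differentiableM _ _ (fun y => (\det (F y))^-1)).
  apply: differentiableV; first exact: differentiable_det.
  by have := nbhs_singleton uF; rewrite unitmxE unitfE.
apply: (@differentiableM _ _ (fun=> (-1) ^+ (j + i))).
  exact: (differentiable_cst ((-1) ^+ (j + i) : R^o)).
apply: differentiable_det; apply/differentiable_mxP => k l.
rewrite (_ : (fun _ => _) = (fun y => F y (lift j k) (lift i l))).
  by move/differentiable_mxP : dF; apply.
by apply/funext => y; rewrite !mxE.
Qed.

Lemma deriveDv (W : normedModType R) (F : V -> W) x u v : differentiable F x ->
  'D_(u + v) F x = 'D_u F x + 'D_v F x.
Proof. by move=> dF; rewrite !deriveE// linearD. Qed.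

Lemma deriveZv (W : normedModType R) (F : V -> W) x a v : differentiable F x ->
  'D_(a *: v) F x = a *: 'D_v F x.
Proof. by move=> dF; rewrite !deriveE// linearZ. Qed.

Lemma differentiable_col_mx m1 m2 n (F : V -> 'M[R]_(m1, n)) (G : V -> 'M[R]_(m2, n)) x :
  differentiable F x -> differentiable G x ->
  differentiable (fun y => col_mx (F y) (G y)) x.
Proof.
move=> /differentiable_mxP dF /differentiable_mxP dG.
apply/differentiable_mxP => i j; case: (split_ordP i) => k ->.
  rewrite (_ : (fun _ => _) = fun y => F y k j); first exact: dF.
  by apply/funext => y; rewrite col_mxEu.
rewrite (_ : (fun _ => _) = fun y => G y k j); first exact: dG.
by apply/funext => y; rewrite col_mxEd.
Qed.

Lemma derive_col_mx m1 m2 n (F : V -> 'M[R]_(m1, n)) (G : V -> 'M[R]_(m2, n)) x v :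
  differentiable F x -> differentiable G x ->
  'D_v (fun y => col_mx (F y) (G y)) x = col_mx ('D_v F x) ('D_v G x).
Proof.
move=> dF dG; have dFG := differentiable_col_mx dF dG.
apply/matrixP => i j; apply: etrans (derive_mxE v i j dFG) _.
case: (split_ordP i) => k ->.
  rewrite col_mxEu; apply: etrans _ (esym (derive_mxE v k j dF)).
  by congr ('D_v _ x); apply/funext => y; rewrite col_mxEu.
rewrite col_mxEd; apply: etrans _ (esym (derive_mxE v k j dG)).
by congr ('D_v _ x); apply/funext => y; rewrite col_mxEd.
Qed.

(* [G] is the Gram matrix of the frame [Z1], and both frames solve the linear
   equation [DZ = (DZ1 J Z1^T) G^-1 Z]; the matrix that is constant here is the
   one that carries [Z1] to [Z2] and kills the orthogonal complement of [Z1]. *)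
Lemma transport_derive0 k n (J : 'M[R]_n) (Z1 Z2 : V -> 'M[R]_(k, n))
    (G : V -> 'M[R]_k) x v :
  J^T = J -> (forall y, G y = Z1 y *m J *m (Z1 y)^T) ->
  differentiable Z1 x -> differentiable Z2 x -> (\near x, G x \in unitmx) ->
  'D_v Z1 x = 'D_v Z1 x *m J *m (Z1 x)^T *m invmx (G x) *m Z1 x ->
  'D_v Z2 x = 'D_v Z1 x *m J *m (Z1 x)^T *m invmx (G x) *m Z2 x ->
  'D_v (fun y => J *m (Z1 y)^T *m invmx (G y) *m Z2 y) x = 0.
Proof.
move=> JT GE dZ1 dZ2 uG; set S := 'D_v Z1 x *m J *m _ => E1 E2.
have dG : differentiable G x.
  rewrite (_ : G = fun y => Z1 y *m J *m (Z1 y)^T); last exact/funext.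
  by apply: differentiable_mulmx; [exact: differentiable_mulmxr|exact: differentiable_trmx].
have GT : (G x)^T = G x by rewrite GE !trmx_mul trmxK JT mulmxA.
have dH := differentiable_invmx dG uG; set H := fun y => invmx (G y) in dH *.
have uGx : G x \in unitmx by exact: (nbhs_singleton uG).
have HT : (H x)^T = H x by rewrite trmx_inv GT.
have DG : 'D_v G x = S + S^T.
  rewrite (_ : G = fun y => Z1 y *m J *m (Z1 y)^T); last exact/funext.
  rewrite derive_mulmx ?derive_mulmxr ?derive_trmx//; last 2 first.
  - exact: differentiable_mulmxr.
  - exact: differentiable_trmx.
  by rewrite /S !trmx_mul trmxK JT mulmxA.
have DH : 'D_v H x = - (H x *m 'D_v G x *m H x).
  have : 'D_v (fun y => H y *m G y) x = 0.
    rewrite (@near_eq_derive _ _ _ _ (fun=> 1%:M)); first exact: (derive_cst 1%:M).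
    by apply: filterS uG => y uy; rewrite /H mulVmx.
  rewrite derive_mulmx// => /eqP; rewrite addr_eq0 => /eqP DHG.
  by rewrite -[LHS](mulmxK uGx) DHG mulNmx.
have dZT := differentiable_trmx dZ1.
have dA : differentiable (fun y => J *m (Z1 y)^T) x.
  by apply: differentiable_mulmx => //; exact: (differentiable_cst J).
rewrite derive_mulmx//; last exact: differentiable_mulmx.
rewrite (derive_mulmx _ dA dH) derive_mulmxl// derive_trmx// DH DG E1 E2.
(* With [S H Z1] for the derivative of [Z1], the product rule gives
   [J Z1^T H (S^T - (S + S^T) + S) H Z2]. *)
rewrite -/(H x) -/S !trmx_mul HT.
rewrite !(mulmxDl, mulmxDr, mulmxN, mulNmx) !mulmxA.
by rewrite opprD addrCA subrr addr0 addNr.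
Qed.

End Calculus.

(** * Smooth functions on open sets and affine changes of variable *)

Section SmoothFunctions.
Variables (R : realType) (V : normedModType R).
Implicit Types (x v : V) (U : set V).

Lemma Cdiff_ext (W : normedModType R) k U (F G : V -> W) : open U ->
  (forall x, U x -> F x = G x) -> Cdiff k U F -> Cdiff k U G.
Proof.
move=> oU; elim: k F G => [|k IH] F G FG.
  move=> cF x Ux; have nFG : {near x, F =1 G}.
    by apply: filterS (open_nbhs_nbhs (conj oU Ux)) => y; exact: FG.
  rewrite /prop_for /continuous_at -(FG _ Ux).
  by apply: cvg_trans (cF x Ux); apply: near_eq_cvg.
have nFG x : U x -> {near x, F =1 G}.
  by move=> Ux; apply: filterS (open_nbhs_nbhs (conj oU Ux)) => y; exact: FG.
move=> [dF cF]; split=> [x Ux|v].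
  exact: (near_eq_differentiable (nFG x Ux) (dF x Ux)).
apply: IH (cF v) => x Ux; exact: near_eq_derive (nFG x Ux).
Qed.

Lemma Cdiff_sub (W : normedModType R) k U U' (F : V -> W) :
  U' `<=` U -> Cdiff k U F -> Cdiff k U' F.
Proof.
move=> sU; elim: k F => [|k IH] F; first by move=> cF x /sU /cF.
by move=> [dF cF]; split=> [x /sU /dF //|v]; exact: IH (cF v).
Qed.

Lemma Cdiff_pred (W : normedModType R) k U (F : V -> W) :
  Cdiff k.+1 U F -> Cdiff k U F.
Proof.
elim: k F => [|k IH] F [dF cF]; first by move=> x /dF /differentiable_continuous.
by split=> // v; exact: IH (cF v).
Qed.

Lemma Csmooth_differentiable (W : normedModType R) U (F : V -> W) x :
  Csmooth U F -> U x -> differentiable F x.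
Proof. by move=> /(_ 1%N)[dF _] /dF. Qed.

Lemma Csmooth_derive (W : normedModType R) U (F : V -> W) v :
  Csmooth U F -> Csmooth U ('D_v F).
Proof. by move=> sF k; case: (sF k.+1) => _; exact. Qed.

Lemma Csmooth_ext (W : normedModType R) U (F G : V -> W) : open U ->
  (forall x, U x -> F x = G x) -> Csmooth U F -> Csmooth U G.
Proof. by move=> oU FG sF k; exact: Cdiff_ext FG (sF k). Qed.

Lemma Csmooth_sub (W : normedModType R) U U' (F : V -> W) :
  U' `<=` U -> Csmooth U F -> Csmooth U' F.
Proof. by move=> sU sF k; exact: Cdiff_sub (sF k). Qed.

Lemma Csmooth_cst (W : normedModType R) U (a : W) : Csmooth U (fun=> a).
Proof.
move=> k; elim: k a => [|k IH] a.
  by move=> x _; exact: cst_continuous.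
split=> [x _|v]; first exact: (differentiable_cst a).
by rewrite (_ : 'D_v _ = fun=> 0) //; apply/funext => x; exact: (derive_cst a).
Qed.

Lemma CdiffD (W : normedModType R) k U (F G : V -> W) : open U ->
  Cdiff k U F -> Cdiff k U G -> Cdiff k U (fun x => F x + G x).
Proof.
move=> oU; elim: k F G => [|k IH] F G.
  by move=> cF cG x Ux; apply: continuousD; [exact: cF|exact: cG].
move=> [dF cF] [dG cG]; split=> [x Ux|v].
  by apply: (@differentiableD _ _ _ F); [exact: dF|exact: dG].
apply: Cdiff_ext (IH _ _ (cF v) (cG v)) => // x Ux.
by rewrite (@deriveD _ _ _ F)//; apply: diff_derivable; [exact: dF|exact: dG].
Qed.

Lemma CdiffM k U (F G : V -> R^o) : open U ->
  Cdiff k U F -> Cdiff k U G -> Cdiff k U (fun x => F x * G x : R^o).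
Proof.
move=> oU; elim: k F G => [|k IH] F G.
  by move=> cF cG x Ux; apply: continuousM; [exact: cF|exact: cG].
move=> CF CG; have [dF cF] := CF; have [dG cG] := CG; split=> [x Ux|v].
  by apply: (@differentiableM _ _ F); [exact: dF|exact: dG].
have C1 := IH _ _ (Cdiff_pred CF) (cG v); have C2 := IH _ _ (Cdiff_pred CG) (cF v).
apply: Cdiff_ext (CdiffD oU C1 C2) => // x Ux.
by rewrite (@deriveM _ _ F)//; apply: diff_derivable; [exact: dF|exact: dG].
Qed.

Lemma CsmoothD (W : normedModType R) U (F G : V -> W) : open U ->
  Csmooth U F -> Csmooth U G -> Csmooth U (fun x => F x + G x).
Proof. by move=> oU sF sG k; exact: CdiffD. Qed.

Lemma CsmoothM U (F G : V -> R^o) : open U ->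
  Csmooth U F -> Csmooth U G -> Csmooth U (fun x => F x * G x : R^o).
Proof. by move=> oU sF sG k; exact: CdiffM. Qed.

Lemma Csmooth_bigsum (W : normedModType R) (I : finType) U (F : I -> V -> W) :
  open U -> (forall i, Csmooth U (F i)) -> Csmooth U (fun x => \sum_i F i x).
Proof.
move=> oU sF; rewrite /index_enum; elim: Finite.enum => [|i s IH].
  rewrite (_ : (fun _ => _) = fun=> 0); first exact: Csmooth_cst.
  by apply/funext => x; rewrite big_nil.
rewrite (_ : (fun _ => _) = fun x => F i x + \sum_(i <- s) F i x).
  exact: CsmoothD.
by apply/funext => x; rewrite big_cons.
Qed.

Lemma Csmooth_mxP m n U (F : V -> 'M[R]_(m, n)) : open U ->
  Csmooth U F <-> forall i j, Csmooth U (fun x => F x i j : R^o).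
Proof.
move=> oU; split=> [sF i j k|sF k].
  elim: k F {sF}(sF k) => [|k IH] F.
    move=> cF x Ux; apply: (@continuous_comp _ _ _ F (fun M : 'M[R]_(m, n) => M i j)).
      exact: cF.
    exact: coord_continuous.
  move=> [dF cF]; split=> [x Ux|v]; first by move/differentiable_mxP : (dF x Ux).
  apply: (@Cdiff_ext _ k U _ _ oU _ (IH _ (cF v))) => x Ux.
  by rewrite derive_mxE//; exact: dF.
(* The entries are taken one degree smoother than the claim, so that differentiability of [F]
   follows entrywise and yields continuity at level 0. *)
elim: k F {sF}(fun i j => sF i j k.+1) => [|k IH] F cF.
  move=> x Ux; apply/differentiable_continuous/differentiable_mxP => i j.
  by case: (cF i j) => + _; exact.
have dF x : U x -> differentiable F x.
  by move=> Ux; apply/differentiable_mxP => i j; case: (cF i j) => + _; exact.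
split=> // v; apply: IH => i j; case: (cF i j) => _ /(_ v) cFij.
apply: (@Cdiff_ext _ k.+1 U _ _ oU _ cFij) => x Ux.
by rewrite derive_mxE//; exact: dF.
Qed.

Lemma Csmooth_mulmx m n p U (F : V -> 'M[R]_(m, n)) (G : V -> 'M[R]_(n, p)) :
  open U -> Csmooth U F -> Csmooth U G -> Csmooth U (fun x => F x *m G x).
Proof.
move=> oU /(Csmooth_mxP _ oU) sF /(Csmooth_mxP _ oU) sG.
apply/(Csmooth_mxP _ oU) => i j.
rewrite (_ : (fun _ => _) = fun x => \sum_k F x i k * G x k j : R^o).
  by apply: Csmooth_bigsum => // k; exact: CsmoothM.
by apply/funext => x; rewrite mxE.
Qed.

Lemma Csmooth_trmx m n U (F : V -> 'M[R]_(m, n)) :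
  open U -> Csmooth U F -> Csmooth U (fun x => (F x)^T).
Proof.
move=> oU /(Csmooth_mxP _ oU) sF; apply/(Csmooth_mxP _ oU) => i j.
rewrite (_ : (fun _ => _) = fun x => F x j i); first exact: sF.
by apply/funext => x; rewrite mxE.
Qed.

Lemma Csmooth_col_mx m1 m2 n U (F : V -> 'M[R]_(m1, n)) (G : V -> 'M[R]_(m2, n)) :
  open U -> Csmooth U F -> Csmooth U G -> Csmooth U (fun x => col_mx (F x) (G x)).
Proof.
move=> oU /(Csmooth_mxP _ oU) sF /(Csmooth_mxP _ oU) sG.
apply/(Csmooth_mxP _ oU) => i j; case: (split_ordP i) => k ->.
  rewrite (_ : (fun _ => _) = fun x => F x k j); first exact: sF.
  by apply/funext => x; rewrite col_mxEu.
rewrite (_ : (fun _ => _) = fun x => G x k j); first exact: sG.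
by apply/funext => x; rewrite col_mxEd.
Qed.

(** The equation has the shape of a difference quotient, so the chain rule [derive_affine] holds for
    every [F], differentiable or not. Linearity of [L] is a consequence of it. *)
Definition affine_along (V' : normedModType R) (A L : V' -> V) :=
  forall h (w y : V'), A (h *: w + y) = h *: L w + A y.

Lemma derive_affine (V' W : normedModType R) (A L : V' -> V) (F : V -> W) (v : V') :
  affine_along A L -> 'D_v (F \o A) = 'D_(L v) F \o A.
Proof. by move=> AL; apply/funext => x; rewrite /derive /= /shift /=; under eq_fun do rewrite AL. Qed.

Lemma derive_affineE (V' W : normedModType R) (A L : V' -> V) (F : V -> W) (v y : V') :
  affine_along A L -> 'D_v (F \o A) y = 'D_(L v) F (A y).
Proof. by move=> AL; have /(congr1 (@^~ y)) := derive_affine F v AL. Qed.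

Lemma Csmooth_comp_affine (V' W : normedModType R) (A L : V' -> V) U (F : V -> W) :
  affine_along A L -> (forall y : V', differentiable A y) ->
  Csmooth U F -> Csmooth (A @^-1` U) (F \o A).
Proof.
move=> AL dA sF k; elim: k F {sF}(sF k) => [|k IH] F.
  move=> cF x Ux; apply: continuous_comp; last exact: cF.
  exact/differentiable_continuous.
move=> [dF cF]; split=> [x Ux|v]; first by apply: differentiable_comp => //; exact: dF.
by rewrite (derive_affine F v AL); exact: IH (cF (L v)).
Qed.

End SmoothFunctions.

Section AffineMaps.
Variable R : realType.

Lemma affine_differentiable m (W : normedModType R) (A L : 'rV[R]_m -> W) x :
  affine_along A L -> differentiable A x.
Proof.
move=> AL.
have LD u v : L (u + v) = L u + L v.
  have := AL 1 u v; have := AL 1 v 0; have := AL 1 (u + v) 0.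
  rewrite !scale1r !addr0 => -> ->; rewrite addrA; exact: addIr.
have LZ a u : L (a *: u) = a *: L u.
  have := AL 1 (a *: u) 0; have := AL a u 0.
  by rewrite !scale1r !addr0 => ->; move/addIr.
have L0 : L 0 = 0 by have := LZ 0 0; rewrite !scale0r.
have LE u : L u = \sum_i u 0 i *: L (delta_mx 0 i).
  rewrite {1}(row_sum_delta u); elim/big_rec2: _ => // i y1 y2 _ <-.
  by rewrite LD LZ.
rewrite (_ : A = fun y => A 0 + \sum_i y 0 i *: L (delta_mx 0 i)).
  apply: (@differentiableD _ _ _ (fun=> A 0)); first exact: (differentiable_cst (A 0)).
  apply: differentiable_bigsum => i _; apply: differentiableZl.
  exact: differentiable_coord.
by apply/funext => y; have := AL 1 y 0; rewrite !scale1r !addr0 -LE addrC.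
Qed.

Lemma Csmooth_affine m (W : normedModType R) (A L : 'rV[R]_m -> W) U :
  affine_along A L -> Csmooth U A.
Proof.
move=> AL [|k].
  by move=> x _; exact/differentiable_continuous/(affine_differentiable _ AL).
split=> [x _|v]; first exact: affine_differentiable AL.
rewrite (_ : 'D_v A = fun=> L v); first exact: Csmooth_cst.
by rewrite -[A]/(idfun \o A) (derive_affine idfun v AL); apply/funext => x /=; exact: derive_id.
Qed.

Lemma derive_affine_id m (W : normedModType R) (A L : 'rV[R]_m -> W) v x :
  affine_along A L -> 'D_v A x = L v.
Proof.
move=> AL; have /(congr1 (@^~ x)) /= := derive_affine idfun v AL.
by rewrite derive_id.
Qed.

End AffineMaps.

(** * Symmetry of second derivatives; maps with vanishing derivative *)

Section SecondDerivatives.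
Variables (R : realType) (V : normedModType R).
Implicit Types (x y u v : V) (U : set V).

Lemma line_MVT (f : V -> R^o) y u (h : R) : 0 <= h ->
  (forall t, 0 <= t <= h -> differentiable f (t *: u + y)) ->
  exists2 t, 0 <= t <= h & f (h *: u + y) - f y = h * 'D_u f (t *: u + y).
Proof.
move=> h0 df; pose A (t : R^o) := t *: u + y.
have AL : affine_along A (fun t : R^o => t *: u).
  by move=> a s t; rewrite /A scalerDl scalerA addrA.
have dA t : differentiable A t.
  have d1 : differentiable (fun t : R^o => t *: u) t by exact: differentiableZl.
  exact: (differentiableD d1 (differentiable_cst y t)).
have fD t : 0 <= t <= h -> is_derive (t : R^o) 1 (f \o A) ('D_u f (A t)).
  move=> ht; apply: DeriveDef.
    by apply: diff_derivable; apply: differentiable_comp => //; exact: df.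
  have /(congr1 (@^~ t)) /= := derive_affine f (1 : R^o) AL.
  by rewrite scale1r.
have fDo t : t \in `]0, h[%R -> is_derive (t : R^o) 1 (f \o A) ('D_u f (A t)).
  by rewrite in_itv /= => /andP[/ltW t0 /ltW th]; apply: fD; rewrite t0 th.
have fC : {within `[0, h], continuous (f \o A : R -> R)}.
  apply: derivable_within_continuous => t; rewrite in_itv /= => /fD[].
  by [].
have [t] := MVT_segment h0 fDo fC.
rewrite in_itv /= => ht e; exists t => //.
by move: e; rewrite /A /= scale0r add0r subr0 mulrC.
Qed.

(** The mean value theorem is applied twice: along [u] to the increment [f (h *: v + y) - f y], then
    along [v] to the derivative of [f] along [u]. The left-hand side is symmetric in [u] and [v],
    which is what makes the mixed derivatives comparable. *)
Lemma second_difference (f : V -> R^o) U x u v (h : R) : 0 <= h ->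
  Csmooth U f ->
  (forall s t, 0 <= s <= h -> 0 <= t <= h -> U (t *: v + (s *: u + x))) ->
  exists s t, [/\ 0 <= s <= h, 0 <= t <= h &
    f (h *: v + (h *: u + x)) - f (h *: u + x) - (f (h *: v + x) - f x) =
    h * (h * 'D_v ('D_u f) (t *: v + (s *: u + x)))].
Proof.
move=> h0 sf hU; pose g y := f (h *: v + y) - f y : R^o.
have U0 s : 0 <= s <= h -> U (s *: u + x).
  by move=> hs; have := hU s 0 hs; rewrite lexx h0 scale0r add0r; exact.
have hh : 0 <= h <= h by rewrite h0 lexx.
have AL : affine_along (fun y => h *: v + y) (id : V -> V).
  by move=> a y z; rewrite addrCA.
have dA (y : V) : differentiable (fun y => h *: v + y) y.
  by apply: (@differentiableD _ _ _ (fun=> h *: v)).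
have df1 s : 0 <= s <= h -> differentiable (fun y => f (h *: v + y)) (s *: u + x).
  move=> hs; apply: (@differentiable_comp _ _ _ _ (fun y => h *: v + y) f) => //.
  by apply: Csmooth_differentiable sf _; exact: hU.
have df s : 0 <= s <= h -> differentiable f (s *: u + x).
  by move=> hs; apply: Csmooth_differentiable sf _; exact: U0.
have dg s : 0 <= s <= h -> differentiable g (s *: u + x).
  by move=> hs; apply: (@differentiableB _ _ _ (fun y => f (h *: v + y))); [exact: df1|exact: df].
have [s hs e1] := line_MVT h0 dg.
have [|t ht e2] := @line_MVT ('D_u f) (s *: u + x) v h h0.
  move=> t ht; apply: Csmooth_differentiable (hU s t hs ht).
  exact: Csmooth_derive.
exists s, t; split => //; rewrite -e2; apply: (etrans e1); congr (h * _).
rewrite (@deriveB _ _ _ (fun y => f (h *: v + y))); last 2 first.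
- by apply: diff_derivable; exact: df1.
- by apply: diff_derivable; exact: df.
congr (_ - _).
by have /(congr1 (@^~ (s *: u + x))) /= := derive_affine f u AL.
Qed.

(** The common value may be attained at two different points, because the two mean value arguments
    for a second difference produce unrelated intermediate points. *)
Lemma continuous_eq_near (a b : V -> R) x :
  {for x, continuous a} -> {for x, continuous b} ->
  (forall d : R, 0 < d ->
     exists y z, [/\ ball x d y, ball x d z & a y = b z]) -> a x = b x.
Proof.
move=> ca cb ab; apply/eqP; rewrite -subr_eq0 -normr_eq0; apply/eqP.
apply: le_anti; rewrite normr_ge0 andbT; apply/ler_addgt0Pr => e e0; rewrite add0r.
have e20 : 0 < e / 2 by rewrite divr_gt0.
move/cvgrPdist_lt/(_ _ e20)/(@nbhs_ballP R V x) : ca => [d1 /= d10 B1].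
move/cvgrPdist_lt/(_ _ e20)/(@nbhs_ballP R V x) : cb => [d2 /= d20 B2].
have d0 : 0 < Num.min d1 d2 by rewrite lt_min d10.
have [y [z [By Bz ayz]]] := ab _ d0.
rewrite -(subrKA (a y)) (splitr e).
apply: (le_trans (ler_normD _ _)); apply: lerD; apply: ltW.
  by apply: B1; apply: le_ball By; rewrite ge_min lexx.
by rewrite ayz distrC; apply: B2; apply: le_ball Bz; rewrite ge_min lexx orbT.
Qed.

Lemma derive_comm_scalar (f : V -> R^o) U x u v : open U -> U x -> Csmooth U f ->
  'D_u ('D_v f) x = 'D_v ('D_u f) x.
Proof.
move=> oU Ux sf; apply: (@continuous_eq_near ('D_u ('D_v f)) ('D_v ('D_u f))).
- exact: (Csmooth_derive u (Csmooth_derive v sf) 0%N x Ux).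
- exact: (Csmooth_derive v (Csmooth_derive u sf) 0%N x Ux).
move=> d1 d10.
have /(@nbhs_ballP R V x)[d2 /= d20 xd] := open_nbhs_nbhs (conj oU Ux).
pose d := Num.min d1 d2.
have d0 : 0 < d by rewrite lt_min d10.
(* The summand 1 keeps [k] positive when both vectors vanish; with [h = d / 2 / k] the parallelogram
   of sides [h *: u] and [h *: v] stays in the open ball of radius [d]. *)
pose k := `|u| + `|v| + 1.
have k0 : 0 < k by rewrite /k ltr_pwDr// addr_ge0.
pose h := d / 2 / k.
have h0 : 0 < h by rewrite /h !divr_gt0.
have hB a b s t : `|a| + `|b| + 1 = k -> 0 <= s <= h -> 0 <= t <= h ->
    ball x d (t *: b + (s *: a + x)).
  move=> kE /andP[s0 sh] /andP[t0 th]; rewrite -ball_normE /ball_ /=.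
  rewrite distrC addrA addrK.
  apply: (@le_lt_trans _ _ (h * k)).
    apply: (le_trans (ler_normD _ _)); rewrite !normrZ (ger0_norm s0) (ger0_norm t0).
    rewrite -kE !mulrDr mulr1 [h * _ + h * _]addrC ler_wpDr ?(ltW h0)//.
    by rewrite lerD// ler_wpM2r.
  by rewrite /h divfK ?gt_eqF// gtr_pMr// invf_lt1// ltr1n.
have hU a b : `|a| + `|b| + 1 = k -> forall s t, 0 <= s <= h -> 0 <= t <= h ->
    U (t *: b + (s *: a + x)).
  move=> kE s t hs ht; apply: xd; apply: le_ball (hB a b s t kE hs ht).
  by rewrite ge_min lexx orbT.
have kE : `|v| + `|u| + 1 = k by rewrite /k [`|v| + _]addrC.
have [s [t [hs ht E1]]] := second_difference (ltW h0) sf (hU u v erefl).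
have [s' [t' [hs' ht' E2]]] := second_difference (ltW h0) sf (hU v u kE).
have dd1 : d <= d1 by rewrite ge_min lexx.
exists (t' *: u + (s' *: v + x)), (t *: v + (s *: u + x)); split.
- exact: le_ball dd1 _ (hB v u s' t' kE hs' ht').
- exact: le_ball dd1 _ (hB u v s t erefl hs ht).
have h0' : h != 0 by rewrite gt_eqF.
move: E1 E2; rewrite (addrCA (h *: v) (h *: u)).
move: ('D_v _ _) ('D_u _ (_ + _)) => a b Ea Eb; apply: (mulfI h0'); apply: (mulfI h0').
by rewrite -Ea -Eb; move: (f _) (f _) (f _) (f _) => p q r w; ring.
Qed.

Lemma derive_comm m n (F : V -> 'M[R]_(m, n)) U x u v : open U -> U x ->
  Csmooth U F -> 'D_u ('D_v F) x = 'D_v ('D_u F) x.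
Proof.
move=> oU Ux sF; apply/matrixP => i j.
have dF y : U y -> differentiable F y by exact: Csmooth_differentiable.
have D1 a : differentiable ('D_a F) x.
  by apply: Csmooth_differentiable Ux; exact: Csmooth_derive.
have E a b : 'D_a ('D_b F) x i j = 'D_a ('D_b (fun y => F y i j : R^o)) x.
  rewrite derive_mxE//; apply: near_eq_derive.
  apply: filterS (open_nbhs_nbhs (conj oU Ux)) => y Uy.
  by rewrite derive_mxE//; exact: dF.
have sFij := (Csmooth_mxP F oU).1 sF i j.
apply: (etrans (E u v)); apply: (etrans _ (esym (E v u))).
exact: (derive_comm_scalar u v oU Ux sFij).
Qed.

(** A ball contained in [U] is convex, so the mean value theorem applies on the segment from its
    centre, entry by entry. *)
Lemma derive0_near_cst m n (F : V -> 'M[R]_(m, n)) U x : open U -> U x ->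
  (forall y, U y -> differentiable F y) ->
  (forall y v, U y -> 'D_v F y = 0) -> \forall y \near x, F y = F x.
Proof.
move=> oU Ux dF F0.
have /(@nbhs_ballP R V x _)[d d0 xd] := open_nbhs_nbhs (conj oU Ux).
apply/nbhs_ballP; exists d => //= y xy; apply/matrixP => i j.
have B t : 0 <= t <= 1 -> U (t *: (y - x) + x).
  move=> /andP[t0 t1]; apply: xd; rewrite -ball_normE /ball_ /=.
  rewrite distrC addrK normrZ ger0_norm//.
  move: xy; rewrite -ball_normE /ball_ /= distrC; apply: le_lt_trans.
  by rewrite ler_piMl.
have [|t ht] := @line_MVT (fun y => F y i j) x (y - x) 1 ler01.
  by move=> t ht; move/differentiable_mxP : (dF _ (B t ht)); exact.
rewrite scale1r subrK mul1r -derive_mxE; last exact/dF/B.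
by rewrite F0 ?mxE; [move/eqP; rewrite subr_eq0 => /eqP|exact: B].
Qed.

End SecondDerivatives.

Lemma connected_loc_cst (T : topologicalType) (X : Type) (f : T -> X) :
  connected [set: T] -> (forall p, \forall q \near p, f q = f p) ->
  forall p q, f p = f q.
Proof.
move=> cT fl p q; pose A := [set z | f z = f p].
suff : A = setT by move=> AT; have : A q by rewrite AT.
have oA : open A.
  rewrite openE => z Az; rewrite /A /= in Az; have := fl z.
  by apply: filterS => w; rewrite Az.
have cA : closed A.
  rewrite -openC openE => z Az; have := fl z.
  by apply: filterS => w wz Aw; apply: Az; rewrite /A /= -wz.
by apply: cT; [exists p|exists A; rewrite ?setTI|exists A; rewrite ?setTI].
Qed.

(** * Inner products and orthogonal decompositions *)

Section InnerProducts.
Variable R : realType.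
Implicit Types eps : R.

Definition ipmx eps k : 'M[R]_k :=
  diag_mx (\row_i (if val i == 0%N then eps else 1)).

Lemma ipE eps k (x y : 'rV[R]_k) : ip eps x y = (x *m ipmx eps k *m y^T) 0 0.
Proof.
rewrite mxE /ip; apply: eq_bigr => i _; rewrite mul_mx_diag !mxE.
by rewrite [x 0 i * _]mulrC.
Qed.

Lemma tr_ipmx eps k : (ipmx eps k)^T = ipmx eps k.
Proof. exact: tr_diag_mx. Qed.

Lemma ipmxK eps k : eps * eps = 1 -> ipmx eps k *m ipmx eps k = 1%:M.
Proof.
move=> ee; rewrite mulmx_diag -diag_const_mx; congr diag_mx.
by apply/rowP => i; rewrite !mxE; case: ifP; rewrite ?mulr1.
Qed.

Lemma ip_mx11 eps k (x y : 'rV[R]_k) : x *m ipmx eps k *m y^T = (ip eps x y)%:M.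
Proof. by rewrite ipE -mx11_scalar. Qed.

Lemma ipC eps k (x y : 'rV[R]_k) : ip eps x y = ip eps y x.
Proof. by apply: eq_bigr => i _; rewrite -!mulrA [x 0 i * _]mulrC. Qed.

Lemma ipDl eps k (x y z : 'rV[R]_k) : ip eps (x + y) z = ip eps x z + ip eps y z.
Proof. by rewrite !ipE !mulmxDl mxE. Qed.

Lemma ipZl eps k a (x z : 'rV[R]_k) : ip eps (a *: x) z = a * ip eps x z.
Proof. by rewrite !ipE -!scalemxAl mxE. Qed.

Lemma ipDr eps k (x y z : 'rV[R]_k) : ip eps z (x + y) = ip eps z x + ip eps z y.
Proof. by rewrite !(ipC _ z) ipDl. Qed.

Lemma ipZr eps k a (x z : 'rV[R]_k) : ip eps z (a *: x) = a * ip eps z x.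
Proof. by rewrite !(ipC _ z) ipZl. Qed.

Lemma ip0l eps k (z : 'rV[R]_k) : ip eps 0 z = 0.
Proof. by rewrite ipE !mul0mx mxE. Qed.

Lemma ip0r eps k (z : 'rV[R]_k) : ip eps z 0 = 0.
Proof. by rewrite ipC ip0l. Qed.

Lemma ipNl eps k (x z : 'rV[R]_k) : ip eps (- x) z = - ip eps x z.
Proof. by rewrite -scaleN1r ipZl mulN1r. Qed.

Lemma ipNr eps k (x z : 'rV[R]_k) : ip eps z (- x) = - ip eps z x.
Proof. by rewrite !(ipC _ z) ipNl. Qed.

Lemma ipBl eps k (x y z : 'rV[R]_k) : ip eps (x - y) z = ip eps x z - ip eps y z.
Proof. by rewrite ipDl ipNl. Qed.

Lemma ipBr eps k (x y z : 'rV[R]_k) : ip eps z (x - y) = ip eps z x - ip eps z y.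
Proof. by rewrite ipDr ipNr. Qed.

Lemma ip_suml eps k (I : finType) (x : I -> 'rV[R]_k) z :
  ip eps (\sum_i x i) z = \sum_i ip eps (x i) z.
Proof.
elim/big_rec2: _ => [|i a b _ <-]; first exact: ip0l.
by rewrite ipDl.
Qed.

Lemma ip_sumr eps k (I : finType) (x : I -> 'rV[R]_k) z :
  ip eps z (\sum_i x i) = \sum_i ip eps z (x i).
Proof. by rewrite ipC ip_suml; apply: eq_bigr => i _; rewrite ipC. Qed.

Lemma ip_nondeg eps k (x : 'rV[R]_k) : eps * eps = 1 ->
  (forall y, ip eps x y = 0) -> x = 0.
Proof.
move=> ee x0; rewrite -[x]mulmx1 -(ipmxK k ee) mulmxA.
suff -> : x *m ipmx eps k = 0 by rewrite mul0mx.
apply/rowP => j; have := x0 (delta_mx 0 j); rewrite ipE trmx_delta -colE.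
by rewrite !mxE.
Qed.

Lemma ip_eq eps k (x y : 'rV[R]_k) : eps * eps = 1 ->
  (forall z, ip eps x z = ip eps y z) -> x = y.
Proof.
move=> ee xy; apply/eqP; rewrite -subr_eq0; apply/eqP; apply: (ip_nondeg ee) => z.
by rewrite ipBl xy subrr.
Qed.

Lemma ip1_ge0 k (x : 'rV[R]_k) : 0 <= ip 1 x x.
Proof. by apply: sumr_ge0 => i _; rewrite if_same mul1r -expr2 sqr_ge0. Qed.

Lemma ip1_gt0 k (x : 'rV[R]_k) : x != 0 -> 0 < ip 1 x x.
Proof.
move=> x0; rewrite lt_def ip1_ge0 andbT; apply: contra x0 => /eqP xx.
apply/eqP/rowP => i; rewrite mxE; apply/eqP; rewrite -sqrf_eq0 expr2.
move/eqP: xx; rewrite psumr_eq0; last by move=> j _; rewrite if_same mul1r -expr2 sqr_ge0.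
by move/allP => /(_ i); rewrite mem_index_enum if_same mul1r; exact.
Qed.

Lemma ip1_CS k (x y : 'rV[R]_k) : ip 1 x y ^+ 2 <= ip 1 x x * ip 1 y y.
Proof.
have [->|y0] := eqVneq y 0; first by rewrite !ip0r expr0n mulr0.
have yy := ip1_gt0 y0.
have := ip1_ge0 (ip 1 y y *: x - ip 1 x y *: y).
rewrite !(ipBl, ipBr, ipZl, ipZr) (ipC 1 y x).
set a := ip 1 x x; set b := ip 1 x y; move: yy; rewrite -/b; move: (ip 1 y y) => c c0.
rewrite (_ : _ - _ = c * (a * c - b ^+ 2)); last by ring.
by rewrite pmulr_rge0// subr_ge0.
Qed.

Lemma ip_lorentz k (x y : 'rV[R]_k.+1) :
  ip (-1) x y = - (x 0 0 * y 0 0) + ip 1 (\row_i x 0 (lift 0 i)) (\row_i y 0 (lift 0 i)).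
Proof.
rewrite /ip big_ord_recl /= mulN1r mulNr; congr (_ + _).
by apply: eq_bigr => i _; rewrite !mxE if_same.
Qed.

(** Orthogonality equates the product of the time coordinates with the product [B] of the spatial
    parts. If [x] were not spacelike, with spatial squares [T] and [X] then [T X] would be smaller
    than the square of [B], against Cauchy-Schwarz. *)
Lemma timelike_orth_gt0 k (t x : 'rV[R]_k) : ip (-1) t t < 0 -> ip (-1) t x = 0 ->
  x != 0 -> 0 < ip (-1) x x.
Proof.
case: k t x => [|k] t x; first by rewrite /ip big_ord0 ltxx.
rewrite !ip_lorentz; have := ip1_CS (\row_i t 0 (lift 0 i)) (\row_i x 0 (lift 0 i)).
have := @ip1_gt0 _ (\row_i x 0 (lift 0 i)).
have := ip1_ge0 (\row_i x 0 (lift 0 i)).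
have := ip1_ge0 (\row_i t 0 (lift 0 i)).
set T := ip 1 _ _; set X := ip 1 _ _; set B := ip 1 _ _.
move=> T0 X0 X1 CS tt tx x0.
have xi : \row_i x 0 (lift 0 i) != 0 -> 0 < X := X1.
have [xE|xN] := eqVneq (\row_i x 0 (lift 0 i)) 0; last first.
  have Xp := xi xN; rewrite ltNge; apply/negP => xx.
  have e1 : T < t 0 0 * t 0 0 by nra.
  have e2 : X <= x 0 0 * x 0 0 by nra.
  have e3 : B = t 0 0 * x 0 0 by nra.
  rewrite e3 in CS; nra.
have B0 : B = 0 by rewrite /B xE ip0r.
have t0 : t 0 0 != 0 by apply/negP => /eqP t0; move: tt; rewrite t0; nra.
have x00 : x 0 0 = 0.
  by move: tx; rewrite B0 addr0 => /eqP; rewrite oppr_eq0 mulf_eq0 (negbTE t0) => /eqP.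
case/negP: x0; apply/eqP/rowP => i; rewrite !mxE.
case: (unliftP 0 i) => [j ->|->] //.
by move/rowP: xE => /(_ j); rewrite !mxE.
Qed.

(** Cauchy-Schwarz on the spatial parts bounds their product strictly by that of the time
    coordinates. This fixes every choice of sheet later on. *)
Lemma future_ip_lt0 k (x y : 'rV[R]_k.+1) : ip (-1) x x < 0 -> ip (-1) y y < 0 ->
  0 < x 0 0 -> 0 < y 0 0 -> ip (-1) x y < 0.
Proof.
rewrite !ip_lorentz; have := ip1_CS (\row_i x 0 (lift 0 i)) (\row_i y 0 (lift 0 i)).
have := ip1_ge0 (\row_i x 0 (lift 0 i)); have := ip1_ge0 (\row_i y 0 (lift 0 i)).
set Y := ip 1 _ _; set X := ip 1 _ _; set B := ip 1 _ _.
move: (x 0 0) (y 0 0) => a b Y0 X0 CS xx yy a0 b0.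
rewrite addrC subr_lt0; apply: (@le_lt_trans _ _ `|B|); first exact: ler_norm.
have ab : 0 < a * b by rewrite mulr_gt0.
rewrite -(@ltr_pXn2r _ 2) ?nnegrE ?normr_ge0 ?(ltW ab)//.
rewrite real_normK ?num_real//; apply: (le_lt_trans CS).
have e1 : X < a * a by lra.
have e2 : Y < b * b by lra.
by rewrite exprMn !expr2; apply: ltr_pM.
Qed.

End InnerProducts.

Section OrthogonalBases.
Variable R : realType.

(** Gram-Schmidt on the rows, from the last to the first. The rows may be dependent: a row whose
    residual vanishes is dropped, so the number of output rows is existential. *)
Lemma orthonormalize n (G : 'M[R]_n) k (A : 'M[R]_(k, n)) : G^T = G ->
  (forall x : 'rV_n, (x <= A)%MS -> x != 0 -> 0 < (x *m G *m x^T) 0 0) ->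
  exists m (B : 'M[R]_(m, n)), B *m G *m B^T = 1%:M /\ (B :=: A)%MS.
Proof.
move=> GT; elim: k A => [|k IH] A Apos.
  exists 0%N, 0; split; first by rewrite [_ *m _]flatmx0; apply/matrixP => -[].
  by rewrite [A]flatmx0; exact: eqmx_refl.
move: A Apos; rewrite -[k.+1]/(1 + k)%N => A Apos.
have Av : A = col_mx (usubmx A) (dsubmx A) by rewrite vsubmxK.
have [] := IH (dsubmx A).
  move=> x xA; apply: Apos; apply: (submx_trans xA).
  by rewrite [X in (_ <= X)%MS]Av -addsmxE addsmxSr.
move=> m [B [BB BA]]; pose a := usubmx A.
have AE : (A :=: a + B)%MS.
  rewrite Av; apply: eqmx_trans (eqmx_sym (addsmxE _ _)) _.
  by apply: adds_eqmx; [exact: eqmx_refl|exact: eqmx_sym].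
pose a' := a - a *m G *m B^T *m B.
have a'B : a' *m G *m B^T = 0.
  by rewrite /a' !mulmxBl -!mulmxA [B *m (G *m _)]mulmxA BB mulmx1 subrr.
have aE : a = a' + a *m G *m B^T *m B by rewrite /a' subrK.
have AE' : (A :=: a' + B)%MS.
  apply: eqmx_trans AE _; apply/eqmxP; rewrite !addsmx_sub !addsmxSr !andbT.
  apply/andP; split.
    by rewrite aE addmx_sub ?addsmxSl// (submx_trans (submxMl _ _))// addsmxSr.
  rewrite /a' addmx_sub ?addsmxSl// eqmx_opp.
  by rewrite (submx_trans (submxMl _ _))// addsmxSr.
have [a'0|a'0] := eqVneq a' 0.
  exists m, B; split=> //; apply: eqmx_sym; apply: eqmx_trans AE' _.
  by rewrite a'0; exact: adds0mx.
have c0 := Apos a'; rewrite AE' addsmxSl in c0; have {}c0 := c0 isT a'0.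
set c := (_ *m _) _ _ in c0.
have sc : Num.sqrt c * Num.sqrt c = c by rewrite -expr2 sqr_sqrtr// ltW.
have s0 : Num.sqrt c != 0 by rewrite gt_eqF// sqrtr_gt0.
exists (1 + m)%N, (col_mx ((Num.sqrt c)^-1 *: a') B); split; last first.
  apply: eqmx_sym; apply: eqmx_trans AE' _; apply: eqmx_trans _ (addsmxE _ _).
  apply: adds_eqmx; last exact: eqmx_refl.
  by apply: eqmx_sym; apply: eqmx_scale; rewrite invr_eq0.
rewrite tr_col_mx mul_col_mx mul_col_row BB -!scalemxAl a'B scaler0.
have -> : B *m G *m ((Num.sqrt c)^-1 *: a')^T = 0.
  apply: trmx_inj; rewrite trmx0 !trmx_mul GT trmxK -scalemxAl.
  by rewrite mulmxA a'B scaler0.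
have -> : (Num.sqrt c)^-1 *: (a' *m G *m ((Num.sqrt c)^-1 *: a')^T) = 1%:M.
  rewrite linearZ /= -scalemxAr scalerA [_ *m a'^T]mx11_scalar -/c.
  rewrite scale_scalar_mx; congr (_%:M).
  by rewrite -[X in _ * X]sc mulrACA !mulVf// mulr1.
by rewrite -scalar_mx_block.
Qed.

End OrthogonalBases.

Section Decompositions.
Variable R : realType.
Implicit Types eps : R.

Lemma mulmx_ipE eps k l n (A : 'M[R]_(k, n)) (B : 'M[R]_(l, n)) i j :
  (A *m ipmx eps n *m B^T) i j = ip eps (row i A) (row j B).
Proof.
rewrite ipE -row_mul mxE [RHS]mxE; apply: eq_bigr => h _.
by rewrite [row i _ _ _]mxE [B^T _ _]mxE [_^T _ _]mxE [row j B _ _]mxE.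
Qed.

Lemma row_mulmx_ip0 eps l n (x : 'rV[R]_n) (B : 'M[R]_(l, n)) :
  (forall j, ip eps x (row j B) = 0) -> x *m ipmx eps n *m B^T = 0.
Proof.
move=> xB; apply/rowP => j; rewrite mulmx_ipE (_ : row 0 x = x) ?xB ?mxE//.
by apply/rowP => i; rewrite mxE.
Qed.

Lemma orth_complement eps k n (S : 'M[R]_(k, n)) : eps * eps = 1 ->
  exists T : 'M[R]_n,
    (forall x : 'rV_n, (x <= T)%MS <-> forall s : 'rV_n, (s <= S)%MS -> ip eps x s = 0) /\
    ((forall x : 'rV_n, (x <= S)%MS -> (x <= T)%MS -> x = 0) ->
     \rank T = (n - \rank S)%N /\
     forall z : 'rV_n, exists s t : 'rV_n, [/\ (s <= S)%MS, (t <= T)%MS & z = s + t]).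
Proof.
move=> ee; pose T := kermx (ipmx eps n *m S^T).
have uJ : ipmx eps n \in unitmx by case: (mulmx1_unit (ipmxK n ee)).
exists T; split=> [x|ST].
  split=> [/sub_kermxP xT s /submxP[w ->]|xS].
    by rewrite ipE trmx_mul mulmxA -(mulmxA x) xT mul0mx mxE.
  apply/sub_kermxP; rewrite mulmxA; apply: row_mulmx_ip0 => j.
  by apply: xS; exact: row_sub.
have rT : \rank T = (n - \rank S)%N.
  by rewrite mxrank_ker -(mxrank_tr S) eqmxMfull// row_full_unit.
have cap0 : (S :&: T)%MS = 0.
  apply/eqP; rewrite -submx0; apply/row_subP => i.
  have := row_sub i (S :&: T)%MS; rewrite sub_capmx => /andP[h1 h2].
  by rewrite (ST _ h1 h2) sub0mx.
split=> // z; have : (z <= S + T)%MS.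
  apply: submx_full; rewrite /row_full.
  have := mxrank_sum_cap S T; rewrite cap0 mxrank0 addn0 => ->.
  by rewrite rT subnKC// rank_leq_col.
by move/sub_addsmxP => [[u1 u2] /= ->]; exists (u1 *m S), (u2 *m T); rewrite !submxMl.
Qed.

Definition mutually_orthogonal eps n r (U : 'I_r -> 'M[R]_n) :=
  forall a b (x y : 'rV_n), a != b -> (x <= U a)%MS -> (y <= U b)%MS -> ip eps x y = 0.

Definition total_family n r (U : 'I_r -> 'M[R]_n) :=
  forall z : 'rV_n, exists2 x : 'I_r -> 'rV[R]_n, forall a, (x a <= U a)%MS & z = \sum_a x a.

(* The complement of the sum of the [U a] is absorbed into the first [U a]; a null
   vector arises when the sum meets its own orthogonal complement. *)
Lemma complete_family eps n r (U : 'I_r -> 'M[R]_n) : eps * eps = 1 -> (0 < r)%N ->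
  mutually_orthogonal eps U ->
  (exists w : 'rV[R]_n, [/\ w != 0, ip eps w w = 0 &
     forall a x, (x <= U a)%MS -> ip eps w x = 0]) \/
  exists U' : 'I_r -> 'M[R]_n, [/\ forall a, (U a <= U' a)%MS,
    mutually_orthogonal eps U' & total_family U'].
Proof.
move=> ee r0 oU; pose S := (\sum_a U a)%MS.
have US a : (U a <= S)%MS by rewrite (sumsmx_sup a).
have [T [TP Tsplit]] := orth_complement S ee.
have [ST|] := pselect (forall x : 'rV_n, (x <= S)%MS -> (x <= T)%MS -> x = 0); last first.
  move/existsNP => [w /not_implyP[wS /not_implyP[wT /eqP w0]]]; left; exists w; split => //.
    by move/TP: wT => /(_ _ wS).
  by move=> a x xU; move/TP: wT; apply; exact: submx_trans xU (US a).
right; pose a0 := Ordinal r0.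
pose U' a := if a == a0 then (U a + T)%MS else U a.
have dec a (x : 'rV_n) : (x <= U' a)%MS -> exists u t : 'rV_n,
    [/\ (u <= U a)%MS, (t <= T)%MS, x = u + t & a != a0 -> t = 0].
  rewrite /U'; case: eqP => [_|_] xU; last first.
    by exists x, 0; rewrite addr0 sub0mx.
  move/sub_addsmxP: xU => [[u1 u2] /= ->].
  by exists (u1 *m U a), (u2 *m T); rewrite !submxMl.
exists U'; split.
- by move=> a; rewrite /U'; case: ifP => // _; exact: addsmxSl.
- move=> a b x y ab /dec[u [t [uU tT -> ta]]] /dec[v [s [vU sT -> sb]]].
  rewrite ipDl !ipDr (oU a b)// (TP t).1//; last exact: submx_trans vU (US b).
  rewrite (ipC _ u) (TP s).1//; last exact: submx_trans uU (US a).
  rewrite !add0r; have [aE|aN] := eqVneq a a0; last by rewrite ta// ip0l.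
  by rewrite sb ?ip0r// -aE eq_sym.
move=> z; have [s [t [sS tT ->]]] := (Tsplit ST).2 z.
move/sub_sumsmxP: sS => [u ->].
exists (fun a => u a *m U a + (if a == a0 then t else 0)).
  move=> a; rewrite /U'; case: ifP => _; last by rewrite addr0 submxMl.
  apply: addmx_sub; first exact: submx_trans (submxMl _ _) (addsmxSl _ _).
  exact: submx_trans tT (addsmxSr _ _).
by rewrite big_split /= -big_mkcond /= big_pred1_eq.
Qed.

(** [Q] carries extra information about the chosen bases through the choice; in the Lorentzian case
    this is the time orientation of the first basis vector. *)
Lemma orth_decomp_of_bases eps n r (sg : 'I_r -> R) (U : 'I_r -> 'M[R]_n)
    (Q : forall a m, 'M[R]_(m, n) -> Prop) :
  mutually_orthogonal eps U -> total_family U ->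
  (forall a, exists m (B : 'M[R]_(m, n)),
    [/\ forall x y, ip eps (x *m B) (y *m B) = ip (sg a) x y, (B :=: U a)%MS & Q a m B]) ->
  exists m (iota : forall a, 'M[R]_(m a, n)), orth_decomp eps sg iota /\
    forall a, (U a <= iota a)%MS /\ Q a (m a) (iota a).
Proof.
move=> oU tU HB; pose m a := sval (cid (HB a)).
pose iota a : 'M[R]_(m a, n) := sval (cid (svalP (cid (HB a)))).
have iotaP a : [/\ forall x y, ip eps (x *m iota a) (y *m iota a) = ip (sg a) x y,
    (iota a :=: U a)%MS & Q a (m a) (iota a)] := svalP (cid (svalP (cid (HB a)))).
exists m, iota; split; last first.
  by move=> a; have [_ e q] := iotaP a; split => //; rewrite e.
split.
- by move=> a x y; have [h _ _] := iotaP a.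
- move=> a b x y ab; have [_ ea _] := iotaP a; have [_ eb _] := iotaP b.
  by apply: (oU a b) => //; rewrite -?ea -?eb submxMl.
move=> z; have [x xU ->] := tU z.
have xP a : exists w, x a = w *m iota a.
  by have [_ ea _] := iotaP a; apply/submxP; rewrite ea.
exists (fun a => sval (cid (xP a))); apply: eq_bigr => a _.
exact: (svalP (cid (xP a))).
Qed.

Lemma positive_basis eps n (U : 'M[R]_n) :
  (forall x : 'rV_n, (x <= U)%MS -> x != 0 -> 0 < ip eps x x) ->
  exists m (B : 'M[R]_(m, n)),
    [/\ forall x y, ip eps (x *m B) (y *m B) = ip 1 x y, B *m ipmx eps n *m B^T = 1%:M
      & (B :=: U)%MS].
Proof.
move=> Upos; have [|m [B [BB BU]]] := @orthonormalize _ _ (ipmx eps n) _ U (tr_ipmx _ _).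
  by move=> x xU x0; rewrite -ipE; exact: Upos.
exists m, B; split => // x y.
rewrite ipE trmx_mul !mulmxA -(mulmxA x) -(mulmxA x) BB mulmx1.
by rewrite mxE /ip; apply: eq_bigr => i _; rewrite !mxE if_same mul1r.
Qed.

Lemma euclidean_decomp n r (U : 'I_r -> 'M[R]_n) : (0 < r)%N ->
  mutually_orthogonal 1 U ->
  exists m (iota : forall a, 'M[R]_(m a, n)), orth_decomp 1 (fun=> 1) iota /\
    forall a, (U a <= iota a)%MS.
Proof.
move=> r0 oU; have [[w [w0 ww _]]|] := complete_family (mulr1 1) r0 oU.
  by have := ip1_gt0 w0; rewrite ww ltxx.
move=> [U' [UU' oU' tU']].
have [|m [iota [dec P]]] := @orth_decomp_of_bases 1 n r (fun=> 1) U' (fun _ _ _ => True) oU' tU'.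
  move=> a; have [x _ x0|m [B [H1 _ H2]]] := @positive_basis 1 n (U' a).
    exact: ip1_gt0.
  by exists m, B.
by exists m, iota; split => // a; have [+ _] := P a; exact: submx_trans.
Qed.

Lemma ipmx_block eps m : ipmx eps (1 + m) = block_mx eps%:M 0 0 1%:M.
Proof.
apply/matrixP => i j; rewrite !mxE.
case: (splitP i) => i' ei; rewrite !mxE; case: (splitP j) => j' ej; rewrite !mxE.
- by rewrite (ord1 i') (ord1 j') /= -val_eqE /= ei ej (ord1 i') (ord1 j') eqxx.
- by rewrite -val_eqE /= ei ej (ord1 i').
- by rewrite -val_eqE /= ei ej (ord1 j').
by rewrite -val_eqE /= ei ej /= eqSS.
Qed.

Lemma lorentz_basis n (U : 'M[R]_n.+1) (t : 'rV[R]_n.+1) : (t <= U)%MS ->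
  ip (-1) t t < 0 ->
  exists m (B : 'M[R]_(m, n.+1)),
    [/\ forall x y, ip (-1) (x *m B) (y *m B) = ip (-1) x y, (B :=: U)%MS &
        forall i : 'I_m, val i = 0%N -> 0 < B i 0].
Proof.
move=> tU tt.
have t00 : t 0 0 != 0.
  apply/negP => /eqP t0; move: tt; rewrite ip_lorentz t0 mul0r oppr0 add0r.
  by rewrite ltNge ip1_ge0.
(* The sign makes [c *: t] future-directed and the square root gives it square -1. *)
pose c := Num.sg (t 0 0) / Num.sqrt (- ip (-1) t t).
have s0 : 0 < Num.sqrt (- ip (-1) t t) by rewrite sqrtr_gt0 oppr_gt0.
pose u := c *: t.
have uU : (u <= U)%MS by exact: scalemx_sub.
have u0 : 0 < u 0 0.
  by rewrite mxE /c mulrAC -normrEsg divr_gt0// normr_gt0.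
have uu : ip (-1) u u = -1.
  rewrite ipZl ipZr mulrA /c mulrACA -expr2 sqr_sg t00 mul1r -invfM -expr2.
  by rewrite sqr_sqrtr ?oppr_ge0 ?ltW// invrN mulNr mulVf// lt_eqF.
have uu0 : ip (-1) u u < 0 by rewrite uu oppr_lt0.
have ee : (-1) * (-1) = 1 :> R by rewrite mulrNN mulr1.
have [T [TP _]] := orth_complement u ee.
have TP' (x : 'rV_n.+1) : (x <= T)%MS <-> ip (-1) x u = 0.
  split=> [/TP|xu]; first by apply; exact: submx_refl.
  by apply/TP => s /sub_rVP[a ->]; rewrite ipZr xu mulr0.
have [|m [B [_ BB BV]]] := @positive_basis (-1) _ (U :&: T)%MS.
  move=> x; rewrite sub_capmx => /andP[xU /TP' xu] x0.
  by apply: timelike_orth_gt0 uu0 _ x0; rewrite ipC.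
have uB : u *m ipmx (-1) n.+1 *m B^T = 0.
  apply: row_mulmx_ip0 => j.
  have : (row j B <= U :&: T)%MS by rewrite -BV row_sub.
  by rewrite sub_capmx => /andP[_ /TP']; rewrite ipC.
exists (1 + m)%N, (col_mx u B); split.
- move=> x y; rewrite !ipE trmx_mul !mulmxA -(mulmxA x) -(mulmxA x).
  congr ((x *m _ *m _) 0 0).
  rewrite tr_col_mx mul_col_mx mul_col_row BB uB ipmx_block; congr block_mx.
    by rewrite ip_mx11 uu.
  by apply: trmx_inj; rewrite !trmx_mul trmxK tr_ipmx mulmxA uB trmx0.
- apply/eqmxP; rewrite col_mx_sub uU BV capmxSl /=.
  apply/row_subP => i; have := row_sub i U; move: (row i U) => x xU.
  (* As [u] has square -1, its orthogonal projection carries a minus sign. *)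
  have -> : x = - ip (-1) x u *: u + (x + ip (-1) x u *: u) by rewrite addrCA scaleNr addNr addr0.
  rewrite -addsmxE; apply: addmx_sub.
    by rewrite (submx_trans _ (addsmxSl _ _))// scalemx_sub.
  rewrite (submx_trans _ (addsmxSr _ _))// BV sub_capmx addmx_sub ?scalemx_sub//=.
  by apply/TP'; rewrite ipDl ipZl uu mulrN1 subrr.
move=> i i0; have -> : i = lshift m 0 by apply: val_inj.
by rewrite col_mxEu.
Qed.

Lemma lorentzian_decomp n r (U : 'I_r -> 'M[R]_n.+1) : (0 < r)%N ->
  mutually_orthogonal (-1) U ->
  (exists w : 'rV[R]_n.+1, [/\ w != 0, ip (-1) w w = 0 &
     forall a x, (x <= U a)%MS -> ip (-1) w x = 0]) \/
  exists b m (iota : forall a, 'M[R]_(m a, n.+1)),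
    [/\ orth_decomp (-1) (fun a => if a == b then -1 else 1) iota,
        forall a, (U a <= iota a)%MS &
        forall i : 'I_(m b), val i = 0%N -> 0 < iota b i 0].
Proof.
move=> r0 oU; have ee : (-1) * (-1) = 1 :> R by rewrite mulrNN mulr1.
have [W|[U' [UU' oU' tU']]] := complete_family ee r0 oU; first by left.
right; have [x xU xE] := tU' (delta_mx 0 0).
(* The Lorentzian summand is found by splitting the timelike unit vector: its square -1 is the sum
   of the squares of its mutually orthogonal components, so one of them is timelike. The other
   summands are orthogonal to that component, hence positive definite. *)
have [b xb] : exists b, ip (-1) (x b) (x b) < 0.
  apply/not_existsP => xge.
  have : ip (-1) (delta_mx 0 0 : 'rV[R]_n.+1) (delta_mx 0 0) < 0.
    rewrite ip_lorentz !mxE !eqxx mulr1 (_ : \row_i _ = 0) ?ip0l ?addr0 ?oppr_lt0//.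
    by apply/rowP => i; rewrite !mxE.
  rewrite xE ip_suml ltNge => /negP; apply; apply: sumr_ge0 => a _.
  rewrite ip_sumr (bigD1 a)//= big1 ?addr0; last first.
    by move=> c ca; apply: (oU' a c) => //; rewrite eq_sym.
  by rewrite leNgt; apply/negP/xge.
exists b.
have [|m [iota [dec P]]] := @orth_decomp_of_bases (-1) n.+1 r
  (fun a => if a == b then -1 else 1) U'
  (fun a m B => a = b -> forall i : 'I_m, val i = 0%N -> 0 < B i 0) oU' tU'.
  move=> a; have [->|ab] := eqVneq a b.
    by have [m [B [h1 h2 h3]]] := lorentz_basis (xU b) xb; exists m, B.
  have [y yU y0|m [B [H1 _ H2]]] := @positive_basis (-1) _ (U' a).
    by apply: timelike_orth_gt0 xb _ y0; apply: (oU' b a) => //; rewrite eq_sym.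
  by exists m, B; split => // ab'; rewrite ab' eqxx in ab.
exists m, iota; split => //; last by have [_ +] := P b; exact.
by move=> a; have [+ _] := P a; exact: submx_trans.
Qed.

(** The adjoint of [x *m iota] for the two inner products. For an isometric inclusion it gives the
    coordinates of the orthogonal projection onto the summand. *)
Definition decomp_proj eps n m (sg : R) (iota : 'M[R]_(m, n)) : 'M[R]_(n, m) :=
  ipmx eps n *m iota^T *m ipmx sg m.

Lemma decomp_projK eps n r (sg : 'I_r -> R) (m : 'I_r -> nat)
    (iota : forall a, 'M[R]_(m a, n)) : (forall a, sg a * sg a = 1) ->
  orth_decomp eps sg iota ->
  [/\ forall a, iota a *m decomp_proj eps (sg a) (iota a) = 1%:M,
      forall a b, a != b -> iota b *m decomp_proj eps (sg a) (iota a) = 0 &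
      forall z : 'rV[R]_n, z = \sum_a z *m decomp_proj eps (sg a) (iota a) *m iota a].
Proof.
move=> ss [io1 io2 io3].
have E1 a : iota a *m decomp_proj eps (sg a) (iota a) = 1%:M.
  rewrite /decomp_proj !mulmxA -(ipmxK _ (ss a)); congr (_ *m _).
  apply/matrixP => i j; rewrite mulmx_ipE !rowE io1 ipE trmx_delta -colE -rowE.
  by rewrite !mxE.
have E2 a b : a != b -> iota b *m decomp_proj eps (sg a) (iota a) = 0.
  move=> ab; rewrite /decomp_proj !mulmxA (_ : _ *m (iota a)^T = 0) ?mul0mx//.
  by apply/matrixP => i j; rewrite mulmx_ipE !rowE io2 ?mxE// eq_sym.
split => // z; have [x {1 2}->] := io3 z.
apply: eq_bigr => a _; congr (_ *m _).
rewrite mulmx_suml (bigD1 a)//= big1 ?addr0; last first.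
  by move=> b ba; rewrite -mulmxA E2 ?mulmx0// eq_sym.
by rewrite -mulmxA E1 mulmx1.
Qed.

End Decompositions.

(** * Charts of products and differentials in charts *)

Section Topology.
Variable R : realType.

Lemma continuous_mxP (T : topologicalType) m n (F : T -> 'M[R]_(m, n)) p :
  (forall i j, {for p, continuous (fun q => F q i j)}) -> {for p, continuous F}.
Proof.
move=> cF; rewrite /prop_for /continuous_at.
apply/cvg_ballP => e e0.
have : \forall q \near p, forall i j, ball (F p i j) e (F q i j).
  apply: filter_forall => i; apply: filter_forall => j.
  by have /cvg_ballP/(_ e e0) := cF i j.
by apply: filterS => q Fq; split.
Qed.

Lemma continuous_linmx m k l (f : 'rV[R]_m -> 'M[R]_(k, l)) (s : 'I_k -> 'I_l -> 'I_m) :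
  (forall x i j, f x i j = x 0 (s i j)) -> continuous f.
Proof.
move=> fE x; apply: continuous_mxP => i j.
rewrite (_ : (fun _ => _) = (fun y : 'rV[R]_m => y 0 (s i j))).
  exact: coord_continuous.
by apply/funext => y; rewrite fE.
Qed.

Lemma continuous_lsubmx m n : continuous (@lsubmx R 1 m n).
Proof.
by apply: (@continuous_linmx _ _ _ _ (fun _ j => lshift n j)) => x i j; rewrite !mxE ord1.
Qed.

Lemma continuous_rsubmx m n : continuous (@rsubmx R 1 m n).
Proof.
by apply: (@continuous_linmx _ _ _ _ (fun _ j => rshift m j)) => x i j; rewrite !mxE ord1.
Qed.

Lemma continuous_submxrow r (m : 'I_r -> nat) a :
  continuous (fun x : 'rV[R]_(\sum_b m b) => submxrow x a).
Proof.
by apply: (@continuous_linmx _ _ _ _ (fun _ j => tagnat.Rank a j)) => x i j; rewrite !mxE ord1.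
Qed.

Lemma continuous_prod_topology (T : topologicalType) (I : eqType) (K : I -> topologicalType)
    (f : T -> prod_topology K) p :
  (forall i, {for p, continuous (fun q => f q i)}) -> {for p, continuous f}.
Proof.
move=> cf; apply/cvg_sup => i A.
rewrite nbhsE => -[B [[C oC <-] Cp] CA].
by apply: filterS CA _; apply: (cf i); exact: open_nbhs_nbhs.
Qed.

End Topology.

Section Charts.
Variable R : realType.

(** The part of [is_manifold] that concerns one chart at a time. It passes to [prod2] and [prodn],
    so products are treated on the same footing as their factors. *)
Definition charts_ok (M : atlas R) : Prop :=
  (forall p : M, exists i, cdom M i p) /\
  forall i,
    [/\ open (cdom M i),
        open (cmap M i @` cdom M i),
        (forall p, cdom M i p -> cinv M i (cmap M i p) = p),
        (forall p, cdom M i p -> {for p, continuous (cmap M i)}) &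
        (forall x, (cmap M i @` cdom M i) x -> {for x, continuous (cinv M i)})].

Lemma manifold_charts_ok (M : atlas R) : is_manifold M -> charts_ok M.
Proof. by case. Qed.

Lemma image_prod2 (M N : atlas R) (c : idx (prod2 M N)) :
  cmap (prod2 M N) c @` cdom (prod2 M N) c =
  (lsubmx @^-1` (cmap M c.1 @` cdom M c.1)) `&` (rsubmx @^-1` (cmap N c.2 @` cdom N c.2)).
Proof.
apply/seteqP; split => [_ [p [p1 p2] <-]|x [[p p1 px] [q q2 qx]]].
  by split; [exists p.1|exists p.2] => //=; rewrite ?row_mxKl ?row_mxKr.
by exists (p, q) => //=; rewrite px qx hsubmxK.
Qed.

Lemma prod2_charts_ok (M N : atlas R) : charts_ok M -> charts_ok N -> charts_ok (prod2 M N).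
Proof.
move=> [cM oM] [cN oN]; split=> [[p q]|[i j]].
  by have [i ip] := cM p; have [j jq] := cN q; exists (i, j).
have [M1 M2 M3 M4 M5] := oM i; have [N1 N2 N3 N4 N5] := oN j; split.
- rewrite /= openE => -[p q] [/= pi qj].
  exists (cdom M i, cdom N j) => //=; split; exact: open_nbhs_nbhs.
- rewrite image_prod2; apply: openI; apply: open_comp => //= x _.
    exact: continuous_lsubmx.
  exact: continuous_rsubmx.
- by move=> [p q] [/= pi qj]; rewrite row_mxKl row_mxKr M3 ?N3.
- move=> [p q] [/= pi qj]; apply: continuous_mxP => a b.
  case: (splitP b) => b' bE.
    have -> : b = lshift (mdim N) b' by apply: val_inj.
    rewrite (_ : (fun _ => _) = (fun x => cmap M i x a b') \o fst); last first.
      by apply/funext => x /=; rewrite row_mxEl.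
    apply: continuous_comp; first exact: cvg_fst.
    apply: (@continuous_comp _ _ _ (cmap M i) (fun x : 'rV[R]__ => x a b')).
      exact: M4.
    exact: coord_continuous.
  have -> : b = rshift (mdim M) b' by apply: val_inj.
  rewrite (_ : (fun _ => _) = (fun x => cmap N j x a b') \o snd); last first.
    by apply/funext => x /=; rewrite row_mxEr.
  apply: continuous_comp; first exact: cvg_snd.
  apply: (@continuous_comp _ _ _ (cmap N j) (fun x : 'rV[R]__ => x a b')).
    exact: N4.
  exact: coord_continuous.
move=> x; rewrite image_prod2 => -[x1 x2].
have c1 : {for x, continuous (cinv M i \o lsubmx)}.
  by apply: continuous_comp; [exact: continuous_lsubmx|exact: M5].
have c2 : {for x, continuous (cinv N j \o rsubmx)}.
  by apply: continuous_comp; [exact: continuous_rsubmx|exact: N5].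
exact: (cvg_pair c1 c2).
Qed.

Lemma image_prodn r (M : 'I_r -> atlas R) (c : idx (prodn M)) :
  cmap (prodn M) c @` cdom (prodn M) c =
  [set x | forall a, (cmap (M a) (c a) @` cdom (M a) (c a)) (submxrow x a)].
Proof.
apply/seteqP; split => [_ [p pc <-] a|x /= xc].
  by exists (p a); rewrite /= ?mxrowK.
exists (fun a => sval (cid2 (xc a))).
  by move=> a; case: cid2.
apply/mxrowP => a; rewrite /= mxrowK; by case: cid2.
Qed.

Lemma open_forall (T : topologicalType) (I : finType) (A : I -> set T) :
  (forall i, open (A i)) -> open [set x | forall i, A i x].
Proof.
move=> oA; rewrite openE => x Ax.
by apply: filter_forall => i; apply: open_nbhs_nbhs; split => //; exact: Ax.
Qed.

Lemma prodn_charts_ok r (M : 'I_r -> atlas R) :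
  (forall a, charts_ok (M a)) -> charts_ok (prodn M).
Proof.
move=> oM; split=> [p|c].
  have H a := (oM a).1 (p a).
  by exists (fun a => sval (cid (H a))) => a; exact: (svalP (cid (H a))).
have H a := (oM a).2 (c a); split.
- apply: open_forall => a; have [M1 _ _ _ _] := H a.
  have pc : continuous (@proj _ M a : prod_topology M -> M a) by exact: proj_continuous.
  exact: (open_comp (fun x _ => pc x) M1).
- rewrite image_prodn; apply: open_forall => a; have [_ M2 _ _ _] := H a.
  apply: (@open_comp _ _ (fun x : 'rV[R]_(\sum_b mdim (M b)) => submxrow x a)) => // x _.
  exact: continuous_submxrow.
- move=> p pc; apply: functional_extensionality_dep => a /=.
  by have [_ _ M3 _ _] := H a; rewrite mxrowK M3.
- move=> p pc; apply: continuous_mxP => i j.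
  rewrite (_ : (fun _ => _) = (fun x => cmap (M (tagnat.sig1 j)) (c (tagnat.sig1 j)) x i (tagnat.sig2 j))
      \o (@proj _ M (tagnat.sig1 j) : prod_topology M -> _)); last first.
    by apply/funext => x; rewrite /= mxE.
  have [_ _ _ M4 _] := H (tagnat.sig1 j).
  apply: continuous_comp; first exact: proj_continuous.
  apply: (@continuous_comp _ _ _ (cmap (M (tagnat.sig1 j)) (c (tagnat.sig1 j)))
     (fun x : 'rV[R]__ => x i (tagnat.sig2 j))).
    by apply: M4; exact: pc.
  exact: coord_continuous.
move=> x; rewrite image_prodn => xc; apply: continuous_prod_topology => a.
have [_ _ _ _ M5] := H a.
apply: (@continuous_comp _ _ _ (fun x : 'rV[R]_(\sum_b mdim (M b)) => submxrow x a)
  (cinv (M a) (c a))); first exact: continuous_submxrow.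
by apply: M5; exact: xc.
Qed.

Lemma chart_cst (M : atlas R) m n (F : M -> 'M[R]_(m, n)) : charts_ok M ->
  connected [set: M] ->
  (forall i p, cdom M i p -> differentiable (F \o cinv M i) (cmap M i p)) ->
  (forall i p v, cdom M i p -> 'D_v (F \o cinv M i) (cmap M i p) = 0) ->
  forall p q, F p = F q.
Proof.
move=> [cM oM] conM dF D0; apply: connected_loc_cst => // p.
have [i ip] := cM p; have [M1 M2 M3 M4 M5] := oM i.
have nF : \forall y \near cmap M i p, (F \o cinv M i) y = (F \o cinv M i) (cmap M i p).
  apply: (derive0_near_cst M2); first by exists p.
    by move=> _ [q qi <-]; exact: dF.
  by move=> _ v [q qi <-]; exact: D0.
have := M4 p ip _ nF; rewrite /= M3//.
have : \forall q \near p, cdom M i q by exact: open_nbhs_nbhs.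
by apply: filterS2 => q qi /=; rewrite M3.
Qed.

End Charts.

HB.lock Definition jac (R : realType) (M : atlas R) k (F : M -> 'rV[R]_k) (i : idx M) (p : M)
    : 'M[R]_(mdim M, k) :=
  \matrix_(j, l) push F i p (delta_mx 0 j) 0 l.

(* The position vector, which is normal to the space form, is the first row. *)
HB.lock Definition frame (R : realType) (M : atlas R) k (F : M -> 'rV[R]_k) (i : idx M) (p : M)
    : 'M[R]_(1 + mdim M, k) :=
  col_mx (F p) (jac F i p).

Section Pushforward.
Variables (R : realType) (M : atlas R) (k : nat).
Hypothesis okM : charts_ok M.
Implicit Types (F : M -> 'rV[R]_k) (i : idx M) (p : M) (u v : 'rV[R]_(mdim M)).

Lemma chart_image_open i : open (cmap M i @` cdom M i).
Proof. by case: (okM.2 i). Qed.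

Lemma chart_invK i p : cdom M i p -> cinv M i (cmap M i p) = p.
Proof. by case: (okM.2 i) => _ _ + _ _; exact. Qed.

Lemma chart_compK (X : Type) (F : M -> X) i p : cdom M i p ->
  (F \o cinv M i) (cmap M i p) = F p.
Proof. by move=> ip /=; rewrite chart_invK. Qed.

Lemma chart_image_mem i p : cdom M i p -> (cmap M i @` cdom M i) (cmap M i p).
Proof. by move=> ip; exists p. Qed.

Lemma chart_image_invK i x : (cmap M i @` cdom M i) x -> cmap M i (cinv M i x) = x.
Proof. by move=> [p ip <-]; rewrite chart_invK. Qed.

Lemma chart_image_inv i x : (cmap M i @` cdom M i) x -> cdom M i (cinv M i x).
Proof. by move=> [p ip <-]; rewrite chart_invK. Qed.

Lemma smooth_mapP F :
  smooth_map F <-> forall i, Csmooth (cmap M i @` cdom M i) (F \o cinv M i).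
Proof. by split=> sF i; have := sF i; rewrite setIT. Qed.

Lemma smooth_chart_differentiable F i p : smooth_map F -> cdom M i p ->
  differentiable (F \o cinv M i) (cmap M i p).
Proof.
move=> /smooth_mapP sF ip.
by apply: Csmooth_differentiable (sF i) _; exact: chart_image_mem.
Qed.

Lemma pushD F i p u v : smooth_map F -> cdom M i p ->
  push F i p (u + v) = push F i p u + push F i p v.
Proof. by move=> sF ip; apply: deriveDv; exact: smooth_chart_differentiable. Qed.

Lemma pushZ F i p a u : smooth_map F -> cdom M i p ->
  push F i p (a *: u) = a *: push F i p u.
Proof. by move=> sF ip; apply: deriveZv; exact: smooth_chart_differentiable. Qed.

Lemma push0 F i p : push F i p 0 = 0.
Proof. exact: derive0. Qed.

Lemma push_sum (I : finType) F i p (u : I -> 'rV[R]_(mdim M)) : smooth_map F -> cdom M i p ->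
  push F i p (\sum_j u j) = \sum_j push F i p (u j).
Proof.
move=> sF ip; elim/big_rec2: _ => [|j a b _ <-]; first exact: push0.
by rewrite pushD.
Qed.

Lemma push_delta F i p u : smooth_map F -> cdom M i p ->
  push F i p u = \sum_j u 0 j *: push F i p (delta_mx 0 j).
Proof.
move=> sF ip; rewrite {1}(row_sum_delta u) push_sum//.
by apply: eq_bigr => j _; rewrite pushZ.
Qed.

Lemma jacE F i p j l : jac F i p j l = push F i p (delta_mx 0 j) 0 l.
Proof. by rewrite unlock mxE. Qed.

Lemma row_jac F i p j : row j (jac F i p) = push F i p (delta_mx 0 j).
Proof. by apply/rowP => l; rewrite mxE jacE. Qed.

Lemma push_jac F i p u : smooth_map F -> cdom M i p -> push F i p u = u *m jac F i p.
Proof.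
move=> sF ip; rewrite push_delta//; apply/rowP => l; rewrite summxE mxE.
by apply: eq_bigr => j _; rewrite mxE jacE.
Qed.

Lemma smooth_mulmxr l F (B : 'M[R]_(k, l)) : smooth_map F -> smooth_map (fun p => F p *m B).
Proof.
move=> /smooth_mapP sF i; rewrite setIT.
by apply: Csmooth_mulmx (sF i) (Csmooth_cst _ B); exact: chart_image_open.
Qed.

Lemma push_mulmxr l F (B : 'M[R]_(k, l)) i p u : smooth_map F -> cdom M i p ->
  push (fun q => F q *m B) i p u = push F i p u *m B.
Proof.
by move=> sF ip; apply: (derive_mulmxr B); exact: smooth_chart_differentiable.
Qed.

Lemma hess_comm F i p u v : smooth_map F -> cdom M i p -> hess F i p u v = hess F i p v u.
Proof.
move=> /smooth_mapP sF ip.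
exact: (derive_comm u v (@chart_image_open i) (chart_image_mem ip) (sF i)).
Qed.

Lemma jac_chart F i x j l : (cmap M i @` cdom M i) x ->
  jac F i (cinv M i x) j l = 'D_(delta_mx 0 j) (F \o cinv M i) x 0 l.
Proof. by move=> ix; rewrite jacE /push chart_image_invK. Qed.

Lemma Csmooth_jac F i : smooth_map F ->
  Csmooth (cmap M i @` cdom M i) (jac F i \o cinv M i).
Proof.
move=> /smooth_mapP sF; apply/(Csmooth_mxP _ (@chart_image_open i)) => j l.
have sD := Csmooth_derive (delta_mx 0 j) (sF i).
have := (Csmooth_mxP _ (@chart_image_open i)).1 sD 0 l.
by apply: Csmooth_ext (@chart_image_open i) _ => x ix; rewrite /= jac_chart.
Qed.

Lemma chart_image_near i p : cdom M i p ->
  \forall x \near cmap M i p, (cmap M i @` cdom M i) x.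
Proof.
by move=> ip; apply: open_nbhs_nbhs; split; [exact: chart_image_open|exact: chart_image_mem].
Qed.

Lemma row_derive_jac F i p u j : smooth_map F -> cdom M i p ->
  row j ('D_u (jac F i \o cinv M i) (cmap M i p)) = hess F i p u (delta_mx 0 j).
Proof.
move=> sF ip; have sJ := Csmooth_jac i sF.
have sD := Csmooth_derive (delta_mx 0 j) ((smooth_mapP F).1 sF i).
apply/rowP => l; rewrite mxE derive_mxE; last exact: (Csmooth_differentiable sJ (chart_image_mem ip)).
rewrite /hess derive_mxE; last exact: (Csmooth_differentiable sD (chart_image_mem ip)).
apply: near_eq_derive; apply: filterS (chart_image_near ip) => x ix.
exact: jac_chart.
Qed.

Lemma frameE F i p : frame F i p = col_mx (F p) (jac F i p).
Proof. by rewrite unlock. Qed.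

Lemma row_frame F i p j : row j (frame F i p) =
  match fintype.split j with inl _ => F p | inr j' => push F i p (delta_mx 0 j') end.
Proof.
rewrite frameE; case: (split_ordP j) => h ->.
  by rewrite rowKu (ord1 h); apply/rowP => l; rewrite mxE.
by rewrite rowKd row_jac.
Qed.

Lemma frame_comp F i : frame F i \o cinv M i =
  fun x => col_mx ((F \o cinv M i) x) ((jac F i \o cinv M i) x).
Proof. by apply/funext => x; rewrite /= frameE. Qed.

Lemma Csmooth_frame F i : smooth_map F ->
  Csmooth (cmap M i @` cdom M i) (frame F i \o cinv M i).
Proof.
move=> sF; rewrite frame_comp; apply: Csmooth_col_mx.
- exact: chart_image_open.
- exact: ((smooth_mapP F).1 sF i).
exact: Csmooth_jac.
Qed.

Lemma row_derive_frame F i p u j : smooth_map F -> cdom M i p ->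
  row j ('D_u (frame F i \o cinv M i) (cmap M i p)) =
  match fintype.split j with inl _ => push F i p u
                           | inr j' => hess F i p u (delta_mx 0 j') end.
Proof.
move=> sF ip; have d1 := smooth_chart_differentiable sF ip.
have d2 := Csmooth_differentiable (Csmooth_jac i sF) (chart_image_mem ip).
rewrite frame_comp (derive_col_mx u d1 d2); case: (split_ordP j) => h ->.
  by rewrite rowKu (ord1 h); apply/rowP => l; rewrite mxE.
by rewrite rowKd (row_derive_jac u h sF ip).
Qed.

Lemma mul_frame F i p (w : 'rV[R]_(1 + mdim M)) : smooth_map F -> cdom M i p ->
  w *m frame F i p = w 0 0 *: F p + push F i p (rsubmx w).
Proof.
move=> sF ip; rewrite frameE -{1}(hsubmxK w) mul_row_col (push_jac _ sF ip).
congr (_ + _); rewrite [lsubmx w]mx11_scalar mul_scalar_mx; congr (_ *: _).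
by rewrite mxE; congr (w _ _); apply: val_inj.
Qed.

(** Equality near [p] on the manifold becomes equality near the coordinates of [p] through the
    continuity of [cinv]. *)
Lemma push_near F G i p u : (\forall q \near p, F q = G q) -> cdom M i p ->
  push F i p u = push G i p u.
Proof.
move=> FG ip; apply: near_eq_derive.
case: (okM.2 i) => _ _ _ _ /(_ _ (chart_image_mem ip)) ci.
by apply: (ci (fun q => F q = G q)); rewrite chart_invK.
Qed.

End Pushforward.

(** * Inclusions of factors into products, read in charts *)

Section Slices.
Variable R : realType.

(* In the charts [i] and [j] the map [f] is the affine map [A], with linear part [L]. *)
Definition slice (N M : atlas R) (f : N -> M) (i : idx N) (j : idx M)
    (A L : 'rV[R]_(mdim N) -> 'rV[R]_(mdim M)) :=
  [/\ affine_along A L,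
      forall x, cinv M j (A x) = f (cinv N i x) &
      forall p, cdom N i p -> cdom M j (f p) /\ A (cmap N i p) = cmap M j (f p)].

Section SliceTheory.
Variables (N M : atlas R) (f : N -> M) (i : idx N) (j : idx M).
Variables (A L : 'rV[R]_(mdim N) -> 'rV[R]_(mdim M)).
Hypothesis fA : slice f i j A L.

Lemma slice_comp (X : Type) (F : M -> X) : F \o f \o cinv N i = (F \o cinv M j) \o A.
Proof. by case: fA => _ e _; apply/funext => x /=; rewrite e. Qed.

Lemma slice_derive (X : normedModType R) (F : M -> X) u p : cdom N i p ->
  'D_u (F \o f \o cinv N i) (cmap N i p) = 'D_(L u) (F \o cinv M j) (cmap M j (f p)).
Proof.
move=> ip; have [AL _ /(_ p ip)[_ <-]] := fA.
by rewrite slice_comp (derive_affineE _ u _ AL).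
Qed.

Lemma slice_push k (F : M -> 'rV[R]_k) u p : cdom N i p ->
  push (F \o f) i p u = push F j (f p) (L u).
Proof. exact: slice_derive. Qed.

Lemma slice_hess k (F : M -> 'rV[R]_k) u v p : cdom N i p ->
  hess (F \o f) i p u v = hess F j (f p) (L u) (L v).
Proof.
move=> ip; have [AL _ /(_ p ip)[_ e]] := fA.
by rewrite /hess slice_comp (derive_affine _ v AL) (derive_affineE _ u _ AL) e.
Qed.

Lemma slice_Csmooth (X : normedModType R) (F : M -> X) :
  Csmooth (cmap M j @` cdom M j) (F \o cinv M j) ->
  Csmooth (cmap N i @` cdom N i) (F \o f \o cinv N i).
Proof.
move=> sF; rewrite slice_comp; have [AL _ Af] := fA.
apply: Csmooth_sub (Csmooth_comp_affine AL (fun y => affine_differentiable y AL) sF).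
by move=> _ [p ip <-]; have [h e] := Af p ip; rewrite /preimage /= e; exists (f p).
Qed.

End SliceTheory.

Lemma slice_smooth (N M : atlas R) (f : N -> M) k (F : M -> 'rV[R]_k) :
  (forall i, exists j A L, slice f i j A L) -> smooth_map F -> smooth_map (F \o f).
Proof.
move=> H /smooth_mapP sF; apply/smooth_mapP => i.
have [j [A [L fA]]] := H i; exact: (slice_Csmooth fA (sF j)).
Qed.

Lemma slice_left (M N : atlas R) (i : idx M) (j : idx N) (q : N) :
  charts_ok N -> cdom N j q ->
  @slice M (prod2 M N) (fun p => (p, q)) i (i, j)
    (fun x => row_mx x (cmap N j q)) (fun u => row_mx u 0).
Proof.
move=> okN jq; split=> [h w y|x|p ip //].
  by rewrite scale_row_mx scaler0 add_row_mx add0r.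
by rewrite /= row_mxKl row_mxKr chart_invK.
Qed.

Lemma slice_right (M N : atlas R) (i : idx M) (j : idx N) (p : M) :
  charts_ok M -> cdom M i p ->
  @slice N (prod2 M N) (fun q => (p, q)) j (i, j)
    (fun x => row_mx (cmap M i p) x) (fun u => row_mx 0 u).
Proof.
move=> okM ip; split=> [h w y|x|q jq //].
  by rewrite scale_row_mx scaler0 add_row_mx add0r.
by rewrite /= row_mxKl row_mxKr chart_invK.
Qed.

Definition block r (m : 'I_r -> nat) a (u : 'rV[R]_(m a)) : 'rV[R]_(\sum_b m b) :=
  \mxrow_b dfwith (fun b => 0 : 'rV[R]_(m b)) a u b.

Arguments block {r m} a u.

Lemma block_affine r (m : 'I_r -> nat) a (x0 : forall b, 'rV[R]_(m b)) :
  affine_along (fun x : 'rV[R]_(m a) => \mxrow_b dfwith x0 a x b : 'rV[R]_(\sum_b m b))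
    (block a).
Proof.
move=> h w y; apply/mxrowP => b; rewrite mxrowK submxrowD.
have -> : submxrow (h *: block a w) b = h *: submxrow (block a w) b.
  by apply/rowP => l; rewrite !mxE.
rewrite !mxrowK; have [<-|ab] := eqVneq a b; first by rewrite !dfwithin.
by rewrite !dfwithout// scaler0 add0r.
Qed.

(** The chart of the product changes in the a-th slot too: [z] runs through the chart [i] of the
    a-th factor, which need not contain [p a]. *)
Lemma slice_dfwith r (M : 'I_r -> atlas R) (c : idx (prodn M)) (p : prodn M) a (i : idx (M a)) :
  (forall b, charts_ok (M b)) -> cdom (prodn M) c p ->
  @slice (M a) (prodn M) (fun z => dfwith p a z) i (dfwith c a i)
    (fun x => \mxrow_b dfwith (fun b => cmap (M b) (c b) (p b)) a x b) (block a).
Proof.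
move=> okM cp; split.
- exact: block_affine.
- move=> x; apply: functional_extensionality_dep => b /=; rewrite mxrowK.
  have [<-|ab] := eqVneq a b; first by rewrite !dfwithin.
  by rewrite !dfwithout// chart_invK.
move=> z iz; split.
  move=> b; have [<-|ab] := eqVneq a b; first by rewrite !dfwithin.
  by rewrite !dfwithout.
apply: eq_mxrow => b; have [<-|ab] := eqVneq a b; first by rewrite !dfwithin.
by rewrite !dfwithout.
Qed.

Lemma sum_block r (m : 'I_r -> nat) (v : 'rV[R]_(\sum_b m b)) :
  v = \sum_a block a (submxrow v a).
Proof.
apply/mxrowP => b; rewrite submxrow_sum (bigD1 b)//= mxrowK dfwithin big1 ?addr0//.
by move=> a ab; rewrite mxrowK dfwithout.
Qed.

Lemma submxrow_block r (m : 'I_r -> nat) a (u : 'rV[R]_(m a)) b :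
  submxrow (block a u) b = dfwith (fun b => 0 : 'rV[R]_(m b)) a u b.
Proof. exact: mxrowK. Qed.

End Slices.

Arguments block {R r m} a u.

(** * Local isometries of polar metrics *)

Section InnerProductCalculus.
Variables (R : realType) (V : normedModType R).

Lemma derive_ip eps k (F G : V -> 'rV[R]_k) x v :
  differentiable F x -> differentiable G x ->
  'D_v (fun y => ip eps (F y) (G y) : R^o) x =
  ip eps ('D_v F x) (G x) + ip eps (F x) ('D_v G x).
Proof.
move=> dF dG.
have -> : (fun y => ip eps (F y) (G y) : R^o) =
          (fun y => (F y *m ipmx eps k *m (G y)^T) 0 0 : R^o).
  by apply/funext => y; rewrite ipE.
have d1 := differentiable_mulmxr (ipmx eps k) dF.
have d2 := differentiable_trmx dG.
rewrite -derive_mxE; last exact: differentiable_mulmx.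
by rewrite derive_mulmx// derive_mulmxr// derive_trmx// !ipE mxE.
Qed.

End InnerProductCalculus.

Lemma dfwith_id (I : eqType) (T : I -> Type) (f : forall i, T i) i : dfwith f i (f i) = f.
Proof.
apply: functional_extensionality_dep => j.
by have [<-|ij] := eqVneq i j; rewrite ?dfwithin ?dfwithout.
Qed.

Section GramValues.
Variables (R : realType) (M : atlas R) (g : metric M).

Lemma gval0l i p v : gval g i p 0 v = 0.
Proof. by rewrite /gval !mul0mx mxE. Qed.

Lemma gval0r i p u : gval g i p u 0 = 0.
Proof. by rewrite /gval trmx0 mulmx0 mxE. Qed.

End GramValues.

Section PolarGeometry.
Variables (R : realType) (eps : R) (r : nat) (M0 : atlas R) (M : 'I_r -> atlas R).
Variables (g0 : metric M0) (ga : forall a : 'I_r, M0 -> metric (M a)).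
Variables (g : metric (prod2 M0 (prodn M))).
Arguments ga : clear implicits.
Variable f : prod2 M0 (prodn M) -> 'rV[R]_(mdim (prod2 M0 (prodn M))).+1.
Hypothesis ee : eps * eps = 1.
Hypothesis okM0 : charts_ok M0.
Hypothesis okM : forall a, charts_ok (M a).
Hypothesis polg : polar g0 ga g.
Hypothesis isof : local_isometry eps g f.

Local Notation P := (prod2 M0 (prodn M)).

Let okMt : charts_ok (prodn M) := prodn_charts_ok okM.
Let okP : charts_ok P := prod2_charts_ok okM0 okMt.

(* In the names below, h marks vectors tangent to [M0] and v vectors tangent to
   the other factors. *)
Definition polar_gram (c : idx P) (p : P) (X Y : 'rV[R]_(mdim P)) : R :=
  gval g0 c.1 p.1 (lsubmx X) (lsubmx Y) +
  \sum_a gval (ga a p.1) (c.2 a) (p.2 a)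
     (submxrow (rsubmx X) a) (submxrow (rsubmx Y) a).

Let sf : smooth_map f. Proof. by case: isof. Qed.

Lemma ip_ff p : ip eps (f p) (f p) = eps.
Proof. by case: isof => _ /(_ p)[]. Qed.

Lemma ip_push_push c p X Y : cdom P c p ->
  ip eps (push f c p X) (push f c p Y) = polar_gram c p X Y.
Proof. by move=> cp; case: isof => _ _ -> // _; case: polg => _ _ _ ->. Qed.

Lemma push_onto c p w : cdom P c p -> ip eps (f p) w = 0 -> exists X, push f c p X = w.
Proof. by move=> cp; case: isof => _ _ _; apply. Qed.

Lemma chart_diff c p : cdom P c p -> differentiable (f \o cinv P c) (cmap P c p).
Proof. exact: smooth_chart_differentiable. Qed.

Lemma chart_diff2 c p X : cdom P c p -> differentiable ('D_X (f \o cinv P c)) (cmap P c p).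
Proof.
move=> cp; have sfc := Csmooth_derive X ((smooth_mapP f).1 sf c).
exact: (Csmooth_differentiable sfc (chart_image_mem cp)).
Qed.

Lemma ip_push_f c p X : cdom P c p -> ip eps (push f c p X) (f p) = 0.
Proof.
move=> cp; have := derive_ip eps X (chart_diff cp) (chart_diff cp).
rewrite (_ : (fun _ => _) = fun=> eps); last by apply/funext => x /=; rewrite ip_ff.
rewrite (derive_cst (eps : R^o)) (chart_compK okP)// -/(push f c p X) (ipC _ (f p)).
by move=> /esym e; move: e; rewrite -mulr2n => /eqP; rewrite mulrn_eq0 => /eqP.
Qed.

Lemma push_chart_inv c x X : (cmap P c @` cdom P c) x ->
  push f c (cinv P c x) X = 'D_X (f \o cinv P c) x.
Proof. by move=> cx; rewrite /push chart_image_invK. Qed.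

Lemma ip_hess_f c p X Y : cdom P c p ->
  ip eps (hess f c p X Y) (f p) = - ip eps (push f c p Y) (push f c p X).
Proof.
move=> cp; have := derive_ip eps X (chart_diff2 Y cp) (chart_diff cp).
rewrite (@near_eq_derive _ _ _ _ (fun=> 0 : R^o)); last first.
  apply: filterS (chart_image_near okP cp) => x cx /=.
  by rewrite -push_chart_inv// ip_push_f//; exact: chart_image_inv.
rewrite (derive_cst (0 : R^o)) (chart_compK okP)// -/(push f c p X) -/(push f c p Y).
rewrite -/(hess f c p X Y).
by move=> /esym e; lra.
Qed.

Definition dgram c p Z X Y : R :=
  'D_Z (fun x => polar_gram c (cinv P c x) X Y : R^o) (cmap P c p).

Lemma ip_hess_push c p Z X Y : cdom P c p ->
  ip eps (hess f c p Z X) (push f c p Y) + ip eps (push f c p X) (hess f c p Z Y)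
  = dgram c p Z X Y.
Proof.
move=> cp; apply: etrans (esym (derive_ip eps Z (chart_diff2 X cp) (chart_diff2 Y cp))) _.
apply: near_eq_derive; apply: filterS (chart_image_near okP cp) => x cx /=.
by rewrite -!push_chart_inv// ip_push_push//; exact: chart_image_inv.
Qed.

#[local] Opaque push hess.

(** Constant vectors in a chart are commuting coordinate fields, so no bracket terms appear. Pairing
    the ambient second derivative with a tangent vector gives the Christoffel symbols of the first
    kind, expressed by derivatives of the metric coefficients. *)
Lemma koszul c p X Y Z : cdom P c p ->
  2 * ip eps (hess f c p X Y) (push f c p Z) =
  dgram c p X Y Z + dgram c p Y X Z - dgram c p Z X Y.
Proof.
move=> cp.
have E1 := ip_hess_push X Y Z cp; have E2 := ip_hess_push Y X Z cp.
have E3 := ip_hess_push Z X Y cp.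
rewrite (hess_comm okP Y X sf cp) in E2.
rewrite (hess_comm okP Z X sf cp) (hess_comm okP Z Y sf cp) in E3.
have arith (x y z a b d : R) : x + y = a -> x + z = b -> y + z = d -> 2 * x = a + b - d.
  by move=> <- <- <-; ring.
by apply: (arith _ _ _ _ _ _ E1 E2); rewrite [X in X + _]ipC.
Qed.

Lemma polar_gram_hh c p u v :
  polar_gram c p (row_mx u 0) (row_mx v 0) = gval g0 c.1 p.1 u v.
Proof.
rewrite /polar_gram !row_mxKl !row_mxKr big1 ?addr0// => a _.
by rewrite submxrow0 gval0l.
Qed.

Lemma polar_gram_hv c p u y : polar_gram c p (row_mx u 0) (row_mx 0 y) = 0.
Proof.
rewrite /polar_gram !row_mxKl !row_mxKr gval0r add0r big1// => a _.
by rewrite submxrow0 gval0l.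
Qed.

Lemma polar_gram_vh c p u y : polar_gram c p (row_mx 0 y) (row_mx u 0) = 0.
Proof.
rewrite /polar_gram !row_mxKl !row_mxKr gval0l add0r big1// => a _.
by rewrite submxrow0 gval0r.
Qed.

Lemma polar_gram_vv c p y z : polar_gram c p (row_mx 0 y) (row_mx 0 z) =
  \sum_a gval (ga a p.1) (c.2 a) (p.2 a) (submxrow y a) (submxrow z a).
Proof. by rewrite /polar_gram !row_mxKl !row_mxKr gval0l add0r. Qed.

Lemma polar_gram_block c p a u v :
  polar_gram c p (row_mx 0 (block a u)) (row_mx 0 (block a v)) =
  gval (ga a p.1) (c.2 a) (p.2 a) u v.
Proof.
rewrite polar_gram_vv (bigD1 a)//= !submxrow_block !dfwithin big1 ?addr0// => b ba.
by rewrite !submxrow_block dfwithout 1?eq_sym// gval0l.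
Qed.

Lemma polar_gram_blocks c p a b u v : a != b ->
  polar_gram c p (row_mx 0 (block a u)) (row_mx 0 (block b v)) = 0.
Proof.
move=> ab; rewrite polar_gram_vv big1// => d _; rewrite !submxrow_block.
have [<-|ad] := eqVneq a d; first by rewrite (@dfwithout _ _ _ b) 1?eq_sym// gval0r.
by rewrite dfwithout// gval0l.
Qed.

Lemma dgram0 c p Z X Y : (forall q, polar_gram c q X Y = 0) -> dgram c p Z X Y = 0.
Proof.
move=> XY; rewrite /dgram (_ : (fun _ => _) = fun=> 0); last by apply/funext => x; rewrite XY.
exact: (derive_cst (0 : R^o)).
Qed.

Definition dgram0h (i : idx M0) (p : M0) w u v : R :=
  'D_w (fun x => gval g0 i (cinv M0 i x) u v : R^o) (cmap M0 i p).

Lemma dgram_hhh c p w u v : cdom P c p ->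
  dgram c p (row_mx w 0) (row_mx u 0) (row_mx v 0) = dgram0h c.1 p.1 w u v.
Proof.
case: c p => [i c] [p q] [/= ip cq].
rewrite /dgram (_ : (fun _ => _) = (fun z => gval g0 i z.1 u v : R^o) \o cinv P (i, c)); last first.
  by apply/funext => x; rewrite polar_gram_hh.
by rewrite -(slice_derive (slice_left i okMt cq) _ w ip).
Qed.

Lemma dgram_vhh c p y u v : cdom P c p ->
  dgram c p (row_mx 0 y) (row_mx u 0) (row_mx v 0) = 0.
Proof.
case: c p => [i c] [p q] [/= ip cq].
rewrite /dgram (_ : (fun _ => _) = (fun z => gval g0 i z.1 u v : R^o) \o cinv P (i, c)); last first.
  by apply/funext => x; rewrite polar_gram_hh.
rewrite -(slice_derive (slice_right c okM0 ip) _ y cq).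
exact: (derive_cst (gval g0 i p u v : R^o)).
Qed.

Lemma slice_block i c p q a : cdom M0 i p -> cdom (prodn M) c q ->
  exists A, @slice _ (M a) P (fun z => (p, dfwith q a z)) (c a) (i, c) A
     (fun u => row_mx 0 (block a u)).
Proof.
move=> ip cq; have [A1 A2 A3] := slice_right c okM0 ip.
have := slice_dfwith (c a) okM cq; rewrite dfwith_id.
set B := (X in slice _ _ _ X _) => -[B1 B2 B3].
exists (fun x => row_mx (cmap M0 i p) (B x)); split.
- by move=> h w y; rewrite B1 A1.
- by move=> x; rewrite A2 B2.
by move=> z iz; have [C1 C2] := B3 z iz; have [D1 D2] := A3 _ C1; rewrite C2 D2.
Qed.

(** In a polar metric the b-th block depends on the points of M_0 and of the b-th factor only, so it
    is constant when another factor moves. *)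
Lemma dgram_block c p a b w u v : a != b -> cdom P c p ->
  dgram c p (row_mx 0 (block a w)) (row_mx 0 (block b u)) (row_mx 0 (block b v)) = 0.
Proof.
move=> ab; case: c p => [i c] [p q] [/= ip cq].
have [A sA] := slice_block a ip cq.
rewrite /dgram (_ : (fun _ => _) =
   (fun z => gval (ga b z.1) (c b) (z.2 b) u v : R^o) \o cinv P (i, c)); last first.
  by apply/funext => x; rewrite polar_gram_block.
have := slice_derive sA (fun z : P => gval (ga b z.1) (c b) (z.2 b) u v : R^o) w (cq a).
rewrite dfwith_id => <-.
rewrite (_ : _ \o _ \o _ = fun=> gval (ga b p) (c b) (q b) u v : R^o).
  exact: (derive_cst (gval (ga b p) (c b) (q b) u v : R^o)).
by apply/funext => x /=; rewrite dfwithout.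
Qed.

#[local] Opaque dgram dgram0h.

(** This is where codimension zero enters: the differential of [f] is onto the orthogonal of [f p],
    and [f p] itself is not null. The coefficient comes from [ip eps (f p) (f p) = eps] and
    [eps * eps = 1]. *)
Lemma polar_span c p z : cdom P c p ->
  exists X, z = (eps * ip eps z (f p)) *: f p + push f c p X.
Proof.
move=> cp; have [|X Xz] := @push_onto c p (z - (eps * ip eps z (f p)) *: f p) cp.
  by rewrite ipBr ipZr ip_ff mulrAC ee mul1r ipC subrr.
by exists X; rewrite Xz addrC subrK.
Qed.

Lemma polar_eq0 c p z : cdom P c p -> ip eps z (f p) = 0 ->
  (forall X, ip eps z (push f c p X) = 0) -> z = 0.
Proof.
move=> cp zf zX; apply: (ip_nondeg ee) => y; have [X ->] := polar_span y cp.
by rewrite ipDr ipZr zf zX mulr0 addr0.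
Qed.

Lemma split_hv (X : 'rV[R]_(mdim P)) :
  X = (row_mx (lsubmx X) 0 : 'rV[R]_(mdim P)) + row_mx 0 (rsubmx X).
Proof. by rewrite add_row_mx addr0 add0r hsubmxK. Qed.

Lemma push_split c p X : cdom P c p ->
  push f c p X = push f c p (row_mx (lsubmx X) 0) + push f c p (row_mx 0 (rsubmx X)).
Proof. by move=> cp; rewrite {1}(split_hv X) pushD. Qed.

Lemma row0_sum (I : finType) (y : I -> 'rV[R]_(mdim (prodn M))) :
  row_mx (0 : 'rV[R]_(mdim M0)) (\sum_i y i) = \sum_i row_mx 0 (y i).
Proof.
elim/big_rec2: _ => [|i a b _ <-]; first by rewrite row_mx0.
by rewrite add_row_mx addr0.
Qed.

Lemma push_blocks c p y : cdom P c p ->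
  push f c p (row_mx 0 y) = \sum_a push f c p (row_mx 0 (block a (submxrow y a))).
Proof. by move=> cp; rewrite {1}(sum_block y) row0_sum push_sum. Qed.

(** All three Koszul terms vanish: horizontal and vertical vectors are orthogonal everywhere, and
    g_0 is constant in the vertical directions. Geometrically, the slices of M_0 are totally
    geodesic, which [hess_hh_v] says in another form. *)
Lemma hess_hv_h c p u y v : cdom P c p ->
  ip eps (hess f c p (row_mx u 0) (row_mx 0 y)) (push f c p (row_mx v 0)) = 0.
Proof.
move=> cp; have := koszul (row_mx u 0) (row_mx 0 y) (row_mx v 0) cp.
rewrite (dgram0 _ _ (fun q => polar_gram_vh c q v y)) dgram_vhh//.
rewrite (dgram0 _ _ (fun q => polar_gram_hv c q u y)).
by move=> e; lra.
Qed.

Lemma hess_hh_v c p u v y : cdom P c p ->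
  ip eps (hess f c p (row_mx u 0) (row_mx v 0)) (push f c p (row_mx 0 y)) = 0.
Proof.
move=> cp; have := koszul (row_mx u 0) (row_mx v 0) (row_mx 0 y) cp.
rewrite (dgram0 _ _ (fun q => polar_gram_hv c q v y)) dgram_vhh//.
rewrite (dgram0 _ _ (fun q => polar_gram_hv c q u y)).
by move=> e; lra.
Qed.

Lemma hess_hh_h c p u v w : cdom P c p ->
  2 * ip eps (hess f c p (row_mx u 0) (row_mx v 0)) (push f c p (row_mx w 0)) =
  dgram0h c.1 p.1 u v w + dgram0h c.1 p.1 v u w - dgram0h c.1 p.1 w u v.
Proof. by move=> cp; rewrite koszul// !dgram_hhh. Qed.

(** Koszul's formula kills every tangential component, and the component along the position vector
    is minus the inner product of the two orthogonal directions. By [polar_eq0] nothing remains. *)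
Lemma hess_blocks c p a b u v : a != b -> cdom P c p ->
  hess f c p (row_mx 0 (block a u)) (row_mx 0 (block b v)) = 0.
Proof.
move=> ab cp; apply: (polar_eq0 cp).
  by rewrite ip_hess_f// ip_push_push// polar_gram_blocks ?oppr0// eq_sym.
have E2 (x : R) : 2 * x = 0 -> x = 0 by move=> e; lra.
have ba : b != a by rewrite eq_sym.
move=> X; rewrite push_split// push_blocks// ipDr ip_sumr [X in _ + X]big1.
  rewrite addr0; apply: E2; rewrite koszul//.
  rewrite (dgram0 _ _ (fun q => polar_gram_vh c q (lsubmx X) (block b v))).
  rewrite (dgram0 _ _ (fun q => polar_gram_vh c q (lsubmx X) (block a u))).
  by rewrite (dgram0 _ _ (fun q => polar_gram_blocks c q u v ab)) addr0 subr0.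
move=> d _; apply: E2; rewrite koszul//; move: (submxrow _ d) => w.
rewrite (dgram0 _ _ (fun q => polar_gram_blocks c q u v ab)) subr0.
(* The third direction shares its factor with at most one of the other two; the surviving term
   differentiates the metric of one factor along another. *)
have [bd|bd] := eqVneq b d.
  move: w; rewrite -bd => w; rewrite dgram_block// add0r.
  by rewrite (dgram0 _ _ (fun q => polar_gram_blocks c q u w ab)).
rewrite (dgram0 _ _ (fun q => polar_gram_blocks c q v w bd)) add0r.
have [ad|ad] := eqVneq a d; first by move: w; rewrite -ad => w; rewrite dgram_block.
by rewrite (dgram0 _ _ (fun q => polar_gram_blocks c q u w ad)).
Qed.

(** * Transport of the frame along M_0 between two points of the other factors *)

Hypothesis conM0 : connected [set: M0].

Local Notation fl q := (fun p0 : M0 => f (p0, q)).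
Local Notation fr p0 := (fun q : prodn M => f (p0, q)).

Lemma smooth_left q : smooth_map (fl q).
Proof.
apply: (@slice_smooth _ M0 P (fun p0 => (p0, q)) _ f _ sf) => i.
have [c cq] := okMt.1 q.
by do 3!eexists; exact: (slice_left i okMt cq).
Qed.

Lemma smooth_right p0 : smooth_map (fr p0).
Proof.
apply: (@slice_smooth _ (prodn M) P (fun q => (p0, q)) _ f _ sf) => c.
have [i pi0] := okM0.1 p0.
by do 3!eexists; exact: (slice_right c okM0 pi0).
Qed.

Lemma push_left i c p0 q u : cdom M0 i p0 -> cdom (prodn M) c q ->
  push (fl q) i p0 u = push f (i, c) (p0, q) (row_mx u 0).
Proof. by move=> pi0 cq; exact: (slice_push (slice_left i okMt cq) f u pi0). Qed.

Lemma hess_left i c p0 q u v : cdom M0 i p0 -> cdom (prodn M) c q ->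
  hess (fl q) i p0 u v = hess f (i, c) (p0, q) (row_mx u 0) (row_mx v 0).
Proof. by move=> pi0 cq; exact: (slice_hess (slice_left i okMt cq) f u v pi0). Qed.

Lemma push_right i c p0 q y : cdom M0 i p0 -> cdom (prodn M) c q ->
  push (fr p0) c q y = push f (i, c) (p0, q) (row_mx 0 y).
Proof. by move=> pi0 cq; exact: (slice_push (slice_right c okM0 pi0) f y cq). Qed.

(** The value contains neither [q] nor [f]. Together with [derive_gram_frameE] it says that the
    linear equation satisfied by the frame along M_0 is the same for every [q]. *)
Lemma gram_frameE q i p0 j k : cdom M0 i p0 ->
  ip eps (row j (frame (fl q) i p0)) (row k (frame (fl q) i p0)) =
  match fintype.split j, fintype.split k with
  | inl _, inl _ => eps
  | inl _, inr _ => 0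
  | inr _, inl _ => 0
  | inr j', inr k' => gval g0 i p0 (delta_mx 0 j') (delta_mx 0 k')
  end.
Proof.
move=> pi0; have [c cq] := okMt.1 q; have cp : cdom P (i, c) (p0, q) by [].
rewrite !row_frame; case: (fintype.split j) => j'; case: (fintype.split k) => k'.
- exact: ip_ff.
- by rewrite (push_left _ pi0 cq) ipC ip_push_f.
- by rewrite (push_left _ pi0 cq) ip_push_f.
by rewrite !(push_left _ pi0 cq) ip_push_push// polar_gram_hh.
Qed.

Lemma derive_gram_frameE q i p0 u j k : cdom M0 i p0 ->
  ip eps (row j ('D_u (frame (fl q) i \o cinv M0 i) (cmap M0 i p0)))
         (row k (frame (fl q) i p0)) =
  match fintype.split j, fintype.split k with
  | inl _, inl _ => 0
  | inl _, inr k' => gval g0 i p0 u (delta_mx 0 k')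
  | inr j', inl _ => - gval g0 i p0 (delta_mx 0 j') u
  | inr j', inr k' => (dgram0h i p0 u (delta_mx 0 j') (delta_mx 0 k') +
      dgram0h i p0 (delta_mx 0 j') u (delta_mx 0 k') -
      dgram0h i p0 (delta_mx 0 k') u (delta_mx 0 j')) / 2
  end.
Proof.
move=> pi0; have [c cq] := okMt.1 q; have cp : cdom P (i, c) (p0, q) by [].
rewrite row_frame (row_derive_frame okM0 _ _ (smooth_left q) pi0).
case: (fintype.split j) => j'; case: (fintype.split k) => k'.
- by rewrite (push_left _ pi0 cq) ip_push_f.
- by rewrite !(push_left _ pi0 cq) ip_push_push// polar_gram_hh.
- by rewrite (hess_left _ _ pi0 cq) ip_hess_f// ip_push_push// polar_gram_hh.
have two0 : (2 : R) != 0 by rewrite pnatr_eq0.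
rewrite (hess_left _ _ pi0 cq) (push_left _ pi0 cq).
by apply: (mulfI two0); rewrite hess_hh_h// mulrC divfK.
Qed.

Lemma gram_frame q q' i p0 : cdom M0 i p0 ->
  frame (fl q) i p0 *m ipmx eps _ *m (frame (fl q) i p0)^T =
  frame (fl q') i p0 *m ipmx eps _ *m (frame (fl q') i p0)^T.
Proof.
move=> pi0; apply/matrixP => j k.
apply: etrans (mulmx_ipE eps (frame (fl q) i p0) _ _ _) _.
apply: etrans _ (esym (mulmx_ipE eps (frame (fl q') i p0) _ _ _)).
exact: etrans (gram_frameE q j k pi0) (esym (gram_frameE q' j k pi0)).
Qed.

Lemma derive_gram_frame q q' i p0 u : cdom M0 i p0 ->
  'D_u (frame (fl q) i \o cinv M0 i) (cmap M0 i p0) *m ipmx eps _ *m (frame (fl q) i p0)^T =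
  'D_u (frame (fl q') i \o cinv M0 i) (cmap M0 i p0) *m ipmx eps _ *m (frame (fl q') i p0)^T.
Proof.
move=> pi0; apply/matrixP => j k.
apply: etrans (mulmx_ipE eps _ (frame (fl q) i p0) _ _) _.
apply: etrans _ (esym (mulmx_ipE eps _ (frame (fl q') i p0) _ _)).
exact: etrans (derive_gram_frameE q u j k pi0) (esym (derive_gram_frameE q' u j k pi0)).
Qed.

Lemma unitmx_inj n (G : 'M[R]_n) : (forall w : 'rV_n, w *m G = 0 -> w = 0) -> G \in unitmx.
Proof.
move=> G0; rewrite -row_free_unit -kermx_eq0; apply/rowV0P => w /sub_kermxP.
exact: G0.
Qed.

Hypothesis pos0 : forall i p u, cdom M0 i p -> u != 0 -> 0 < gval g0 i p u u.

(** The Gram matrix is the orthogonal sum of [eps] and g_0. A kernel vector loses its first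
    coordinate by pairing with the position vector, and the rest by positivity of g_0. *)
Lemma unit_gram_frame q i p0 : cdom M0 i p0 ->
  frame (fl q) i p0 *m ipmx eps _ *m (frame (fl q) i p0)^T \in unitmx.
Proof.
move=> pi0; have [c cq] := okMt.1 q.
have cp : cdom P (i, c) (p0, q) by [].
apply: unitmx_inj => w; rewrite !mulmxA => wG.
have E v : ip eps (w *m frame (fl q) i p0) (v *m frame (fl q) i p0) = 0.
  by rewrite ipE trmx_mul !mulmxA wG mul0mx mxE.
have w0 : w 0 0 = 0.
  have := E (delta_mx 0 (lshift _ 0)); rewrite -rowE row_frame (unsplitK (inl _)).
  rewrite (mul_frame _ (smooth_left q) pi0) ipDl (push_left _ pi0 cq) ip_push_f//.
  rewrite addr0 ipZl ip_ff => /eqP.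
  rewrite mulf_eq0 => /orP[/eqP //|/eqP e0].
  by move: ee; rewrite e0 mul0r => /eqP; rewrite eq_sym oner_eq0.
have r0 : rsubmx w = 0.
  have := E w; rewrite (mul_frame _ (smooth_left q) pi0) w0 scale0r add0r (push_left _ pi0 cq).
  rewrite ip_push_push// polar_gram_hh => G0; apply/eqP/negP => /negP rw.
  by have := pos0 pi0 rw; rewrite G0 ltxx.
rewrite -[w]hsubmxK r0 -[RHS](row_mx0 _ 1 1); congr row_mx.
by apply/rowP => k; rewrite (ord1 k) !mxE -w0; congr (w _ _); apply: val_inj.
Qed.

(** The right-hand side is the orthogonal projection of [D] onto the row span of the frame. The
    difference is orthogonal to the frame by construction, and to the vertical vectors because the
    slices of M_0 are totally geodesic. *)
Lemma derive_frame_span q i p0 u : cdom M0 i p0 ->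
  let Z := frame (fl q) i p0 in
  let D := 'D_u (frame (fl q) i \o cinv M0 i) (cmap M0 i p0) in
  D = D *m ipmx eps _ *m Z^T *m invmx (Z *m ipmx eps _ *m Z^T) *m Z.
Proof.
move=> pi0 Z D; have [c cq] := okMt.1 q.
have cp : cdom P (i, c) (p0, q) by [].
set C := D *m _ *m _ *m invmx _; apply/eqP; rewrite -subr_eq0; apply/eqP.
have EZ : (D - C *m Z) *m ipmx eps _ *m Z^T = 0.
  rewrite !mulmxBl (_ : C *m Z *m _ *m _ = C *m (Z *m ipmx eps _ *m Z^T)).
    by rewrite /C mulmxKV ?subrr//; exact: unit_gram_frame.
  by rewrite !mulmxA.
apply/row_matrixP => j; rewrite row0; apply: (polar_eq0 cp).
  have := congr1 (fun A : 'M[R]_(_, _) => A j (lshift _ 0)) EZ.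
  by rewrite mulmx_ipE row_frame mxE (unsplitK (inl _)).
have Eh u' : ip eps (row j (D - C *m Z)) (push f (i, c) (p0, q) (row_mx u' 0)) = 0.
  rewrite -(push_left _ pi0 cq) (push_delta u' (smooth_left q) pi0) ip_sumr big1// => k _.
  have := congr1 (fun A : 'M[R]_(_, _) => A j (rshift _ k)) EZ.
  by rewrite ipZr mulmx_ipE row_frame (unsplitK (inr _)) => ->; rewrite mxE mulr0.
move=> X; rewrite (push_split X cp).
rewrite ipDr; apply: etrans (congr2 +%R (Eh (lsubmx X)) _) (addr0 0).
rewrite linearB /= ipBl row_mul (mul_frame _ (smooth_left q) pi0) ipDl ipZl.
rewrite (ipC _ (f _)) ip_push_f// mulr0 add0r (push_left _ pi0 cq) ip_push_push// polar_gram_hv subr0.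
rewrite (row_derive_frame okM0 _ _ (smooth_left q) pi0); case: (fintype.split j) => k.
  by rewrite (push_left _ pi0 cq) ip_push_push// polar_gram_hv.
by rewrite (hess_left _ _ pi0 cq) hess_hh_v.
Qed.

(** The second clause fixes [T] on the complement of the frame at [q1], and so makes it unique once
    the first clause holds near [p0]. *)
Definition transports (q1 q2 : prodn M) (p0 : M0) (T : 'M[R]_((mdim P).+1)) : Prop :=
  f (p0, q1) *m T = f (p0, q2) /\
  forall c y, cdom (prodn M) c q1 -> push (fr p0) c q1 y *m T = 0.

Lemma push_right_orth i c p0 q y u : cdom M0 i p0 -> cdom (prodn M) c q ->
  ip eps (push (fr p0) c q y) (push (fl q) i p0 u) = 0.
Proof.
move=> pi0 cq; have cp : cdom P (i, c) (p0, q) by [].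
by rewrite (push_left _ pi0 cq) (push_right _ pi0 cq) ip_push_push// polar_gram_vh.
Qed.

Lemma transport_near q1 q2 (p0 : M0) : exists T, \forall p \near p0, transports q1 q2 p T.
Proof.
have [i pi0] := okM0.1 p0.
pose G p := frame (fl q1) i p *m ipmx eps _ *m (frame (fl q1) i p)^T.
(* The factors before the last one read off the frame coefficients of the projection onto the frame
   at [q1]; the last one expands them in the frame at [q2]. *)
pose T p := ipmx eps _ *m (frame (fl q1) i p)^T *m invmx (G p) *m frame (fl q2) i p.
have TP p : cdom M0 i p -> transports q1 q2 p (T p).
  move=> pi0'; have ZT : frame (fl q1) i p *m T p = frame (fl q2) i p.
    by rewrite /T !mulmxA -/(G p) mulmxV ?mul1mx//; exact: unit_gram_frame.
  split.
    by move: ZT; rewrite !frameE mul_col_mx => /eq_col_mx[].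
  move=> c y cq; have cp : cdom P (i, c) (p, q1) by [].
  rewrite /T !mulmxA (_ : _ *m (frame (fl q1) i p)^T = 0) ?mul0mx//.
  apply: row_mulmx_ip0 => j; rewrite row_frame; case: (fintype.split j) => k.
    by rewrite (push_right _ pi0' cq) ip_push_f.
  exact: push_right_orth.
have Tc : \forall x \near cmap M0 i p0, (T \o cinv M0 i) x = (T \o cinv M0 i) (cmap M0 i p0).
  have dZ q p : cdom M0 i p -> differentiable (frame (fl q) i \o cinv M0 i) (cmap M0 i p).
    by move=> pi0'; exact: Csmooth_differentiable (Csmooth_frame okM0 i (smooth_left q)) (chart_image_mem pi0').
  have uG p : cdom M0 i p -> \forall x \near cmap M0 i p, (G \o cinv M0 i) x \in unitmx.
    move=> pi0'; apply: filterS (chart_image_near okM0 pi0') => x ix.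
    by apply: unit_gram_frame; exact: chart_image_inv.
  have dG p : cdom M0 i p -> differentiable (G \o cinv M0 i) (cmap M0 i p).
    move=> pi0'; apply: differentiable_mulmx; last by apply: differentiable_trmx; exact: dZ.
    by apply: differentiable_mulmxr; exact: dZ.
  apply: (derive0_near_cst (@chart_image_open _ _ okM0 i) (chart_image_mem pi0)).
    move=> _ [p pi0' <-]; apply: differentiable_mulmx; last exact: dZ.
    apply: differentiable_mulmx; last exact: differentiable_invmx (dG p pi0') (uG p pi0').
    apply: differentiable_mulmx; first exact: (differentiable_cst (ipmx eps _)).
    by apply: differentiable_trmx; exact: dZ.
  move=> _ v [p pi0' <-].
  have GE : (G \o cinv M0 i) (cmap M0 i p) = G p by exact: chart_compK.
  have ZE q : (frame (fl q) i \o cinv M0 i) (cmap M0 i p) = frame (fl q) i p by exact: chart_compK.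
  have H := @transport_derive0 _ _ _ _ (ipmx eps _) (frame (fl q1) i \o cinv M0 i)
    (frame (fl q2) i \o cinv M0 i) (G \o cinv M0 i) (cmap M0 i p) v (tr_ipmx eps _)
    (fun=> erefl) (dZ q1 p pi0') (dZ q2 p pi0') (uG p pi0').
  move: H; rewrite GE (ZE q1) (ZE q2); apply; first exact: derive_frame_span.
  (* Replacing [q1] by [q2] in the coefficient matrix turns the required equation for the second
     frame into its own projection identity. *)
  rewrite /G (derive_gram_frame q1 q2 v pi0') (gram_frame q1 q2 pi0').
  exact: derive_frame_span.
exists (T p0); have := okM0.2 i => -[oi _ _ ci _].
have := ci p0 pi0 _ Tc; rewrite (chart_compK okM0)//.
have : \forall p \near p0, cdom M0 i p by exact: open_nbhs_nbhs.
by apply: filterS2 => p pi0'; rewrite /= chart_invK// => <-; exact: TP.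
Qed.

(** Germs are compared rather than values at [p0]: the images of the vectors tangent to M_0 come
    from differentiating [f (p, q1) *m T = f (p, q2)] in [p]. The position vector and the vertical
    vectors complete a spanning set. *)
Lemma transport_eq q1 q2 (p0 : M0) T T' :
  (\forall p \near p0, transports q1 q2 p T) ->
  (\forall p \near p0, transports q1 q2 p T') -> T = T'.
Proof.
move=> nT nT'; have [i pi0] := okM0.1 p0; have [c cq] := okMt.1 q1.
have cp : cdom P (i, c) (p0, q1) by [].
apply/row_matrixP => j; rewrite !rowE; move: (delta_mx 0 j) => z.
have [X ->] := polar_span z cp.
have [f1 v1] := nbhs_singleton nT; have [f2 v2] := nbhs_singleton nT'.
rewrite push_split// !mulmxDl -!scalemxAl f1 f2 -!(push_right _ pi0 cq) v1// v2// !addr0.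
rewrite -(push_left _ pi0 cq) -(push_mulmxr T _ (smooth_left q1) pi0) -(push_mulmxr T' _ (smooth_left q1) pi0).
congr (_ + _); apply: push_near => //.
by apply: filterS2 nT nT' => p [-> _] [-> _].
Qed.

Lemma transport_exists q1 q2 : exists T, forall p0, transports q1 q2 p0 T.
Proof.
pose T p0 := sval (cid (transport_near q1 q2 p0)).
have TP p0 : \forall p \near p0, transports q1 q2 p (T p0) := svalP (cid (transport_near q1 q2 p0)).
have [[p0]|noM0] := pselect (exists p0 : M0, True); last first.
  by exists 0 => p0; case: noM0; exists p0.
exists (T p0) => p'; have -> : T p0 = T p'.
  apply: (connected_loc_cst conM0) => p1.
  (* For [p2] near [p1] the matrix chosen at [p1] still works near [p2], so uniqueness there
     identifies it with the one chosen at [p2]. *)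
  have := near_join (TP p1); apply: filterS => p2 n2.
  exact: transport_eq (TP p2) n2.
exact: nbhs_singleton (TP p').
Qed.

Hypothesis posa : forall a p0 i p u, cdom (M a) i p -> u != 0 -> 0 < gval (ga a p0) i p u u.

Lemma push_fl_f i p0 q u : cdom M0 i p0 -> ip eps (push (fl q) i p0 u) (f (p0, q)) = 0.
Proof.
move=> pi0; have [c cq] := okMt.1 q; have cp : cdom P (i, c) (p0, q) by [].
by rewrite (push_left _ pi0 cq) ip_push_f.
Qed.

Lemma push_fr_f c p0 q y : cdom (prodn M) c q -> ip eps (push (fr p0) c q y) (f (p0, q)) = 0.
Proof.
move=> cq; have [i pi0] := okM0.1 p0; have cp : cdom P (i, c) (p0, q) by [].
by rewrite (push_right _ pi0 cq) ip_push_f.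
Qed.

Lemma push_fl_fl i p0 q u v : cdom M0 i p0 ->
  ip eps (push (fl q) i p0 u) (push (fl q) i p0 v) = gval g0 i p0 u v.
Proof.
move=> pi0; have [c cq] := okMt.1 q; have cp : cdom P (i, c) (p0, q) by [].
by rewrite !(push_left _ pi0 cq) ip_push_push// polar_gram_hh.
Qed.

Lemma push_fr_fr c p0 q y z : cdom (prodn M) c q ->
  ip eps (push (fr p0) c q y) (push (fr p0) c q z) =
  \sum_a gval (ga a p0) (c a) (q a) (submxrow y a) (submxrow z a).
Proof.
move=> cq; have [i pi0] := okM0.1 p0; have cp : cdom P (i, c) (p0, q) by [].
by rewrite !(push_right _ pi0 cq) ip_push_push// polar_gram_vv.
Qed.

Lemma push_fr_gt0 c p0 q y : cdom (prodn M) c q -> y != 0 ->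
  0 < ip eps (push (fr p0) c q y) (push (fr p0) c q y).
Proof.
move=> cq y0; rewrite push_fr_fr//.
have ge0 a : 0 <= gval (ga a p0) (c a) (q a) (submxrow y a) (submxrow y a).
  have [->|/(posa p0 (cq a)) /ltW //] := eqVneq (submxrow y a) 0.
  by rewrite gval0l.
have [a ya] : exists a, submxrow y a != 0.
  apply/not_existsP => ya; case/negP: y0; apply/eqP/mxrowP => a.
  by rewrite submxrow0; apply/eqP/negP => /negP; exact: ya.
rewrite (bigD1 a)//=; apply: ltr_pwDl; first exact: posa.
by apply: sumr_ge0 => b _; exact: ge0.
Qed.

Lemma push_fr_eq0 c p0 q y : cdom (prodn M) c q ->
  ip eps (push (fr p0) c q y) (push (fr p0) c q y) = 0 -> y = 0.
Proof.
move=> cq y0; apply/eqP/negP => /negP /(push_fr_gt0 p0 cq).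
by rewrite y0 ltxx.
Qed.

Lemma span_frame i c p0 q z : cdom M0 i p0 -> cdom (prodn M) c q ->
  exists w y, z = w *m frame (fl q) i p0 + push (fr p0) c q y.
Proof.
move=> pi0 cq; have cp : cdom P (i, c) (p0, q) by [].
have [X ->] := polar_span z cp; set a := eps * _.
exists (row_mx a%:M (lsubmx X)), (rsubmx X).
rewrite (mul_frame _ (smooth_left q) pi0) row_mxKr (push_split X cp).
rewrite (push_left _ pi0 cq) (push_right _ pi0 cq) addrA; congr (_ *: _ + _ + _).
have -> : (0 : 'I_(1 + mdim M0)) = lshift _ 0 by apply: val_inj.
by rewrite row_mxEl mxE.
Qed.

Lemma mul_frame_orth i c p0 q w y : cdom M0 i p0 -> cdom (prodn M) c q ->
  ip eps (w *m frame (fl q) i p0) (push (fr p0) c q y) = 0.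
Proof.
move=> pi0 cq; rewrite (mul_frame _ (smooth_left q) pi0) ipDl ipZl.
by rewrite ipC push_fr_f// mulr0 add0r ipC (push_right_orth _ _ pi0 cq).
Qed.

Lemma normal_of_orth i c p0 q z : cdom M0 i p0 -> cdom (prodn M) c q ->
  (forall y, ip eps z (push (fr p0) c q y) = 0) -> exists w, z = w *m frame (fl q) i p0.
Proof.
move=> pi0 cq zy; have [w [y zE]] := span_frame z pi0 cq.
exists w; have := zy y; rewrite {1}zE ipDl (mul_frame_orth _ _ pi0 cq) add0r.
by move=> /(push_fr_eq0 cq) y0; rewrite zE y0 push0 addr0.
Qed.

Lemma frame_ip_inj i p0 q w : cdom M0 i p0 ->
  (forall w', ip eps (w *m frame (fl q) i p0) (w' *m frame (fl q) i p0) = 0) -> w = 0.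
Proof.
move=> pi0 E; have uG := unit_gram_frame q pi0.
rewrite -[w](mulmxK uG) !mulmxA; set G := frame (fl q) i p0 in E uG *.
suff -> : w *m G *m ipmx eps _ *m G^T = 0 by rewrite mul0mx.
by apply: row_mulmx_ip0 => j; rewrite rowE; exact: E.
Qed.

(** The frame component of [z] is orthogonal to the whole frame, whose Gram matrix is invertible;
    hence it vanishes. *)
Lemma tangent_of_orth i c p0 q z : cdom M0 i p0 -> cdom (prodn M) c q ->
  ip eps z (f (p0, q)) = 0 -> (forall u, ip eps z (push (fl q) i p0 u) = 0) ->
  exists y, z = push (fr p0) c q y.
Proof.
move=> pi0 cq zf zu; have [w [y zE]] := span_frame z pi0 cq.
exists y; suff w0 : w = 0 by rewrite zE w0 mul0mx add0r.
apply: (frame_ip_inj (q := q) pi0) => w'.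
have -> : w *m frame (fl q) i p0 = z - push (fr p0) c q y by rewrite zE addrK.
rewrite ipBl (ipC _ (push _ _ _ y)) (mul_frame_orth _ _ pi0 cq) subr0.
by rewrite (mul_frame _ (smooth_left q) pi0) ipDr ipZr zf mulr0 add0r zu.
Qed.

Lemma push_fr_blocks_orth c p0 q a b u v : a != b -> cdom (prodn M) c q ->
  ip eps (push (fr p0) c q (block a u)) (push (fr p0) c q (block b v)) = 0.
Proof.
move=> ab cq; have [i pi0] := okM0.1 p0; have cp : cdom P (i, c) (p0, q) by [].
by rewrite !(push_right _ pi0 cq) ip_push_push// polar_gram_blocks.
Qed.

Lemma push_fr_block_eq0 c p0 q a u : cdom (prodn M) c q ->
  ip eps (push (fr p0) c q (block a u)) (push (fr p0) c q (block a u)) = 0 -> u = 0.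
Proof.
move=> cq /(push_fr_eq0 cq) /(congr1 (fun y => submxrow y a)).
by rewrite submxrow_block dfwithin submxrow0.
Qed.

Lemma hess_fr_blocks c p0 q a b u v : a != b -> cdom (prodn M) c q ->
  hess (fr p0) c q (block a u) (block b v) = 0.
Proof.
move=> ab cq; have [i pi0] := okM0.1 p0; have cp : cdom P (i, c) (p0, q) by [].
apply: etrans (slice_hess (slice_right c okM0 pi0) f _ _ cq) _.
exact: hess_blocks.
Qed.

(** * The orthonormal normal frame at a base point and the map [f0] *)

Section BasePoint.
Variables (q0 : M0) (i0 : idx M0) (L : 'M[R]_(mdim M0)).
Hypothesis iq0 : cdom M0 i0 q0.
Hypothesis LL : L *m g0 i0 q0 *m L^T = 1%:M.

Local Notation ft := (fr q0).
Local Notation Fr := (fun q => frame (fl q) i0 q0).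

Let B : 'M[R]_(1 + mdim M0) := block_mx 1%:M 0 0 L.

(** [B] leaves the position vector in the first row, so [e1] is the first coordinate vector. It is
    the timelike one for [eps = -1], in accordance with the convention of [ip]. *)
Definition Phi (q : prodn M) : 'M[R]_(1 + mdim M0, (mdim P).+1) := B *m frame (fl q) i0 q0.

Lemma unitB : B \in unitmx.
Proof.
have uL : L \in unitmx by move: LL; rewrite -mulmxA => /mulmx1_unit[].
have : B *m block_mx 1%:M 0 0 (invmx L) = 1%:M.
  rewrite mulmx_block !mulmx0 !mul0mx !addr0 !add0r mulmx1 mulmxV//.
  by rewrite -scalar_mx_block.
by case/mulmx1_unit.
Qed.

Lemma Phi_gram q : Phi q *m ipmx eps _ *m (Phi q)^T = ipmx eps (1 + mdim M0).
Proof.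
have G : frame (fl q) i0 q0 *m ipmx eps _ *m (frame (fl q) i0 q0)^T =
    block_mx eps%:M 0 0 (g0 i0 q0).
  apply/matrixP => j k; apply: etrans (mulmx_ipE _ _ _ _ _) _.
  apply: etrans (gram_frameE q j k iq0) _.
  case: (split_ordP j) => j' ->; case: (split_ordP k) => k' ->.
  - by rewrite block_mxEul (ord1 j') (ord1 k') mxE.
  - by rewrite block_mxEur mxE.
  - by rewrite block_mxEdl mxE.
  rewrite block_mxEdr /gval -rowE trmx_delta -colE !mxE //.
rewrite /Phi trmx_mul !mulmxA -(mulmxA B) -(mulmxA B) G ipmx_block.
rewrite tr_block_mx !trmx0 trmx1 !mulmx_block.
by rewrite !(mulmx0, mul0mx, addr0, add0r, mulmx1, mul1mx) LL.
Qed.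

Lemma ip_Phi q y z : ip eps (y *m Phi q) (z *m Phi q) = ip eps y z.
Proof.
have := Phi_gram q; move: (Phi q) => F FG.
by rewrite !ipE trmx_mul !mulmxA -(mulmxA y) -(mulmxA y) FG.
Qed.

Lemma Phi_e1 q : delta_mx 0 0 *m Phi q = f (q0, q).
Proof.
have e0 : (0 : 'I_(1 + mdim M0)) = lshift (mdim M0) (0 : 'I_1) by apply: val_inj.
have b1 (k : 'I_1) : B (lshift (mdim M0) 0) (lshift (mdim M0) k) = 1.
  by rewrite /B block_mxEul (ord1 k) mxE.
have b2 k : B (lshift (mdim M0) (0 : 'I_1)) (rshift 1 k) = 0.
  by rewrite /B block_mxEur mxE.
have eB : delta_mx 0 0 *m B = delta_mx 0 0 :> 'rV_(1 + mdim M0).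
  rewrite -rowE; apply/rowP => j; rewrite mxE [RHS]mxE eqxx /= e0.
  case: (split_ordP j) => k ->; first by apply: etrans (b1 k) _; rewrite (ord1 k) -val_eqE.
  by apply: etrans (b2 k) _; rewrite -val_eqE.
by rewrite /Phi mulmxA eB -rowE row_frame e0 (unsplitK (inl _)).
Qed.

Lemma Phi_normal c q : cdom (prodn M) c q ->
  range (fun y => y *m Phi q) = Defs.normal_space eps ft c q.
Proof.
move=> cq; apply/seteqP; split=> [_ [y _ <-] u|w wn].
  by rewrite /Phi mulmxA (mul_frame_orth _ _ iq0 cq).
have [w' ->] := normal_of_orth iq0 cq wn.
by exists (w' *m invmx B) => //; rewrite /Phi !mulmxA mulmxKV// unitB.
Qed.

Lemma span_Phi c q x : cdom (prodn M) c q ->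
  exists y z, x = y *m Phi q + push ft c q z.
Proof.
move=> cq; have [w [z ->]] := span_frame x iq0 cq.
by exists (w *m invmx B), z; rewrite /Phi !mulmxA mulmxKV// unitB.
Qed.

Let A0 (x : 'rV[R]_(mdim (prodn M))) : 'rV[R]_(mdim P) := row_mx (cmap M0 i0 q0) x.

Lemma A0_affine : affine_along A0 (fun y => row_mx 0 y).
Proof. by move=> h w y; rewrite /A0 scale_row_mx scaler0 add_row_mx add0r. Qed.

Lemma push_fl_chart c u x : (cmap (prodn M) c @` cdom (prodn M) c) x ->
  push (fl (cinv (prodn M) c x)) i0 q0 u =
  ('D_(row_mx u 0) (f \o cinv P (i0, c)) \o A0) x.
Proof.
move=> [q cq <-]; rewrite (chart_invK okMt cq) (push_left _ iq0 cq).
by [].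
Qed.

Lemma smooth_push_fl u : smooth_map (fun q => push (fl q) i0 q0 u).
Proof.
apply/smooth_mapP => c.
have s1 := Csmooth_derive (row_mx u 0) ((smooth_mapP f).1 sf (i0, c)).
have s2 := Csmooth_comp_affine A0_affine (fun x => affine_differentiable x A0_affine) s1.
have s3 : Csmooth (cmap (prodn M) c @` cdom (prodn M) c)
    ('D_(row_mx u 0) (f \o cinv P (i0, c)) \o A0).
  by apply: Csmooth_sub s2 => _ [q cq <-]; exists (q0, q).
apply: Csmooth_ext s3; first exact: chart_image_open.
by move=> x cx; exact: esym (push_fl_chart u cx).
Qed.

Lemma push_push_fl c q u y : cdom (prodn M) c q ->
  push (fun q => push (fl q) i0 q0 u) c q y =
  hess f (i0, c) (q0, q) (row_mx u 0) (row_mx 0 y).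
Proof.
move=> cq; have cp : cdom P (i0, c) (q0, q) by [].
rewrite (hess_comm okP _ _ sf cp).
apply: etrans (derive_affineE _ _ _ A0_affine).
apply: near_eq_derive; apply: filterS (chart_image_near okMt cq) => x cx.
exact: push_fl_chart.
Qed.

Lemma frame_smooth c :
  Csmooth (cmap (prodn M) c @` cdom (prodn M) c) (Fr \o cinv (prodn M) c).
Proof.
have oc := chart_image_open okMt (i := c).
have s1 := (Csmooth_mxP _ oc).1 ((smooth_mapP _).1 (smooth_right q0) c) 0.
have s2 u := (Csmooth_mxP _ oc).1 ((smooth_mapP _).1 (smooth_push_fl u) c) 0.
apply/(Csmooth_mxP _ oc) => j l.
have e x : (Fr \o cinv (prodn M) c) x j l = row j (frame (fl (cinv (prodn M) c x)) i0 q0) 0 l.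
  by rewrite [RHS]mxE.
case: (split_ordP j) => j' jE.
  apply: Csmooth_ext (s1 l) => // x _; rewrite e row_frame jE.
  by rewrite (unsplitK (inl j')).
apply: Csmooth_ext (s2 (delta_mx 0 j') l) => // x _; rewrite e row_frame jE.
by rewrite (unsplitK (inr j')).
Qed.

Lemma Phi_smooth c :
  Csmooth (cmap (prodn M) c @` cdom (prodn M) c) (Phi \o cinv (prodn M) c).
Proof.
have oc := chart_image_open okMt (i := c).
exact: Csmooth_mulmx oc (Csmooth_cst _ B) (frame_smooth c).
Qed.

Lemma mul_Phi y q :
  y *m Phi q = (y *m B) 0 0 *: f (q0, q) + push (fl q) i0 q0 (rsubmx (y *m B)).
Proof. by rewrite /Phi mulmxA (mul_frame _ (smooth_left q) iq0). Qed.

(** This is parallelism of the frame before projecting to the normal bundle. The derivative consists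
    of a multiple of the differential of [ft] and a mixed second derivative; the latter is
    orthogonal to [f] and, by [hess_hv_h], to the vectors tangent to M_0. *)
Lemma push_Phi_tangent c q y u : cdom (prodn M) c q ->
  exists z, push (fun q => y *m Phi q) c q u = push ft c q z.
Proof.
move=> cq; have cp : cdom P (i0, c) (q0, q) by [].
set a := (y *m B) 0 0; set w := rsubmx (y *m B).
have -> : push (fun q => y *m Phi q) c q u =
    a *: push ft c q u + hess f (i0, c) (q0, q) (row_mx w 0) (row_mx 0 u).
  have d1 := smooth_chart_differentiable (smooth_right q0) cq.
  have d2 := smooth_chart_differentiable (smooth_push_fl w) cq.
  rewrite -(push_push_fl _ _ cq).
  rewrite (_ : (fun q => y *m Phi q) = fun q => a *: f (q0, q) + push (fl q) i0 q0 w); last first.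
    by apply/funext => q'; exact: mul_Phi.
  apply: etrans (@deriveD _ _ _ (a \*: (ft \o cinv (prodn M) c)) _ _ _ _ _) _.
  - by apply: derivableZ; exact: diff_derivable.
  - exact: diff_derivable d2.
  congr (_ + _); apply: deriveZ; exact: diff_derivable.
apply: (tangent_of_orth iq0 cq).
  rewrite ipDl ipZl push_fr_f// mulr0 add0r ip_hess_f// ip_push_push// polar_gram_vh.
  exact: oppr0.
move=> v; rewrite ipDl ipZl (push_right_orth _ _ iq0 cq) mulr0 add0r.
by rewrite (push_left _ iq0 cq) hess_hv_h.
Qed.

Lemma transport_Phi q1 q2 : exists2 T,
  (forall p0, f (p0, q1) *m T = f (p0, q2)) &
  Phi q1 *m T = Phi q2 /\ forall c y, cdom (prodn M) c q1 -> push ft c q1 y *m T = 0.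
Proof.
have [T TP] := transport_exists q1 q2.
exists T; first by move=> p0; have [] := TP p0.
split; last by move=> c y cq; have [_] := TP q0; exact.
rewrite /Phi -mulmxA; congr (_ *m _); apply/row_matrixP => j.
rewrite row_mul !row_frame; case: (fintype.split j) => j'; first by have [] := TP q0.
have e : (fun p => f (p, q1) *m T) = fl q2 by apply/funext => p; have [] := TP p.
by apply: etrans (esym (push_mulmxr T _ (smooth_left q1) iq0)) _; rewrite e.
Qed.

Variable q1 : prodn M.

(** As the Gram matrix of [Phi q1] is that of E^s, the last factor is a right inverse of [Phi q1];
    thus coordinates in this frame are read off. That [f (p0, q1)] lies in its span is settled in
    [f0E]. *)
Definition f0 (p0 : M0) : 'rV[R]_(1 + mdim M0) :=
  f (p0, q1) *m (ipmx eps _ *m (Phi q1)^T *m ipmx eps _).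

Lemma f0E p0 q : f (p0, q) = f0 p0 *m Phi q.
Proof.
have [c cq] := okMt.1 q1.
have E1 : f (p0, q1) = f0 p0 *m Phi q1.
  (* The transport from [q1] to itself fixes the rows of [Phi q1] and kills the tangent vectors, so
     it projects onto the span of the frame. As it also fixes [f (p0, q1)], that vector lies in the
     span. *)
  have [T11 T1 [T2 T3]] := transport_Phi q1 q1.
  have [w [y zE]] := span_frame (f (p0, q1)) iq0 cq.
  have e : f (p0, q1) = (w *m invmx B) *m Phi q1.
    by rewrite -(T1 p0) zE mulmxDl T3// addr0 -T2 /Phi !mulmxA mulmxKV// unitB.
  rewrite /f0 {2}e; have := Phi_gram q1; rewrite e; move: (Phi q1) (w *m _) => F v FG.
  by rewrite !mulmxA -(mulmxA v) -(mulmxA v) FG -(mulmxA v) ipmxK// mulmx1.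
by have [T T1 [T2 _]] := transport_Phi q1 q; rewrite -(T1 p0) E1 -T2 mulmxA.
Qed.

Lemma smooth_f0 : smooth_map f0.
Proof. exact: smooth_mulmxr okM0 _ _ _ (smooth_left q1). Qed.

Lemma push_f0 i p u q : cdom M0 i p -> push (fl q) i p u = push f0 i p u *m Phi q.
Proof.
move=> pi0; have -> : fl q = fun p => f0 p *m Phi q by apply/funext => p'; exact: f0E.
exact: push_mulmxr smooth_f0 pi0.
Qed.

Lemma frame_f0 i p : cdom M0 i p -> frame (fl q1) i p = frame f0 i p *m Phi q1.
Proof.
move=> pi0; apply/row_matrixP => j; rewrite row_mul !row_frame.
by case: (fintype.split j) => j'; [exact: f0E|exact: push_f0].
Qed.

Lemma f0_unit i p : cdom M0 i p -> frame f0 i p \in unitmx.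
Proof.
move=> pi0; have := unit_gram_frame q1 pi0; rewrite frame_f0// trmx_mul.
have := Phi_gram q1; move: (Phi q1) (frame f0 i p) => F S FG.
rewrite !mulmxA -(mulmxA S) -(mulmxA S) FG.
by rewrite -mulmxA unitmx_mul => /andP[].
Qed.

Lemma f0_local_isometry : (eps = 1 \/ eps = -1) -> local_isometry eps g0 f0.
Proof.
move=> heps; have spf p : spaceform eps _ (f p) by case: isof.
split.
- exact: smooth_f0.
- move=> p; split; first by rewrite -(ip_Phi q1) -f0E ip_ff.
  move=> em i iv; have -> : i = 0 by apply: val_inj.
  (* Both values lie on the upper sheet; since [f (q0, q1)] has frame coordinates [e1], their
     product is minus the first coordinate of [f0 p]. *)
  have lt0 : ip eps (f (p, q1)) (f (q0, q1)) < 0.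
    have [e1 h1] := spf (p, q1); have [e2 h2] := spf (q0, q1); rewrite em in e1 e2 *.
    by apply: future_ip_lt0; rewrite ?e1 ?e2 ?oppr_lt0//; [exact: h1|exact: h2].
  move: lt0; rewrite f0E -(Phi_e1 q1) ip_Phi em; move: (f0 p) => x.
  rewrite /ip big_ord_recl /= big1 ?addr0.
    by rewrite mulN1r mxE eqxx mulr1 oppr_lt0.
  by move=> j _; rewrite !mxE eqxx /= mulr0.
- move=> i p u v pi0; rewrite -(ip_Phi q1) -!push_f0//; exact: push_fl_fl.
move=> i p w pi0 fw; have uS := f0_unit pi0.
have wE : w = w *m invmx (frame f0 i p) *m frame f0 i p by rewrite mulmxKV.
move: wE; rewrite (mul_frame _ smooth_f0 pi0) => wE.
move: fw; rewrite wE ipDr ipZr -(ip_Phi q1) -!f0E ip_ff.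
rewrite -(ip_Phi q1) -f0E -push_f0// ipC push_fl_f// addr0 => /eqP.
rewrite mulf_eq0 => /orP[/eqP a0|/eqP e0]; last first.
  by move: ee; rewrite e0 mul0r => /eqP; rewrite eq_sym oner_eq0.
by eexists; rewrite a0 scale0r add0r.
Qed.

End BasePoint.

End PolarGeometry.

(** * Parallel normal frames *)

Lemma euclid_charts_ok (R : realType) s : charts_ok (euclid R s).
Proof.
split=> [p|[]]; first by exists tt.
split=> //=; first exact: openT.
- by rewrite image_id; exact: openT.
- by move=> p _; exact: cvg_id.
by move=> p _; exact: cvg_id.
Qed.

(** [normal_part] is chosen by [xget], so uniqueness is the point: two candidates differ by a vector
    both tangent and normal, which has square zero and therefore vanishes by hypothesis. *)
Lemma normal_part_eq (R : realType) (eps : R) (M : atlas R) k (F : M -> 'rV[R]_k) i p w z :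
  smooth_map F -> cdom M i p ->
  (forall u, ip eps (push F i p u) (push F i p u) = 0 -> u = 0) ->
  Defs.normal_space eps F i p w -> normal_part eps F i p (w + push F i p z) = w.
Proof.
move=> sF pi immF wn; apply: xget_unique.
  by split => //; exists z => //; rewrite addrAC subrr add0r.
move=> w' [wn' [a _ aE]].
have e : w - w' = push F i p (a - z).
  rewrite -[- z]scaleN1r (pushD _ _ sF pi) (pushZ _ _ sF pi) aE scaleN1r.
  by rewrite addrAC addrK.
have az : a - z = 0 by apply: immF; rewrite -{1}e ipBl wn wn' subrr.
by move: e; rewrite az push0 => /eqP; rewrite subr_eq0 => /eqP.
Qed.

Section ParallelFrame.
Variables (R : realType) (eps : R) (M : atlas R) (k s : nat).
Variables (F : M -> 'rV[R]_k) (Phi : M -> 'M[R]_(s, k)).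
Hypothesis ee : eps * eps = 1.
Hypothesis okM : charts_ok M.
Hypothesis sF : smooth_map F.
Hypothesis immF : forall i p u, cdom M i p ->
  ip eps (push F i p u) (push F i p u) = 0 -> u = 0.
Hypothesis sPhi : forall i, Csmooth (cmap M i @` cdom M i) (Phi \o cinv M i).
Hypothesis gramPhi : forall p, Phi p *m ipmx eps k *m (Phi p)^T = ipmx eps s.
Hypothesis normalPhi : forall i p, cdom M i p ->
  range (fun y => y *m Phi p) = Defs.normal_space eps F i p.
Hypothesis tangentPhi : forall i p y u, cdom M i p ->
  exists z, push (fun q => y *m Phi q) i p u = push F i p z.
Hypothesis spanPhi : forall i p x, cdom M i p ->
  exists y z, x = y *m Phi p + push F i p z.

Lemma ip_frame p y z : ip eps (y *m Phi p) (z *m Phi p) = ip eps y z.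
Proof.
have := gramPhi p; move: (Phi p) => G GE.
by rewrite !ipE trmx_mul !mulmxA -(mulmxA y) -(mulmxA y) GE.
Qed.

Lemma frame_orth i p y u : cdom M i p -> ip eps (y *m Phi p) (push F i p u) = 0.
Proof.
move=> pi; have : range (fun y => y *m Phi p) (y *m Phi p) by exists y.
by rewrite (normalPhi pi); exact.
Qed.

Lemma normal_part_frame i p y z : cdom M i p ->
  normal_part eps F i p (y *m Phi p + push F i p z) = y *m Phi p.
Proof.
move=> pi; apply: normal_part_eq => //; first by move=> u; exact: immF.
by rewrite -(normalPhi pi); exists y.
Qed.

Lemma normal_part_tangent i p z : cdom M i p -> normal_part eps F i p (push F i p z) = 0.
Proof. by move=> pi; have := normal_part_frame 0 z pi; rewrite mul0mx add0r. Qed.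

Lemma smooth_frame_map : smooth_map (fun q : prod2 M (euclid R s) => q.2 *m Phi q.1 : 'rV[R]_k).
Proof.
have okE := euclid_charts_ok R s.
apply/smooth_mapP => -[i []]; have oc := chart_image_open (prod2_charts_ok okM okE) (i := (i, tt)).
apply: Csmooth_mulmx => //.
  apply: (@Csmooth_affine _ _ _ _ (fun x => rsubmx x)) => h w y /=.
  by rewrite linearP.
have AL : affine_along (@lsubmx R 1 (mdim M) s) (@lsubmx R 1 (mdim M) s).
  by move=> h w y; rewrite linearP.
have := Csmooth_comp_affine AL (fun x => affine_differentiable x AL) (sPhi i).
by apply: Csmooth_sub; rewrite image_prod2 => x [].
Qed.

Lemma frame_parallel : parallel_isometry eps F (fun p y => y *m Phi p).
Proof.
split.
- exact: smooth_frame_map.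
- by move=> p a y z; rewrite mulmxDl -scalemxAl.
- exact: ip_frame.
- exact: normalPhi.
move=> i p u y pi; rewrite /nabla_perp; have [z ->] := tangentPhi y u pi.
exact: normal_part_tangent.
Qed.

(** In a parallel frame the normal connection is the ordinary derivative of the coefficients [w];
    the derivative of the frame itself contributes only tangent vectors. *)
Lemma nabla_perp_frame i p v (eta : M -> 'rV[R]_k) (w : 'rV[R]_(mdim M) -> 'rV[R]_s) :
  cdom M i p -> differentiable w (cmap M i p) ->
  (\forall x \near cmap M i p, eta (cinv M i x) = w x *m Phi (cinv M i x)) ->
  nabla_perp eps F i v eta p = 'D_v w (cmap M i p) *m Phi p.
Proof.
move=> pi dw etaE; rewrite /nabla_perp.
have dPhi : differentiable (Phi \o cinv M i) (cmap M i p).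
  exact: Csmooth_differentiable (sPhi i) (chart_image_mem pi).
have -> : push eta i p v = 'D_v w (cmap M i p) *m Phi p +
    push (fun q => w (cmap M i p) *m Phi q) i p v.
  apply: etrans (near_eq_derive _ etaE) _.
  apply: etrans (derive_mulmx v dw dPhi) _.
  rewrite (chart_compK okM _ pi); congr (_ + _).
  exact: esym (derive_mulmxl _ _ dPhi).
have [z ->] := tangentPhi (w (cmap M i p)) v pi.
exact: normal_part_frame.
Qed.

(** The curvature becomes the commutator of two directional derivatives of the coefficient vector
    [y], which is zero by symmetry of second derivatives. *)
Lemma frame_flat : flat_normal_bundle eps F.
Proof.
move=> W xi oW [sxi nxi] i p u v Wp pi.
pose D := cmap M i @` (cdom M i `&` W).
pose y q := xi q *m (ipmx eps k *m (Phi q)^T *m ipmx eps s).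
have Dsub : D `<=` cmap M i @` cdom M i by move=> _ [q [qi _] <-]; exists q.
have xiE q : cdom M i q -> W q -> xi q = y q *m Phi q.
  move=> qi Wq; have : range (fun y => y *m Phi q) (xi q).
    by rewrite (normalPhi qi); exact: nxi.
  move=> [z _ zE]; rewrite /y -zE; have := gramPhi q; move: (Phi q) => G GE.
  by rewrite !mulmxA -(mulmxA z) -(mulmxA z) GE -(mulmxA z) (ipmxK _ ee) mulmx1.
have oD : open D.
  rewrite openE => _ [q [qi Wq] <-].
  case: (okM.2 i) => _ _ _ _ /(_ _ (chart_image_mem qi)) ci.
  have nW : \forall x \near cmap M i q, W (cinv M i x).
    by apply: (ci W); rewrite chart_invK//; exact: open_nbhs_nbhs.
  apply: filterS2 nW (chart_image_near okM qi) => x Wx [q' q'i xE].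
  by exists q' => //; split => //; rewrite -xE chart_invK in Wx.
have sy : Csmooth D (y \o cinv M i).
  apply: (Csmooth_mulmx oD (sxi i)); apply: (Csmooth_mulmx oD _ (Csmooth_cst _ _)).
  apply: (Csmooth_mulmx oD (Csmooth_cst _ _)).
  by apply: (Csmooth_trmx oD); exact: (Csmooth_sub Dsub (sPhi i)).
have nearD q : cdom M i q -> W q -> \forall x \near cmap M i q, D x.
  by move=> qi Wq; apply: open_nbhs_nbhs; split => //; exists q.
have Dpt q : cdom M i q -> W q -> D (cmap M i q) by move=> qi Wq; exists q.
have N1 a q : cdom M i q -> W q ->
    nabla_perp eps F i a xi q = 'D_a (y \o cinv M i) (cmap M i q) *m Phi q.
  move=> qi Wq; apply: (nabla_perp_frame a qi).
    exact: Csmooth_differentiable sy (Dpt q qi Wq).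
  apply: filterS (nearD q qi Wq) => _ [q' [q'i Wq'] <-].
  by rewrite /= chart_invK//; exact: xiE.
have N2 a b : nabla_perp eps F i a (nabla_perp eps F i b xi) p =
    'D_a ('D_b (y \o cinv M i)) (cmap M i p) *m Phi p.
  apply: (nabla_perp_frame a pi).
    exact: Csmooth_differentiable (Csmooth_derive b sy) (Dpt p pi Wp).
  apply: filterS (nearD p pi Wp) => _ [q' [q'i Wq'] <-].
  by rewrite N1 chart_invK.
have N2C := congr1 (mulmx^~ (Phi p)) (derive_comm v u oD (Dpt p pi Wp) sy).
have N2vu := etrans (N2 v u) N2C.
by apply: etrans (congr2 (fun a b => a - b) (N2 u v) N2vu) _; exact: subrr.
Qed.

Lemma frame_Omega (e1 Y : 'rV[R]_s) :
  (forall p, e1 *m Phi p = F p) ->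
  (forall i p u, cdom M i p -> push (fun q => (e1 + Y) *m Phi q) i p u = 0 -> u = 0) ->
  Omega eps F (fun p y => y *m Phi p) Y.
Proof.
move=> e1F reg i p pi.
have sPY (z : 'rV[R]_s) : smooth_map (fun q => z *m Phi q).
  apply/smooth_mapP => j.
  exact: (Csmooth_mulmx (@chart_image_open _ _ okM j) (Csmooth_cst _ z) (sPhi j)).
pose x j := sval (cid (tangentPhi Y (delta_mx 0 j) pi)).
have xE j : push (fun q => Y *m Phi q) i p (delta_mx 0 j) = push F i p (x j).
  exact: (svalP (cid (tangentPhi Y (delta_mx 0 j) pi))).
pose A : 'M[R]_(mdim M) := - \matrix_(j, l) x j 0 l.
have AE u : push F i p (u *m A) = - push (fun q => Y *m Phi q) i p u.
  rewrite (push_delta u (sPY Y) pi) /A mulmxN -scaleN1r (pushZ _ _ sF pi) scaleN1r.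
  congr (- _); rewrite mulmx_sum_row (push_sum _ sF pi); apply: eq_bigr => j _.
  rewrite (pushZ _ _ sF pi) xE; congr (_ *: push F i p _).
  by apply/rowP => l; rewrite !mxE.
(* Weingarten: [A] is the shape operator of [Y *m Phi], and [push F] composed
   with [1 - A] is the push-forward of [(e1 + Y) *m Phi]. *)
exists A.
  move=> u v; rewrite AE ipNl /second_form.
  have [y [z hE]] := spanPhi (hess F i p u v) pi.
  have -> : ip eps (normal_part eps F i p (hess F i p u v)) (Y *m Phi p) =
      ip eps (hess F i p u v) (Y *m Phi p).
    by rewrite hE normal_part_frame// ipDl (ipC _ (push F i p z)) frame_orth// addr0.
  have sFc := (smooth_mapP F).1 sF i.
  have d1 := Csmooth_differentiable (Csmooth_derive v sFc) (chart_image_mem pi).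
  have d2 := smooth_chart_differentiable (sPY Y) pi.
  (* The derivative of [F] along [v] stays orthogonal to [Y *m Phi]. Differentiating this along [u]
     exchanges the second derivative of [F] for the derivative of the normal field. *)
  have := derive_ip eps u d1 d2.
  rewrite (@near_eq_derive _ _ _ _ (fun=> 0 : R^o)); last first.
    apply: filterS (chart_image_near okM pi) => _ [q qi <-] /=.
    by rewrite (chart_invK okM qi) ipC; exact: frame_orth qi.
  rewrite (derive_cst (0 : R^o)) (chart_compK okM _ pi) => /esym/eqP.
  rewrite addrC addr_eq0 => /eqP e; rewrite (ipC eps (push (fun q => Y *m Phi q) i p u)).
  exact: etrans (congr1 -%R e) (opprK _).
rewrite -row_free_unit -kermx_eq0; apply/rowV0P => w /sub_kermxP.
rewrite mulmxBr mulmx1 => /eqP; rewrite subr_eq0 => /eqP wA.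
apply: (reg i p w pi).
have -> : (fun q => (e1 + Y) *m Phi q) = fun q => F q + Y *m Phi q.
  by apply/funext => q; rewrite mulmxDl e1F.
have d1 := smooth_chart_differentiable sF pi.
have d2 := smooth_chart_differentiable (sPY Y) pi.
apply: etrans (@deriveD _ _ _ _ _ _ _ (diff_derivable d1) (diff_derivable d2)) _.
by rewrite -/(push F i p w) {1}wA AE addNr.
Qed.

End ParallelFrame.

(** * Immersions of products without mixed second derivatives *)

(** The linear span of an arbitrary set as a row space: elements of [S] are adjoined as long as the
    rank grows. Minimality enters only through its dual form [Q], which says that whatever is
    orthogonal to [S] is orthogonal to [U]. *)
Lemma span_exists (R : realType) eps n (S : set 'rV[R]_n) :
  exists U : 'M[R]_n, (forall x, S x -> (x <= U)%MS) /\
    (forall y, (forall x, S x -> ip eps x y = 0) ->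
       forall x : 'rV_n, (x <= U)%MS -> ip eps x y = 0).
Proof.
pose Q (U : 'M[R]_n) := forall y, (forall x, S x -> ip eps x y = 0) ->
  forall x : 'rV_n, (x <= U)%MS -> ip eps x y = 0.
suff H k (U0 : 'M[R]_n) : (n - \rank U0 <= k)%N -> Q U0 ->
    exists U : 'M[R]_n, (forall x, S x -> (x <= U)%MS) /\ Q U.
  apply: (H n 0); first by rewrite leq_subr.
  by move=> y _ x; rewrite submx0 => /eqP ->; exact: ip0l.
elim: k U0 => [|k IH] U0 rk QU.
  exists U0; split => // x _; apply: submx_full; rewrite /row_full.
  by rewrite eqn_leq rank_leq_col -subn_eq0 -leqn0.
have [SU|] := pselect (forall x, S x -> (x <= U0)%MS); first by exists U0.
move=> /existsNP[x /not_implyP[Sx /negP xU]].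
apply: (IH (U0 + x)%MS).
  have lt : (\rank U0 < \rank (U0 + x)%MS)%N.
    rewrite ltn_neqAle mxrankS ?addsmxSl// andbT; apply: contra xU => /eqP e.
    have := mxrank_leqif_sup (addsmxSl U0 x) => -[_]; rewrite e eqxx => /esym.
    by rewrite addsmx_sub => /andP[].
  have rn : (\rank (U0 + x)%MS <= n)%N by exact: rank_leq_col.
  by rewrite -ltnS (leq_trans _ rk)// ltn_sub2l// (leq_trans lt).
move=> y Sy z /sub_addsmxP[[u1 u2] /= ->]; rewrite ipDl (QU y Sy) ?submxMl// add0r.
by rewrite [u2]mx11_scalar mul_scalar_mx ipZl Sy ?mulr0.
Qed.

Section ConstantNorm.
Variables (R : realType) (e : R) (N : atlas R) (k : nat) (F : N -> 'rV[R]_k).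
Hypothesis okN : charts_ok N.
Hypothesis sF : smooth_map F.

Lemma ip_push_self i p u (a : R) : cdom N i p -> (forall q, ip e (F q) (F q) = a) ->
  ip e (push F i p u) (F p) = 0.
Proof.
move=> pi Fa; have dF := smooth_chart_differentiable sF pi.
have := derive_ip e u dF dF.
rewrite (_ : (fun _ => _) = fun=> a); last by apply/funext => x; exact: Fa.
rewrite (derive_cst (a : R^o)) (chart_compK okN _ pi) -/(push F i p u) [X in _ + X]ipC => /esym.
by rewrite -mulr2n => /eqP; rewrite mulrn_eq0 => /eqP.
Qed.

Lemma constant_norm : connected [set: N] ->
  (forall i p u, cdom N i p -> ip e (push F i p u) (F p) = 0) ->
  forall p q, ip e (F p) (F p) = ip e (F q) (F q).
Proof.
move=> conN F0 p q; pose G p := F p *m ipmx e k *m (F p)^T.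
suff: G p = G q by move=> /(congr1 (fun A : 'M[R]_1 => A 0 0)); rewrite -!ipE.
apply: (chart_cst okN conN) => i {}p.
  move=> pi; have dF := smooth_chart_differentiable sF pi.
  exact: differentiable_mulmx (differentiable_mulmxr _ dF) (differentiable_trmx dF).
move=> u pi; have dF := smooth_chart_differentiable sF pi.
apply: etrans (derive_mulmx u (differentiable_mulmxr (ipmx e k) dF) (differentiable_trmx dF)) _.
rewrite (derive_mulmxr _ _ dF) (derive_trmx _ dF) (chart_compK okN _ pi).
apply: etrans (congr2 +%R (ip_mx11 e (push F i p u) (F p)) (ip_mx11 e (F p) (push F i p u))) _.
have h := F0 i p u pi; rewrite (ipC e (F p) (push F i p u)) h.
by rewrite -raddfD addr0 raddf0.
Qed.

End ConstantNorm.

Section ProductImmersion.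
Variables (R : realType) (eps : R) (n r : nat) (M : 'I_r -> atlas R).
Variable ft : prodn M -> 'rV[R]_n.
Hypothesis okM : forall a, charts_ok (M a).
Hypothesis conMt : connected [set: prodn M].
Hypothesis sft : smooth_map ft.
Hypothesis blocks_orth : forall c p a b u v, a != b -> cdom (prodn M) c p ->
  ip eps (push ft c p (block a u)) (push ft c p (block b v)) = 0.
Hypothesis blocks_pos : forall c p a u, cdom (prodn M) c p ->
  ip eps (push ft c p (block a u)) (push ft c p (block a u)) = 0 -> u = 0.
Hypothesis blocks_hess : forall c p a b u v, a != b -> cdom (prodn M) c p ->
  hess ft c p (block a u) (block b v) = 0.
Variable p1 : prodn M.

Let okMt : charts_ok (prodn M) := prodn_charts_ok okM.

Definition factor_map a : M a -> 'rV[R]_n := fun z => ft (dfwith p1 a z).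

(** Freezing the a-th coordinate at [z] is affine in charts, and its linear part forgets the a-th
    block. It serves to vary all the other factors at once. *)
Lemma slice_replace a c i z : cdom (M a) i z ->
  exists A, @slice R (prodn M) (prodn M) (fun q => dfwith q a z) c (dfwith c a i) A
    (fun v => v - block a (submxrow v a)).
Proof.
move=> iz.
exists (fun x => \mxrow_b dfwith (fun b => submxrow x b) a (cmap (M a) i z) b); split.
- move=> h w y; apply/mxrowP => b; rewrite mxrowK submxrowD.
  have e (v : 'rV[R]_(mdim (prodn M))) : submxrow (h *: v) b = h *: submxrow v b.
    by apply/rowP => l; rewrite !mxE.
  rewrite e mxrowK submxrowB submxrow_block.
  have [<-|ab] := eqVneq a b; first by rewrite !dfwithin subrr scaler0 add0r.
  by rewrite !dfwithout// subr0 submxrowD e.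
- move=> x; apply: functional_extensionality_dep => b /=; rewrite mxrowK.
  have [<-|ab] := eqVneq a b; first by rewrite !dfwithin (chart_invK (okM a)).
  by rewrite !dfwithout.
move=> q cq; split.
  by move=> b; have [<-|ab] := eqVneq a b; rewrite ?dfwithin ?dfwithout.
apply: eq_mxrow => b; have [<-|ab] := eqVneq a b; rewrite ?dfwithin ?dfwithout//.
by rewrite mxrowK.
Qed.

Lemma minus_block_sum a (v : 'rV[R]_(mdim (prodn M))) :
  v - block a (submxrow v a) = \sum_(b | b != a) block b (submxrow v b).
Proof. by rewrite {1}(sum_block v) (bigD1 a)//= addrAC subrr add0r. Qed.

Lemma push_sum_cond (P : pred 'I_r) (y : 'I_r -> 'rV[R]_(mdim (prodn M))) c p :
  cdom (prodn M) c p ->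
  push ft c p (\sum_(b | P b) y b) = \sum_(b | P b) push ft c p (y b).
Proof.
move=> cp; elim/big_rec2: _ => [|b x z _ <-]; first exact: push0.
by rewrite (pushD _ _ sft cp).
Qed.

Lemma push_factor_at a i z u p : cdom (M a) i z ->
  forall c, cdom (prodn M) c p ->
  push (fun z' => ft (dfwith p a z')) i z u =
  push ft (dfwith c a i) (dfwith p a z) (block a u).
Proof. by move=> iz c cp; exact: (slice_push (slice_dfwith i okM cp) ft u iz). Qed.

Lemma hess_minus_block c p a u v : cdom (prodn M) c p ->
  hess ft c p (v - block a (submxrow v a)) (block a u) = 0.
Proof.
move=> cp; rewrite minus_block_sum.
have sD := Csmooth_derive (block a u) ((smooth_mapP ft).1 sft c).
have dD := Csmooth_differentiable sD (chart_image_mem cp).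
pose K (y : 'rV[R]_(mdim (prodn M))) := hess ft c p y (block a u) = 0.
suff: K (\sum_(b | b != a) block b (submxrow v b)) by [].
apply: (big_ind K); first exact: derive0.
  by move=> x y Kx Ky; rewrite /K /hess (deriveDv _ _ dD); rewrite -/(hess ft c p x _) Kx add0r.
by move=> b ba; exact: blocks_hess.
Qed.

(* Moving [p] along another factor changes this vector by mixed second
   derivatives of [ft], and moving it along the a-th factor has no effect. *)
Lemma push_factor_cst a i z u p q : cdom (M a) i z ->
  push (fun z' => ft (dfwith p a z')) i z u = push (fun z' => ft (dfwith q a z')) i z u.
Proof.
move=> iz.
pose F (p : prodn M) := push (fun z' => ft (dfwith p a z')) i z u.
suff: F p = F q by []; apply: (chart_cst okMt conMt).
  move=> c {}p cp; have [A sA] := slice_replace c iz; have [AL _ Ap] := sA.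
  have s1 := Csmooth_derive (block a u) ((smooth_mapP ft).1 sft (dfwith c a i)).
  have [d1 d2] := Ap p cp.
  have dD := Csmooth_differentiable s1 (chart_image_mem d1).
  rewrite -d2 in dD.
  apply: near_eq_differentiable (differentiable_comp (affine_differentiable _ AL) dD).
  apply: filterS (chart_image_near okMt cp) => _ [q' cq' <-].
  apply: etrans _ (esym (chart_compK okMt F cq')).
  rewrite /F (push_factor_at u iz cq') /push.
  by have [_ <-] := Ap q' cq'.
move=> c {}p v cp; have [A sA] := slice_replace c iz; have [AL _ Ap] := sA.
have [d1 d2] := Ap p cp.
apply: etrans _ (hess_minus_block u v d1).
rewrite /hess -d2; apply: etrans _ (derive_affineE _ _ _ AL).
apply: near_eq_derive; apply: filterS (chart_image_near okMt cp) => _ [q' cq' <-].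
apply: etrans (chart_compK okMt F cq') _.
rewrite /F (push_factor_at u iz cq') /push.
by have [_ <-] := Ap q' cq'.
Qed.

Lemma push_block c p a u : cdom (prodn M) c p ->
  push ft c p (block a u) = push (@factor_map a) (c a) (p a) u.
Proof.
move=> cp; apply: etrans (push_factor_cst u p p1 (cp a)).
by rewrite (push_factor_at u (cp a) cp) !dfwith_id.
Qed.

Lemma chart_at (p : prodn M) a i : cdom (M a) i (p a) ->
  exists2 c, cdom (prodn M) c p & c a = i.
Proof.
move=> ip; have [c cp] := okMt.1 p; exists (dfwith c a i); last by rewrite dfwithin.
by move=> b; have [<-|ab] := eqVneq a b; rewrite ?dfwithin ?dfwithout.
Qed.

Lemma push_factor a i z u c p : cdom (prodn M) c p -> c a = i -> p a = z ->
  push (@factor_map a) i z u = push ft c p (block a u).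
Proof. by move=> cp ca pa; move: u; rewrite -ca -pa => u; rewrite push_block. Qed.

Definition factor_pushes a : set 'rV[R]_n :=
  [set x | exists i z u, cdom (M a) i z /\ x = push (@factor_map a) i z u].

Definition tangent_span a : 'M[R]_n := sval (cid (span_exists eps (factor_pushes a))).

Lemma tangent_spanP a i z u : cdom (M a) i z ->
  (push (@factor_map a) i z u <= tangent_span a)%MS.
Proof.
move=> iz; rewrite /tangent_span; case: cid => U /= [h _]; apply: h.
by exists i, z, u.
Qed.

Lemma push_tangent_span c p a u : cdom (prodn M) c p ->
  (push ft c p (block a u) <= tangent_span a)%MS.
Proof. by move=> cp; rewrite push_block//; exact: tangent_spanP. Qed.

Lemma tangent_span_orth a y :
  (forall i z u, cdom (M a) i z -> ip eps (push (@factor_map a) i z u) y = 0) ->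
  forall x : 'rV_n, (x <= tangent_span a)%MS -> ip eps x y = 0.
Proof.
move=> H; rewrite /tangent_span; case: cid => U /= [_ h]; apply: h.
by move=> _ [i [z [u [iz ->]]]]; exact: H.
Qed.

(** Generators of the two spans may come from unrelated points [z] and [w]. Since they do not depend
    on the remaining coordinates, both can be evaluated at one point having [z] in slot [a] and [w]
    in slot [b], where the blocks are orthogonal. *)
Lemma tangent_span_mutually_orthogonal : mutually_orthogonal eps tangent_span.
Proof.
move=> a b x y ab xU yU; apply: (tangent_span_orth _ xU) => i z u iz.
rewrite ipC; apply: (tangent_span_orth _ yU) => j w v jw.
have [c0 c0p] := okMt.1 p1.
pose p : prodn M := dfwith (dfwith p1 a z) b w.
pose c : idx (prodn M) := dfwith (dfwith c0 a i) b j.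
have cp : cdom (prodn M) c p.
  move=> d; rewrite /c /p; have [<-|bd] := eqVneq b d; first by rewrite !dfwithin.
  rewrite !(dfwithout _ _ bd); have [<-|ad] := eqVneq a d; first by rewrite !dfwithin.
  by rewrite !(dfwithout _ _ ad); exact: c0p.
have ba : b != a by rewrite eq_sym.
rewrite (@push_factor b j w v c p cp) ?(@push_factor a i z u c p cp)//.
- by rewrite ipC blocks_orth.
- by rewrite /c (dfwithout _ _ ba) dfwithin.
- by rewrite /p (dfwithout _ _ ba) dfwithin.
- by rewrite /c dfwithin.
by rewrite /p dfwithin.
Qed.

(** Moving the coordinates other than the b-th changes [ft] by vectors of the spans that [X] kills.
    This is what splits [ft] into maps of the single factors. *)
Lemma proj_factor k (X : 'M[R]_(n, k)) b :
  (forall a, a != b -> forall x : 'rV_n, (x <= tangent_span a)%MS -> x *m X = 0) ->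
  forall p, ft p *m X = factor_map (p b) *m X.
Proof.
move=> HX p; have [i ip] := (okM b).1 (p b).
rewrite /factor_map -{1}(dfwith_id p b).
pose F (q : prodn M) := ft (dfwith q b (p b)) *m X.
suff: F p = F p1 by []; apply: (chart_cst okMt conMt).
  move=> c q cq; have [A sA] := slice_replace c ip.
  have s1 := slice_Csmooth sA ((smooth_mapP ft).1 sft (dfwith c b i)).
  have d1 := Csmooth_differentiable s1 (chart_image_mem cq).
  exact: differentiable_mulmxr d1.
move=> c q v cq; have [A sA] := slice_replace c ip.
have s1 := slice_Csmooth sA ((smooth_mapP ft).1 sft (dfwith c b i)).
have d1 := Csmooth_differentiable s1 (chart_image_mem cq).
apply: etrans (derive_mulmxr X v d1) _.
have [_ _ /(_ q cq)[d2 _]] := sA.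
rewrite (slice_derive sA ft v cq) -/(push ft _ _ _) minus_block_sum push_sum_cond//.
rewrite mulmx_suml big1// => a ab; apply: (HX a ab); exact: push_tangent_span.
Qed.

Lemma smooth_factor a : smooth_map (@factor_map a).
Proof.
apply: (@slice_smooth _ (M a) (prodn M) (fun z => dfwith p1 a z) _ ft _ sft) => i.
have [c cp] := okMt.1 p1.
by do 3!eexists; exact: (slice_dfwith i okM cp).
Qed.

Lemma push_factor_eq0 a i z u : cdom (M a) i z ->
  ip eps (push (@factor_map a) i z u) (push (@factor_map a) i z u) = 0 -> u = 0.
Proof.
move=> iz; have [|c cp ca] := @chart_at (dfwith p1 a z) a i; first by rewrite dfwithin.
by rewrite (push_factor u cp ca (dfwithin _ _)); exact: blocks_pos.
Qed.

Lemma immersion_factor k a (X : 'M[R]_(n, k)) :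
  (forall x : 'rV_n, (x <= tangent_span a)%MS -> x *m X = 0 -> ip eps x x = 0) ->
  immersion (fun z => factor_map z *m X : 'rV[R]_k) (M := M a).
Proof.
move=> HX; split; first exact: (smooth_mulmxr (okM a) X (@smooth_factor a)).
move=> i z iz u v; have sa := @smooth_factor a.
rewrite (push_mulmxr X u sa iz) (push_mulmxr X v sa iz) => /eqP.
rewrite -subr_eq0 -mulmxBl -scaleN1r -(pushZ _ _ sa iz) -(pushD _ _ sa iz) scaleN1r => /eqP uv.
apply/eqP; rewrite -subr_eq0; apply/eqP; apply: (push_factor_eq0 iz).
by apply: HX uv; exact: tangent_spanP.
Qed.

Lemma connected_factor a : connected [set: M a].
Proof.
have -> : [set: M a] = (fun p : prodn M => p a : M a) @` [set: prodn M].
  apply/seteqP; split=> // z _; exists (dfwith p1 a z) => //.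
  exact: dfwithin.
apply: (connected_continuous_connected conMt); apply: continuous_subspaceT => p.
exact: (@proj_continuous _ M a).
Qed.

Hypothesis ee : eps * eps = 1.
Hypothesis ft_norm : forall p, ip eps (ft p) (ft p) = eps.
Hypothesis dim_pos : forall a, (0 < mdim (M a))%N.

Lemma proj_cst k (X : 'M[R]_(n, k)) :
  (forall a (x : 'rV_n), (x <= tangent_span a)%MS -> x *m X = 0) ->
  forall p q, ft p *m X = ft q *m X.
Proof.
move=> HX; apply: (chart_cst okMt conMt) => c p.
  by move=> cp; exact: differentiable_mulmxr (smooth_chart_differentiable sft cp).
move=> v cp; apply: etrans (derive_mulmxr X v (smooth_chart_differentiable sft cp)) _.
rewrite -/(push ft c p v) (sum_block v) (push_sum _ sft cp) mulmx_suml big1// => a _.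
by apply: (HX a); exact: push_tangent_span.
Qed.

Lemma factor_nontrivial k a (X : 'M[R]_(n, k)) :
  immersion (fun z => factor_map z *m X : 'rV[R]_k) (M := M a) ->
  (forall z : M a, factor_map z *m X = 0) -> False.
Proof.
move=> [_ inj] X0; have [i ip] := (okM a).1 (p1 a).
have l0 : (0 < mdim (M a))%N by exact: dim_pos.
have := inj i (p1 a) ip (delta_mx 0 (Ordinal l0)) 0.
rewrite push0 /push (_ : _ \o _ = fun=> 0); last by apply/funext => x; exact: X0.
rewrite (derive_cst 0) => /(_ erefl) /rowP /(_ (Ordinal l0)).
by rewrite !mxE !eqxx => /eqP; rewrite oner_eq0.
Qed.

(** The condition on [sg] allows at most one Lorentzian summand, and only for [eps = -1]. The
    components of [ft] depend on one factor each and have constant squares [rho a] with sum [eps];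
    up to the sign [sg a] these are the squared radii. *)
Lemma quadric_product_of_decomp (sg : 'I_r -> R) (m : 'I_r -> nat)
    (iota : forall a, 'M[R]_(m a, n)) :
  (forall a, sg a = 1 \/ [/\ sg a = -1, eps = -1 & forall b, b != a -> sg b = 1]) ->
  orth_decomp eps sg iota -> (forall a, (tangent_span a <= iota a)%MS) ->
  (forall a, sg a = -1 -> forall z (i : 'I_(m a)), val i = 0%N ->
     0 < (@factor_map a z *m decomp_proj eps (sg a) (iota a)) 0 i) ->
  quadric_product eps sg ft.
Proof.
move=> sgP dec Uiota orient.
have ss a : sg a * sg a = 1 by case: (sgP a) => [->|[-> _ _]]; rewrite ?mulr1// mulrNN mulr1.
have [P1 P2 P3] := decomp_projK ss dec; have [io1 io2 _] := dec.
pose pi a := decomp_proj eps (sg a) (iota a).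
pose H a (z : M a) : 'rV[R]_(m a) := factor_map z *m pi a.
have tang a (x : 'rV_n) : (x <= tangent_span a)%MS -> x *m pi a *m iota a = x.
  move=> xU; have /submxP[w ->] := submx_trans xU (Uiota a).
  by rewrite -(mulmxA w) P1 mulmx1.
have tang0 a b (x : 'rV_n) : b != a -> (x <= tangent_span b)%MS -> x *m pi a = 0.
  move=> ba xU; have /submxP[w ->] := submx_trans xU (Uiota b).
  by rewrite -(mulmxA w) P2 ?mulmx0// eq_sym.
have FE p a : ft p *m pi a = H a (p a).
  by apply: proj_factor => b ba x; exact: tang0.
have ftE p : ft p = \sum_a H a (p a) *m iota a.
  by rewrite {1}(P3 (ft p)); apply: eq_bigr => a _; rewrite -/(pi a) FE.
have sH a : smooth_map (H a) by exact: smooth_mulmxr (@smooth_factor a).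
have immH a : immersion (H a).
  apply: immersion_factor => x xU x0; rewrite -(tang a x xU) x0 mul0mx.
  exact: ip0l.
(* The push-forward lies in the a-th summand, so pairing it with [H a z] amounts to pairing it with
   the full value of [ft], whose norm is constant. *)
have ipH a i z u : cdom (M a) i z -> ip (sg a) (push (H a) i z u) (H a z) = 0.
  move=> iz; have sa := @smooth_factor a.
  have xU := tangent_spanP u iz; rewrite (push_mulmxr (pi a) u sa iz) -io1 (tang _ _ xU).
  have fn z' : ip eps (@factor_map a z') (factor_map z') = eps by exact: ft_norm.
  have := ip_push_self (okM a) sa u iz fn; rewrite {2}/factor_map ftE ip_sumr (bigD1 a)//=.
  rewrite big1 ?addr0 ?dfwithin// => b ba.
  by rewrite -(tang _ _ xU) io2// eq_sym.
pose rho a := ip (sg a) (H a (p1 a)) (H a (p1 a)).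
have rhoE a z : ip (sg a) (H a z) (H a z) = rho a.
  exact: (constant_norm (okM a) (sH a) (@connected_factor a) (ipH a)).
have rho_sum : \sum_a rho a = eps.
  apply: etrans _ (ft_norm p1); rewrite ftE ip_suml; apply: eq_bigr => a _.
  rewrite ip_sumr (bigD1 a)//= big1 ?addr0; first by rewrite io1.
  by move=> b ba; rewrite io2// eq_sym.
(* A zero radius in a Euclidean summand would make [H a] vanish identically, which is impossible for
   an immersion of a manifold of positive dimension. *)
have rho1 a : sg a = 1 -> 0 < rho a.
  move=> sa; rewrite lt_def {2}/rho sa ip1_ge0 andbT; apply/negP => /eqP r0.
  apply: (factor_nontrivial (immH a)) => z; apply/eqP/negP => /negP Hz.
  by have := ip1_gt0 Hz; rewrite -/(H a z) -sa rhoE r0 ltxx.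
(* In the Lorentzian slot [rho a] equals -1 minus a sum of nonnegative terms. *)
have rho_pos a : 0 < sg a * rho a.
  case: (sgP a) => [sa|[sa em others]]; first by rewrite sa mul1r rho1.
  rewrite sa mulN1r oppr_gt0; have := rho_sum; rewrite (bigD1 a)//= em => /(canRL (addrK _)) ->.
  rewrite subr_lt0 (lt_le_trans (ltrN10 R))//.
  by apply: sumr_ge0 => b ba; rewrite ltW// rho1// others.
exists m, iota, (fun a => Num.sqrt (sg a * rho a)), H.
have radE a : sg a * Num.sqrt (sg a * rho a) ^+ 2 = rho a.
  by rewrite sqr_sqrtr ?(ltW (rho_pos a))// mulrA ss mul1r.
split => //.
- split; first by move=> a; rewrite sqrtr_gt0.
  by rewrite -[RHS]rho_sum; apply: eq_bigr => a _; exact: radE.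
move=> a z; rewrite radE; split; first exact: rhoE.
by move=> sa i i0; exact: orient.
Qed.

End ProductImmersion.

Lemma euclidean_extrinsic_product (R : realType) n r (M : 'I_r -> atlas R)
    (ft : prodn M -> 'rV[R]_n) (p1 : prodn M) : (0 < r)%N ->
  (forall a, charts_ok (M a)) -> connected [set: prodn M] -> smooth_map ft ->
  (forall c p a b u v, a != b -> cdom (prodn M) c p ->
    ip 1 (push ft c p (block a u)) (push ft c p (block b v)) = 0) ->
  (forall c p a u, cdom (prodn M) c p ->
    ip 1 (push ft c p (block a u)) (push ft c p (block a u)) = 0 -> u = 0) ->
  (forall c p a b u v, a != b -> cdom (prodn M) c p ->
    hess ft c p (block a u) (block b v) = 0) ->
  (forall a, (0 < mdim (M a))%N) -> (forall p, ip 1 (ft p) (ft p) = 1) ->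
  quadric_product 1 (fun=> 1) ft.
Proof.
move=> r0 okM conM sft orth pos hess0 dims norm1.
have oU := tangent_span_mutually_orthogonal okM conM sft orth hess0 (p1 := p1).
have [m [iota [dec Uio]]] := euclidean_decomp r0 oU.
apply: (quadric_product_of_decomp okM conM sft pos hess0 norm1 dims _ dec Uio).
  by move=> a; left.
by move=> a e; have := @ltr01 R; rewrite e ltr0N1.
Qed.

(** * Horospheres and the Lorentzian case *)

Lemma ip_delta (R : realType) (e : R) k (x : 'rV[R]_k) i :
  ip e x (delta_mx 0 i) = (if val i == 0%N then e else 1) * x 0 i.
Proof.
rewrite /ip (bigD1 i)//= mxE !eqxx mulr1 big1 ?addr0// => j ji.
by rewrite mxE eqxx (negbTE ji) mulr0.
Qed.

Lemma mulmx_tr_ip (R : realType) k (x y : 'rV[R]_k) : x *m y^T = (ip 1 x y)%:M.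
Proof.
rewrite -ip_mx11; congr (_ *m _); rewrite -[LHS]mulmx1; congr (_ *m _).
by rewrite -diag_const_mx; congr diag_mx; apply/rowP => i; rewrite !mxE if_same.
Qed.

Section Horosphere.
Variables (R : realType) (n : nat) (xi w : 'rV[R]_n.+2).
Hypothesis xixi : ip (-1) xi xi = -1.
Hypothesis xi0 : 0 < xi 0 0.
Hypothesis xiw : ip (-1) xi w = -1.
Hypothesis ww : ip (-1) w w = 0.

(** [xi] and [w] span a nondegenerate plane containing the timelike [xi], so its complement is
    positive definite of dimension [n]. Pairing with [w] isolates the coefficient of [xi], with a
    minus sign from [ip (-1) xi w = -1]. *)
Lemma horosphere_frame : exists C : 'M[R]_(n, n.+2),
  [/\ C *m ipmx (-1) _ *m C^T = 1%:M,
      forall y : 'rV_n, ip (-1) (y *m C) xi = 0 /\ ip (-1) (y *m C) w = 0 &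
      forall z : 'rV_n.+2, exists b,
        z = - ip (-1) z w *: xi + b *: w + z *m (ipmx (-1) _ *m C^T) *m C].
Proof.
have ee : (-1) * (-1) = 1 :> R by rewrite mulrNN mulr1.
pose S : 'M[R]_(1 + 1, n.+2) := col_mx xi w.
have [T [TP Tsplit]] := orth_complement S ee.
have xiS : (xi <= S)%MS by rewrite -[X in (X <= _)%MS]addr0 /S -addsmxE addr0 addsmxSl.
have wS : (w <= S)%MS by rewrite /S -addsmxE addsmxSr.
have SE (s : 'rV_n.+2) : (s <= S)%MS -> exists a b, s = a *: xi + b *: w.
  move/submxP => [D ->]; rewrite -[D]hsubmxK mul_row_col.
  rewrite [lsubmx D]mx11_scalar [rsubmx D]mx11_scalar !mul_scalar_mx.
  by exists (lsubmx D 0 0), (rsubmx D 0 0).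
have ab0 a b : ip (-1) (a *: xi + b *: w) xi = 0 -> ip (-1) (a *: xi + b *: w) w = 0 ->
    a = 0 /\ b = 0.
  rewrite !ipDl !ipZl xixi xiw ww (ipC _ w xi) xiw => h1 h2.
  by split; lra.
have [|rT dec] := Tsplit.
  move=> x xS xT; have [a [b xE]] := SE x xS; have [a0 b0] : a = 0 /\ b = 0.
    by apply: ab0; rewrite -xE; apply: (TP x).1.
  by rewrite xE a0 b0 !scale0r addr0.
have TT (x : 'rV_n.+2) : (x <= T)%MS -> ip (-1) x xi = 0 /\ ip (-1) x w = 0.
  by move=> xT; split; apply: (TP x).1.
have [|m [C [Cip CC CT]]] := @positive_basis R (-1) _ T.
  move=> x xT x0; apply: (@timelike_orth_gt0 _ _ xi) x0; first by rewrite xixi ltrN10.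
  by rewrite ipC; have [] := TT x xT.
have rS : \rank S = 2%N.
  apply/eqP; change (row_free S); rewrite -kermx_eq0; apply/rowV0P => v /sub_kermxP.
  rewrite -[v]hsubmxK mul_row_col [lsubmx v]mx11_scalar [rsubmx v]mx11_scalar !mul_scalar_mx.
  move=> v0; have [-> ->] := ab0 _ _ (etrans (congr1 (fun s : 'rV[R]_n.+2 => ip (-1) s xi) v0) (ip0l _ _))
    (etrans (congr1 (fun s : 'rV[R]_n.+2 => ip (-1) s w) v0) (ip0l _ _)).
  by rewrite !raddf0 row_mx0.
have mn : m = n.
  have : row_free C by apply/row_freeP; exists (ipmx (-1) _ *m C^T); rewrite mulmxA.
  by rewrite /row_free => /eqP <-; rewrite CT rT rS subn2.
move: C Cip CC CT; rewrite mn => C Cip CC CT; exists C; split => //.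
  by move=> y; apply: TT; rewrite -CT submxMl.
move=> z; have [s [t [/SE[a [b ->]] tT zE]]] := dec z.
have [tx tw] := TT t tT.
have zw : - ip (-1) z w = a by rewrite zE !ipDl !ipZl xiw ww tw; lra.
exists b; rewrite zw {1}zE; congr (_ + _).
have /submxP[y tE] : (t <= C)%MS by rewrite CT.
have XC (x : 'rV_n.+2) : (forall y' : 'rV_n, ip (-1) (y' *m C) x = 0) ->
    x *m (ipmx (-1) _ *m C^T) = 0.
  by move=> xC; rewrite mulmxA; apply: row_mulmx_ip0 => j; rewrite ipC rowE.
have [x1 x2] : xi *m (ipmx (-1) _ *m C^T) = 0 /\ w *m (ipmx (-1) _ *m C^T) = 0.
  have yT (y' : 'rV_n) : (y' *m C <= T)%MS by rewrite -CT submxMl.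
  by split; apply: XC => y'; have [] := TT _ (yT y').
rewrite zE !mulmxDl -!scalemxAl x1 x2 !mul0mx !scaler0 !add0r tE.
by rewrite -(mulmxA y) (mulmxA C) CC mulmx1.
Qed.

(* The point with coordinates [y] on the horosphere [<x, w> = -1] through [xi];
   the rows of [C] are an orthonormal basis of the complement of [xi] and [w]. *)
Definition horo_map (C : 'M[R]_(n, n.+2)) (y : 'rV[R]_n) : 'rV[R]_n.+2 :=
  xi + (y *m C + y *m y^T *m (2^-1 *: w)).

Section HorosphereMap.
Variable C : 'M[R]_(n, n.+2).
Hypothesis CC : C *m ipmx (-1) _ *m C^T = 1%:M.
Hypothesis Corth : forall y : 'rV_n, ip (-1) (y *m C) xi = 0 /\ ip (-1) (y *m C) w = 0.
Hypothesis Cdec : forall z : 'rV_n.+2, exists b,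
  z = - ip (-1) z w *: xi + b *: w + z *m (ipmx (-1) _ *m C^T) *m C.

Local Notation j := (horo_map C : euclid R n -> 'rV[R]_n.+2).

Lemma horo_mapE y : horo_map C y = xi + (y *m C + (ip 1 y y / 2) *: w).
Proof. by rewrite /horo_map mulmx_tr_ip mul_scalar_mx scalerA. Qed.

Lemma horo_ipC y z : ip (-1) (y *m C) (z *m C) = ip 1 y z.
Proof.
rewrite ipE trmx_mul !mulmxA -(mulmxA y) -(mulmxA y) CC mulmx1 mulmx_tr_ip.
by rewrite mxE eqxx.
Qed.

Lemma horo_proj y : horo_map C y *m (ipmx (-1) _ *m C^T) = y.
Proof.
have XC (x : 'rV_n.+2) : (forall y' : 'rV_n, ip (-1) (y' *m C) x = 0) ->
    x *m (ipmx (-1) _ *m C^T) = 0.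
  by move=> xC; rewrite mulmxA; apply: row_mulmx_ip0 => l; rewrite ipC rowE.
have x1 := XC xi (fun y' => (Corth y').1); have x2 := XC w (fun y' => (Corth y').2).
rewrite horo_mapE !mulmxDl x1 -scalemxAl x2 scaler0 addr0 add0r.
by rewrite -(mulmxA y) (mulmxA C) CC mulmx1.
Qed.

Lemma horo_ip_w y : ip (-1) (horo_map C y) w = -1.
Proof. by rewrite horo_mapE !ipDl ipZl (Corth y).2 ww xiw mulr0 !addr0. Qed.

Lemma horo_ip_self y : ip (-1) (horo_map C y) (horo_map C y) = -1.
Proof.
rewrite {2}horo_mapE !ipDr !ipZr horo_ip_w horo_mapE !ipDl !ipZl xixi (ipC _ w xi) xiw.
rewrite (ipC _ xi) (ipC _ w) !(Corth y).1 !(Corth y).2 horo_ipC.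
by lra.
Qed.

(** The slice condition fixes the coefficient 1 of [xi], and the square -1 then forces the
    coefficient of [w] to be half the square of the Euclidean coordinates. This is the origin of the
    quadratic term of [horo_map]. *)
Lemma horo_map_onto (z : 'rV[R]_n.+2) : ip (-1) z z = -1 -> ip (-1) z w = -1 ->
  z = horo_map C (z *m (ipmx (-1) _ *m C^T)).
Proof.
move=> zz zw; have [b] := Cdec z; rewrite zw opprK scale1r.
move: (z *m (ipmx _ _ *m _)) => y zE.
rewrite horo_mapE; suff -> : ip 1 y y / 2 = b by rewrite addrA addrAC -addrA {1}zE -addrA.
have wxi := ipC (-1) w xi; rewrite xiw in wxi.
have := zz; rewrite zE !ipDl !ipDr !ipZl !ipZr xixi xiw ww wxi (ipC _ xi) (ipC _ w (y *m C)).
rewrite (Corth y).1 (Corth y).2 horo_ipC.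
by move=> e; lra.
Qed.

(** The product with [xi] is at most -1. A zero time coordinate contradicts the square -1, and a
    negative one would make the opposite vector future timelike, with a product of the wrong
    sign. *)
Lemma horo_future y : 0 < horo_map C y 0 0.
Proof.
have jj := horo_ip_self y; have jxi : ip (-1) (horo_map C y) xi < 0.
  rewrite horo_mapE !ipDl ipZl xixi (Corth y).1 (ipC _ w) xiw.
  by have := ip1_ge0 y; lra.
rewrite ltNge; apply/negP; rewrite le_eqVlt => /orP[/eqP j0|j0].
  have := jj; rewrite ip_lorentz j0 mul0r oppr0 add0r => e.
  by have := ip1_ge0 (\row_i horo_map C y 0 (lift 0 i)); rewrite e ler0N1.
have : ip (-1) (- horo_map C y) xi < 0.
  apply: future_ip_lt0 => //; last by rewrite mxE oppr_gt0.
    by rewrite ipNl ipNr opprK jj ltrN10.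
  by rewrite xixi ltrN10.
by rewrite ipNl oppr_lt0 ltNge (ltW jxi).
Qed.

Lemma horo_smooth : smooth_map j.
Proof.
apply/smooth_mapP => -[]; have oT := chart_image_open (euclid_charts_ok R n) (i := tt).
have sid : Csmooth (cmap (euclid R n) tt @` cdom (euclid R n) tt) (id : 'rV[R]_n -> 'rV[R]_n).
  by apply: (@Csmooth_affine _ _ _ _ id).
apply: (CsmoothD oT (Csmooth_cst _ xi)); apply: (CsmoothD oT).
  exact: (Csmooth_mulmx oT sid (Csmooth_cst _ C)).
apply: (Csmooth_mulmx oT _ (Csmooth_cst _ (2^-1 *: w))).
exact: (Csmooth_mulmx oT sid (Csmooth_trmx oT sid)).
Qed.

Lemma horo_derive (x u : 'rV[R]_n) : 'D_u (horo_map C) x = u *m C + x *m (u^T *m w).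
Proof.
have did : differentiable (id : 'rV[R]_n -> 'rV[R]_n) x.
  exact: (@affine_differentiable R n _ id id).
have d1 := differentiable_mulmxr C did.
have d2 := differentiable_mulmx did (differentiable_trmx did).
have d3 := differentiable_mulmxr (2^-1 *: w) d2.
have dc := differentiable_cst xi x.
apply: etrans (@deriveD _ _ _ (fun=> xi) (fun y => y *m C + y *m y^T *m (2^-1 *: w)) _ _
  (diff_derivable dc) (diff_derivable (differentiableD d1 d3))) _.
rewrite (derive_cst xi) add0r.
apply: etrans (@deriveD _ _ _ (fun y => y *m C) (fun y => y *m y^T *m (2^-1 *: w)) _ _
  (diff_derivable d1) (diff_derivable d3)) _.
rewrite (derive_mulmxr _ _ did) derive_id (derive_mulmxr _ _ d2).
rewrite (derive_mulmx _ did (differentiable_trmx did)) (derive_trmx _ did) derive_id.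
congr (_ + _); rewrite mulmxA !mulmx_tr_ip (ipC 1 u x) -raddfD /= !mul_scalar_mx scalerA.
by congr (_ *: _); lra.
Qed.

Lemma horo_push x u : push j tt x u = u *m C + ip 1 x u *: w.
Proof.
by apply: etrans (horo_derive x u) _; rewrite mulmxA mulmx_tr_ip mul_scalar_mx.
Qed.

Lemma horo_hess x u v : hess j tt x u v = ip 1 u v *: w.
Proof.
have -> : hess j tt x u v = 'D_u (fun y : 'rV[R]_n => v *m C + y *m (v^T *m w)) x.
  by rewrite /hess; congr ('D_u _ x); apply/funext => y; exact: horo_derive.
have AL : affine_along (fun y : 'rV[R]_n => v *m C + y *m (v^T *m w)) (fun y => y *m (v^T *m w)).
  by move=> h z y; rewrite mulmxDl scalemxAl addrCA.
by rewrite (derive_affine_id u x AL) mulmxA mulmx_tr_ip mul_scalar_mx.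
Qed.

Lemma horo_push_ip x u v : ip (-1) (push j tt x u) (push j tt x v) = ip 1 u v.
Proof.
rewrite !horo_push !ipDl !ipDr !ipZl !ipZr ww (ipC _ w) !(Corth _).2 horo_ipC.
by rewrite !mulr0 !addr0.
Qed.

Lemma horo_normal_w x : Defs.normal_space (-1) j tt x w.
Proof. by move=> u; rewrite horo_push ipDr ipZr ww mulr0 addr0 ipC (Corth u).2. Qed.

Lemma horo_normal_j x : Defs.normal_space (-1) j tt x (horo_map C x).
Proof.
move=> u; rewrite horo_push ipDr ipZr horo_ip_w horo_mapE !ipDl ipZl horo_ipC.
by rewrite (ipC _ xi) (ipC _ w) (Corth u).1 (Corth u).2; lra.
Qed.

Lemma horo_inclusion : horosphere_inclusion (horo_map C).
Proof.
split.
- split; last first.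
    by move=> x y e; rewrite -(horo_proj x) e horo_proj.
  split; first exact: horo_smooth.
  move=> [] x _ u v; rewrite !horo_push => e.
  have : forall z : 'rV_n, ip 1 u z = ip 1 v z.
    move=> z; have := congr1 (fun s : 'rV[R]_n.+2 => ip (-1) s (z *m C)) e.
    by rewrite !ipDl !ipZl !horo_ipC (ipC _ w) (Corth z).2 !mulr0 !addr0.
  by apply: ip_eq; rewrite mulr1.
- exact: horo_push_ip.
- exists w; split => //.
    by apply/eqP => w0; move: xiw; rewrite w0 ip0r => /eqP; rewrite eq_sym oppr_eq0 oner_eq0.
  apply/seteqP; split=> [_ [y _ <-]|z [[zz _] zw]].
    split; last exact: horo_ip_w.
    split; first exact: horo_ip_self.
    by move=> _ i i0; rewrite (_ : i = 0) ?horo_future//; exact: val_inj.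
  by exists (z *m (ipmx (-1) _ *m C^T)) => //; rewrite -horo_map_onto.
(* The second derivative of the parametrization is [ip 1 u v *: w]; removing the position vector
   from [w] leaves the part normal inside the hyperbolic space. *)
move=> x; exists (w - horo_map C x); split.
- by move=> u; rewrite ipBl (horo_normal_w x u) (horo_normal_j x u) subrr.
- by rewrite ipBl (ipC _ w) horo_ip_w horo_ip_self subrr.
move=> u v; rewrite /second_form horo_hess subrK.
have -> : ip 1 u v *: w = ip 1 u v *: w + push j tt x 0 by rewrite push0 addr0.
rewrite (normal_part_eq 0 horo_smooth) ?push0 ?addr0//.
  move=> z; rewrite horo_push_ip => zz; apply/eqP/negP => /negP z0.
  by have := ip1_gt0 z0; rewrite zz ltxx.
by move=> z; rewrite ipZl (horo_normal_w x z) mulr0.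
Qed.

End HorosphereMap.

End Horosphere.

Section LorentzianProduct.
Variables (R : realType) (n r : nat) (M : 'I_r -> atlas R).
Variables (ft : prodn M -> 'rV[R]_n.+2) (p1 : prodn M).
Hypothesis r0 : (0 < r)%N.
Hypothesis okM : forall a, charts_ok (M a).
Hypothesis conM : connected [set: prodn M].
Hypothesis sft : smooth_map ft.
Hypothesis orth : forall c p a b u v, a != b -> cdom (prodn M) c p ->
  ip (-1) (push ft c p (block a u)) (push ft c p (block b v)) = 0.
Hypothesis pos : forall c p a u, cdom (prodn M) c p ->
  ip (-1) (push ft c p (block a u)) (push ft c p (block a u)) = 0 -> u = 0.
Hypothesis hess0 : forall c p a b u v, a != b -> cdom (prodn M) c p ->
  hess ft c p (block a u) (block b v) = 0.
Hypothesis dims : forall a, (0 < mdim (M a))%N.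
Hypothesis ft_norm : forall p, ip (-1) (ft p) (ft p) = -1.
Hypothesis ft_future : forall p, 0 < ft p 0 0.

Local Notation U := (tangent_span (-1) ft p1).

Lemma ip_ft_const w : (forall a x, (x <= U a)%MS -> ip (-1) w x = 0) ->
  forall p, ip (-1) (ft p) w = ip (-1) (ft p1) w.
Proof.
move=> wU p; have X0 a (x : 'rV_n.+2) : (x <= U a)%MS -> x *m (ipmx (-1) _ *m w^T) = 0.
  by move=> xU; rewrite mulmxA ip_mx11 ipC (wU a x xU) raddf0.
have := proj_cst okM conM sft hess0 X0 p p1.
by rewrite !mulmxA !ip_mx11 => /(congr1 (fun A : 'M[R]_1 => A 0 0)); rewrite !mxE eqxx.
Qed.

Lemma null_direction_horosphere w : w != 0 -> ip (-1) w w = 0 ->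
  (forall a x, (x <= U a)%MS -> ip (-1) w x = 0) -> horosphere_product ft.
Proof.
move=> w0 ww wU; pose k := ip (-1) (ft p1) w.
have ftk p : ip (-1) (ft p) w = k by exact: ip_ft_const.
have k0 : k != 0.
  apply/negP => /eqP k0; have tl : ip (-1) (ft p1) (ft p1) < 0 by rewrite ft_norm ltrN10.
  by have := timelike_orth_gt0 tl k0 w0; rewrite ww ltxx.
(* A timelike vector has no nonzero null vector in its orthogonal, so [k] is nonzero; the rescaling
   puts [ft] on the slice [ip (-1) x v = -1]. *)
pose v := - k^-1 *: w.
have ftv p : ip (-1) (ft p) v = -1 by rewrite ipZr ftk mulNr mulVf.
have vv : ip (-1) v v = 0 by rewrite ipZl ipZr ww !mulr0.
have vU a (x : 'rV_n.+2) : (x <= U a)%MS -> ip (-1) x v = 0.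
  by move=> xU; rewrite ipZr ipC (wU a x xU) mulr0.
clearbody v.
have [C [CC Corth Cdec]] := horosphere_frame (ft_norm p1) (ftv p1) vv.
pose K := ipmx (-1) _ *m C^T.
have Udec a (x : 'rV_n.+2) : (x <= U a)%MS -> exists b, x = b *: v + x *m K *m C.
  move=> xU; have [b xE] := Cdec x; exists b.
  by rewrite {1}xE (vU a x xU) oppr0 scale0r add0r.
(* On the tangent spans [K] only forgets a multiple of [v], which is null and orthogonal to the rows
   of [C]; hence it is isometric there and the orthogonality of the spans descends to R^n. *)
have UK a b (x y : 'rV_n.+2) : (x <= U a)%MS -> (y <= U b)%MS ->
    ip (-1) x y = ip 1 (x *m K) (y *m K).
  move=> xU yU; have [b1 xE] := Udec a x xU; have [b2 yE] := Udec b y yU.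
  rewrite {1}xE {1}yE !ipDl !ipDr !ipZl !ipZr vv (ipC _ v) !(Corth _).2 (horo_ipC CC).
  by rewrite !mulr0 !add0r.
pose V a : 'M[R]_n := <<U a *m K>>%MS.
have VU a (y : 'rV_n) : (y <= V a)%MS -> exists2 x : 'rV_n.+2, (x <= U a)%MS & y = x *m K.
  rewrite genmxE => /submxP[D ->]; exists (D *m U a); first exact: submxMl.
  by rewrite mulmxA.
have KV a (x : 'rV_n.+2) : (x <= U a)%MS -> (x *m K <= V a)%MS.
  by move=> xU; rewrite genmxE submxMr.
have oU := tangent_span_mutually_orthogonal okM conM sft orth hess0 (p1 := p1).
have oV : mutually_orthogonal 1 V.
  move=> a b y z ab /VU[x xU ->] /VU[x' x'U ->].
  by rewrite -(UK a b)// (oU a b).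
have [m [iota [dec Vio]]] := euclidean_decomp r0 oV.
have [P1 P2 P3] := decomp_projK (sg := fun=> 1) (fun=> mulr1 1) dec.
pose pi a := decomp_proj 1 1 (iota a).
have Vpi a (y : 'rV_n) : (y <= V a)%MS -> y *m pi a *m iota a = y.
  move=> yV; have /submxP[D ->] := submx_trans yV (Vio a).
  by rewrite -(mulmxA D) P1 mulmx1.
have FE p a : ft p *m (K *m pi a) = factor_map ft p1 (p a) *m (K *m pi a).
  apply: (proj_factor okM conM sft hess0) => b ba x xU; rewrite mulmxA.
  have /submxP[D ->] := submx_trans (KV b x xU) (Vio b).
  by rewrite -(mulmxA D) P2 ?mulmx0// eq_sym.
exists m, iota, (fun a z => factor_map ft p1 z *m (K *m pi a)), (horo_map (ft p1) v C); split.
- exact: dec.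
- move=> a; apply: (immersion_factor okM conM sft pos hess0) => x xU.
  rewrite mulmxA => x0; rewrite (UK a a)// -(Vpi a (x *m K)) ?KV//.
  by rewrite x0 mul0mx ip0l.
- exact: (horo_inclusion (ft_norm p1) (ft_future p1) (ftv p1) vv CC Corth Cdec).
move=> p; rewrite {1}(horo_map_onto (ft_norm p1) (ftv p1) vv CC Corth Cdec (ft_norm p) (ftv p)).
rewrite -/K {1}(P3 (ft p *m K)); congr (horo_map _ _ _ _).
by apply: eq_bigr => a _; rewrite -/(pi a) -[ft p *m K *m pi a]mulmxA FE.
Qed.

Lemma lorentzian_product :
  (exists b, quadric_product (-1) (fun a => if a == b then -1 else 1) ft) \/
  horosphere_product ft.
Proof.
have oU := tangent_span_mutually_orthogonal okM conM sft orth hess0 (p1 := p1).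
have [[w [w0 ww wU]]|[b [m [iota [dec Uio fut]]]]] := lorentzian_decomp r0 oU.
  by right; exact: null_direction_horosphere wU.
left; exists b; have ee : (-1) * (-1) = 1 :> R by rewrite mulrNN mulr1.
apply: (quadric_product_of_decomp okM conM sft pos hess0 ft_norm dims _ dec Uio).
  move=> a; have [->|ab] := eqVneq a b; last by left.
  by right; split => // c cb; rewrite (negbTE cb).
move=> a sa z i i0; have ab : a = b.
  by apply/eqP/negP => /negP ab; move: sa; rewrite (negbTE ab) => e; have := @ltr01 R; rewrite e ltr0N1.
move: z i i0; rewrite ab eqxx => z i i0.
have sgK c : (if c == b then -1 else 1) * (if c == b then -1 else 1) = 1 :> R.
  by case: ifP => _; rewrite ?mulr1.
have [_ _ P3] := decomp_projK sgK dec; have [io1 io2 _] := dec.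
have tt : ip (-1) (row i (iota b)) (row i (iota b)) = -1.
  by rewrite rowE io1 eqxx ip_delta i0 eqxx mxE !eqxx mulr1.
(* The first row of [iota b] is future timelike, and so are the values of [ft]; their product is
   minus the coordinate whose sign is sought. *)
have : ip (-1) (factor_map ft p1 z) (row i (iota b)) < 0.
  apply: future_ip_lt0; rewrite ?tt ?ltrN10//; first by rewrite ft_norm ltrN10.
    exact: ft_future.
  by rewrite mxE; exact: fut.
rewrite {1}(P3 (factor_map ft p1 z)) ip_suml (bigD1 b)//= big1 ?addr0; last first.
  by move=> c cb; rewrite rowE io2.
by rewrite rowE io1 eqxx ip_delta i0 eqxx mulN1r oppr_lt0.
Qed.

End LorentzianProduct.

Lemma product_immersion_extrinsic (R : realType) (eps : R) n r (M : 'I_r -> atlas R)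
    (ft : prodn M -> 'rV[R]_n) (p1 : prodn M) :
  eps = 1 \/ eps = -1 -> (1 < n)%N -> (0 < r)%N ->
  (forall a, charts_ok (M a)) -> connected [set: prodn M] -> smooth_map ft ->
  (forall c p a b u v, a != b -> cdom (prodn M) c p ->
    ip eps (push ft c p (block a u)) (push ft c p (block b v)) = 0) ->
  (forall c p a u, cdom (prodn M) c p ->
    ip eps (push ft c p (block a u)) (push ft c p (block a u)) = 0 -> u = 0) ->
  (forall c p a b u v, a != b -> cdom (prodn M) c p ->
    hess ft c p (block a u) (block b v) = 0) ->
  (forall a, (0 < mdim (M a))%N) -> (forall p, spaceform eps n (ft p)) ->
  extrinsic_product eps ft.
Proof.
move=> + n1 r0 okM conM sft + + hess0 dims; case=> ->.
  move=> orth pos spf; split => //; left; split => //.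
  by apply: (euclidean_extrinsic_product p1) => // p; have [] := spf p.
(* Horospheres are parametrized by dimension [n.-2], so [n] is exposed as a double successor. *)
case: n ft n1 sft hess0 => [|[|n]] ft n1 sft hess0 // orth pos spf.
split => //; right; split => //.
apply: (lorentzian_product p1) => // p; have [// h1 h2] := spf p.
exact: h2.
Qed.

Theorem corollary24 (R : realType) (eps : R) (r : nat)
    (M0 : atlas R) (M : 'I_r -> atlas R)
    (g0 : metric M0) (ga : forall a : 'I_r, M0 -> metric (M a))
    (g : metric (prod2 M0 (prodn M)))
    (f : prod2 M0 (prodn M) -> 'rV[R]_(mdim (prod2 M0 (prodn M))).+1) :
  eps = 1 \/ eps = -1 ->
  (0 < r)%N ->
  is_manifold M0 ->
  (forall a, is_manifold (M a)) ->
  (forall a, (0 < mdim (M a))%N) ->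
  [set: prod2 M0 (prodn M)] !=set0 ->
  connected [set: prod2 M0 (prodn M)] ->
  polar g0 ga g ->
  local_isometry eps g f ->
  exists (ft : prodn M -> 'rV[R]_(mdim (prod2 M0 (prodn M))).+1) (s : nat)
         (phi : prodn M -> 'rV[R]_s -> 'rV[R]_(mdim (prod2 M0 (prodn M))).+1)
         (e1 : 'rV[R]_s) (f0 : M0 -> 'rV[R]_s),
    extrinsic_product eps ft /\
    flat_normal_bundle eps ft /\
    parallel_isometry eps ft phi /\
    (forall p : prodn M, phi p e1 = ft p) /\
    local_isometry eps g0 f0 /\
    (forall p0 : M0, Omega eps ft phi (f0 p0 - e1)) /\
    (forall (p0 : M0) (p : prodn M), f (p0, p) = phi p (f0 p0)).
Proof.
move=> heps r0 mM0 mM dims [[q0 q1] _] conP polg isof.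
have okM0 := manifold_charts_ok mM0.
have okM a := manifold_charts_ok (mM a).
have ee : eps * eps = 1 by case: heps => ->; rewrite ?mulr1// mulrNN mulr1.
have conM0 : connected [set: M0].
  have -> : [set: M0] = (fun p : prod2 M0 (prodn M) => p.1 : M0) @` [set: prod2 M0 (prodn M)].
    by apply/seteqP; split=> // p _; exists (p, q1).
  apply: (connected_continuous_connected conP); apply: continuous_subspaceT => p.
  exact: cvg_fst.
have conMt : connected [set: prodn M].
  have -> : [set: prodn M] =
      (fun p : prod2 M0 (prodn M) => p.2 : prodn M) @` [set: prod2 M0 (prodn M)].
    by apply/seteqP; split=> // p _; exists (q0, p).
  apply: (connected_continuous_connected conP); apply: continuous_subspaceT => p.
  exact: cvg_snd.
have [_ [g0T g0pos _ _] gafam _] := polg.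
have gapos a p0 i p u : cdom (M a) i p -> u != 0 -> 0 < gval (ga a p0) i p u u.
  by have [_ + _ _] := (gafam a).1 p0; exact.
have [i0 iq0] := okM0.1 q0.
have [|m [L [LL L1]]] := @orthonormalize _ _ (g0 i0 q0) _ 1%:M (g0T i0 q0 iq0).
  by move=> x _ x0; exact: g0pos.
have mE : m = mdim M0.
  have : row_free L by apply/row_freeP; exists (g0 i0 q0 *m L^T); rewrite mulmxA.
  by rewrite /row_free L1 mxrank1 => /eqP.
move: L LL {L1}; rewrite mE => L LL.
pose ft p := f (q0, p).
pose e1 : 'rV[R]_(1 + mdim M0) := delta_mx 0 0.
pose F p := Phi f q0 i0 L p.
pose h := f0 eps f q0 i0 L q1.
have fE p0 p : f (p0, p) = h p0 *m F p.
  exact: (f0E ee okM0 okM polg isof conM0 g0pos iq0 LL).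
have e1F p : e1 *m F p = ft p by exact: Phi_e1.
have okMt := prodn_charts_ok okM.
have sft : smooth_map ft by exact: smooth_right okM0 isof q0.
have sF : forall c, Csmooth (cmap (prodn M) c @` cdom (prodn M) c) (F \o cinv (prodn M) c).
  by move=> c; exact: (Phi_smooth okM0 okM isof L iq0 c).
have gramF p : F p *m ipmx eps _ *m (F p)^T = ipmx eps _.
  exact: (Phi_gram okM0 okM polg isof iq0 LL p).
have normalF c p : cdom (prodn M) c p ->
    range (fun y => y *m F p) = Defs.normal_space eps ft c p.
  exact: (Phi_normal ee okM0 okM polg isof gapos iq0 LL).
have tangentF c p y u : cdom (prodn M) c p ->
    exists z, push (fun q => y *m F q) c p u = push ft c p z.
  exact: (push_Phi_tangent ee okM0 okM polg isof g0pos L iq0 y u).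
have spanF c p x : cdom (prodn M) c p -> exists y z, x = y *m F p + push ft c p z.
  exact: (span_Phi ee okM0 okM isof iq0 LL x).
(* Stated for every [p0]: the base point gives that [ft] is an immersion, an arbitrary [p0] the
   regularity needed for [Omega]. *)
have imm p0 c p u : cdom (prodn M) c p ->
    ip eps (push (fun q => f (p0, q)) c p u) (push (fun q => f (p0, q)) c p u) = 0 -> u = 0.
  exact: (push_fr_eq0 okM0 polg isof gapos).
have isoh : local_isometry eps g0 h.
  exact: (f0_local_isometry ee okM0 okM polg isof conM0 g0pos iq0 LL).
clearbody F h.
exists ft, (1 + mdim M0)%N, (fun p y => y *m F p), e1, h.
split; [|split; [|split; [|split=> //; split=> //; split=> //]]].
- apply: (product_immersion_extrinsic q1 heps) => //.
  + by rewrite ltnS /= (bigD1 (Ordinal r0))//= addnCA ltn_addr.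
  + by move=> c p a b u v; exact: (push_fr_blocks_orth okM0 polg isof q0).
  + by move=> c p a u; exact: (push_fr_block_eq0 okM0 polg isof gapos).
  + by move=> c p a b u v; exact: (hess_fr_blocks ee okM0 okM polg isof q0).
  + by move=> p; case: isof => _ + _ _; exact.
- by apply: (frame_flat ee okMt sft _ sF gramF normalF tangentF) => c p u; exact: imm.
- by apply: (frame_parallel okMt sft _ sF gramF normalF tangentF) => c p u; exact: imm.
move=> p0; apply: (frame_Omega okMt sft _ sF normalF tangentF spanF e1F).
  by move=> c p u; exact: imm.
(* With [Y = f0 p0 - e1] the sum [e1 + Y] is [f0 p0], so the map to be shown regular is
   [f (p0, _)]. *)
move=> c p u cp; rewrite addrCA subrr addr0 => pu.
have e : (fun q => f (p0, q)) = (fun q => h p0 *m F q) by apply/funext => q; exact: fE.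
by apply: (imm p0 c p u cp); rewrite e pu ip0l.
Qed.
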